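(* There exist absolute numerical constants $c_1,c_2>0$ such that the following holds. Let $\bm{x}\in\mathbb{C}^n$ be a spectrally sparse signal of model order $r$ with $\operatorname{rank}(\mathcal{H}\bm{x})=r$, let $\bm{y}=\mathcal{D}\bm{x}$, so that $\mathcal{G}\bm{y}=\mathcal{H}\bm{x}$, and assume that $\mathcal{G}\bm{y}$ is $\mu_0$-incoherent. Let $\varepsilon_0$ be a constant with $0<\varepsilon_0\le 1/11$, let $\mu\ge\mu_0$, let $\sigma=\sigma_1(\bm{L}^0)/(1-\varepsilon_0)$, and take $\lambda=1/4$ in the definition of $F$. Set $\kappa=\sigma_1(\mathcal{G}\bm{y})/\sigma_r(\mathcal{G}\bm{y})$. Let $\Omega=\{a_k\}_{k=1}^m$, where the $a_k$ are drawn independently and uniformly with replacement from $\{0,\dots,n-1\}$. If $$m\ge c_2\,\varepsilon_0^{-2}\mu^2c_s^2\kappa^2r^2\log(n)$$ and the stepsize $\eta>0$ satisfies $$\eta\le\frac{\sigma_r(\mathcal{G}\bm{y})}{600(\mu c_sr)^2\sigma_1^2(\mathcal{G}\bm{y})},$$ then with probability at least $1-c_1n^{-2}$ the iterates $\{\bm{Z}^k\}_{k\ge1}$ produced by the projected gradient descent algorithm (PGD) satisfy, for all $k\ge 1$, $$\operatorname{dist}^2(\bm{Z}^k,\bm{M})\le(1-\eta\nu)^k\operatorname{dist}^2(\bm{Z}^0,\bm{M}),\qquad \nu=\tfrac1{10}\sigma_r(\mathcal{G}\bm{y}).$$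
   Context: **Signal.** A spectrally sparse signal of model order $r$ is a vector $\bm{x}\in\mathbb{C}^n$ with entries $x_a=\sum_{k=1}^r d_k e^{(2\pi\imath f_k-\tau_k)a}$, $a=0,\dots,n-1$, where $\imath=\sqrt{-1}$, $f_k\in[0,1)$, $\tau_k\ge0$, $d_k\in\mathbb{C}$. **Hankel operators.** Fix positive integers $n_1,n_2$ with $n_1+n_2=n+1$; indices start at $0$. $\mathcal{H}:\mathbb{C}^n\to\mathbb{C}^{n_1\times n_2}$ is $[\mathcal{H}\bm{z}]^{(i,j)}=z_{i+j}$. Let $w_a$ be the number of pairs $(i,j)\in\{0,\dots,n_1-1\}\times\{0,\dots,n_2-1\}$ with $i+j=a$. $\mathcal{D}:\mathbb{C}^n\to\mathbb{C}^n$ multiplies the $a$-th entry by $\sqrt{w_a}$, and $\mathcal{G}=\mathcal{H}\mathcal{D}^{-1}$. Its adjoint $\mathcal{G}^*$ satisfies $\mathcal{G}^*\mathcal{G}=\mathcal{I}$, where $\mathcal{I}$ is the identity. Set $c_s=\max\{n/n_1,n/n_2\}$. **Norms, singular values.** $\|\bm{Z}\|_F$ is the Frobenius norm, $\|\bm{Z}\|_{2,\infty}$ is the largest $\ell_2$-norm of a row of $\bm{Z}$, and $\sigma_i(\cdot)$ is the $i$-th largest singular value. **Incoherence.** Let $\mathcal{G}\bm{y}=\bm{U}\bm{\Sigma}\bm{V}^*$ be the reduced SVD (rank $r$). $\mathcal{G}\bm{y}$ is $\mu_0$-incoherent (with $\mu_0>0$) if $\|\bm{U}\|_{2,\infty}\le\sqrt{\mu_0c_sr/n}$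 and $\|\bm{V}\|_{2,\infty}\le\sqrt{\mu_0c_sr/n}$. **Ground truth and distance.** $\bm{M}=\begin{bmatrix}\bm{U}\bm{\Sigma}^{1/2}\\ \bm{V}\bm{\Sigma}^{1/2}\end{bmatrix}\in\mathbb{C}^{(n+1)\times r}$. For $\bm{Z}\in\mathbb{C}^{(n+1)\times r}$, $\operatorname{dist}(\bm{Z},\bm{M})=\min_{\bm{Q}}\|\bm{Z}-\bm{M}\bm{Q}\|_F$, the minimum being over unitary $\bm{Q}\in\mathbb{C}^{r\times r}$. **Sampling.** $p=m/n$ and $\mathcal{P}_\Omega(\bm{z})=\sum_{k=1}^m z_{a_k}\bm{e}_{a_k}$ (repetitions counted with multiplicity), where $\bm{e}_0,\dots,\bm{e}_{n-1}$ is the canonical basis of $\mathbb{C}^n$. **Objective.** Write $\bm{Z}=\begin{bmatrix}\bm{Z}_U\\ \bm{Z}_V\end{bmatrix}$ with $\bm{Z}_U\in\mathbb{C}^{n_1\times r}$, $\bm{Z}_V\in\mathbb{C}^{n_2\times r}$. With $\langle\bm{a},\bm{b}\rangle=\bm{a}^*\bm{b}$, $$F(\bm{Z})=\|(\mathcal{I}-\mathcal{G}\mathcal{G}^* )(\bm{Z}_U\bm{Z}_V^* )\|_F^2+p^{-1}\langle\mathcal{P}_\Omega(\mathcal{G}^*(\bm{Z}_U\bm{Z}_V^* )-\bm{y}),\mathcal{G}^*(\bm{Z}_U\bm{Z}_V^* )-\bm{y}\rangle+\tfrac{\lambda}{2}\|\bm{Z}_U^*\bm{Z}_U-\bm{Z}_V^*\bm{Z}_V\|_F^2.$$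 Its (Wirtinger) gradient is $\nabla F(\bm{Z})=\begin{bmatrix}\bm{A}\bm{Z}_V+\lambda\bm{Z}_U(\bm{Z}_U^*\bm{Z}_U-\bm{Z}_V^*\bm{Z}_V)\\ \bm{A}^*\bm{Z}_U+\lambda\bm{Z}_V(\bm{Z}_V^*\bm{Z}_V-\bm{Z}_U^*\bm{Z}_U)\end{bmatrix}$, where $\bm{A}=(\mathcal{I}-\mathcal{G}\mathcal{G}^* )(\bm{Z}_U\bm{Z}_V^* )+p^{-1}\mathcal{G}\mathcal{P}_\Omega(\mathcal{G}^*(\bm{Z}_U\bm{Z}_V^* )-\bm{y})$. **Feasible set.** $\mathcal{C}=\{\bm{Z}\in\mathbb{C}^{(n+1)\times r}:\|\bm{Z}\|_{2,\infty}\le\sqrt{\mu c_sr\sigma/n}\}$. $\mathcal{P}_{\mathcal{C}}$ is the Frobenius-norm projection onto $\mathcal{C}$: each row with $\ell_2$-norm larger than $\sqrt{\mu c_sr\sigma/n}$ is rescaled to have exactly that norm, and other rows are unchanged. **PGD algorithm.** Initialization: $\bm{L}^0=p^{-1}\mathcal{T}_r(\mathcal{G}\mathcal{P}_\Omega(\bm{y}))=\bm{U}^0\bm{\Sigma}^0(\bm{V}^0)^*$ (SVD with $r$ singular triples), where $\mathcal{T}_r$ returns a best rank-$r$ approximation; $\tilde{\bm{Z}}^0=\begin{bmatrix}\bm{U}^0(\bm{\Sigma}^0)^{1/2}\\ \bm{V}^0(\bm{\Sigma}^0)^{1/2}\end{bmatrix}$ and $\bm{Z}^0=\mathcal{P}_{\mathcal{C}}(\tilde{\bm{Z}}^0)$.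 Iteration, $k=0,1,\dots$: $\bm{Z}^{k+1}=\mathcal{P}_{\mathcal{C}}(\bm{Z}^k-\eta\nabla F(\bm{Z}^k))$. *)

(* Defs.v *)
From HB Require Import structures.
From mathcomp Require Import all_boot all_order all_algebra.
From mathcomp Require Import all_classical all_reals all_analysis.
From mathcomp Require Import complex.
From mathcomp Require Import zify.
Set Implicit Arguments.
Unset Strict Implicit.
Unset Printing Implicit Defensive.
Import Order.TTheory GRing.Theory Num.Theory.
Import numFieldNormedType.Exports.
Local Open Scope classical_set_scope.
Local Open Scope ring_scope.
Local Open Scope complex_scope.
Local Open Scope sesquilinear_scope.

(* All indices start at 0. [M ^t*] is the conjugate transpose of [M].
   [complex.Re] and [complex.Im] are the [R]-valued real and imaginary parts,
   [normc] is the [R]-valued modulus. *)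

Section LinearAlgebra.
Context {R : realType}.
Local Notation C := R[i].

Definition cexp (z : C) : C :=
  (expR (complex.Re z) * cos (complex.Im z))
    +i* (expR (complex.Re z) * sin (complex.Im z)).

(* <A, B> = tr (A^* B), conjugate-linear in the first argument as in
   <a, b> = a^* b for vectors. *)
Definition mxdot m n (A B : 'M[C]_(m, n)) : C := \tr (A^t* *m B).

Definition frob m n (A : 'M[C]_(m, n)) : R :=
  Num.sqrt (\sum_i \sum_j ComplexField.Normc.normc (A i j) ^+ 2).

Lemma mxdotE m n (A B : 'M[C]_(m, n)) :
  mxdot A B = \sum_i \sum_j (A i j)^* * B i j.
Proof.
rewrite /mxdot /mxtrace exchange_big; apply: eq_bigr => j _.
by rewrite mxE; apply: eq_bigr => i _; rewrite !mxE.
Qed.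

Definition rownorm m n (A : 'M[C]_(m, n)) (i : 'I_m) : R := frob (row i A).

Definition norm2inf m n (A : 'M[C]_(m, n)) : R :=
  \big[Num.max/0]_(i < m) rownorm A i.

(* Singular values in nonincreasing order: the square roots of the eigenvalues
   of A^* A, which are all real and nonnegative. *)
Definition singvals m n (A : 'M[C]_(m, n)) : seq R :=
  sort (fun s t : R => t <= s)
    [seq Num.sqrt (complex.Re (spectral_diag (A^t* *m A) 0 j)) | j <- enum 'I_n].

(* The i-th largest singular value, for i = 1, 2, ... *)
Definition sigma m n (i : nat) (A : 'M[C]_(m, n)) : R :=
  nth 0 (singvals A) i.-1.

Definition realdiag k (s : 'rV[R]_k) : 'M[C]_k := diag_mx (map_mx (real_complex R) s).

(* A = U diag(s) V^* with k singular triples; the last singular values may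
   vanish when rank A < k. *)
Definition is_svd m n k (A : 'M[C]_(m, n))
    (U : 'M[C]_(m, k)) (s : 'rV[R]_k) (V : 'M[C]_(n, k)) : Prop :=
  [/\ U^t* *m U = 1%:M, V^t* *m V = 1%:M,
      (forall i, 0 <= s 0 i) /\ (forall i j : 'I_k, (i <= j)%N -> s 0 j <= s 0 i)
    & A = U *m realdiag s *m V^t*].

(* [ U Sigma^{1/2} ; V Sigma^{1/2} ] *)
Definition balanced m n k
    (U : 'M[C]_(m, k)) (s : 'rV[R]_k) (V : 'M[C]_(n, k)) : 'M[C]_(m + n, k) :=
  col_mx (U *m realdiag (map_mx Num.sqrt s)) (V *m realdiag (map_mx Num.sqrt s)).

(* B is a possible value of T_r(A); the minimizer need not be unique. *)
Definition best_rank_approx m n (r : nat) (A B : 'M[C]_(m, n)) : Prop :=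
  (\rank B <= r)%N /\
  forall B' : 'M[C]_(m, n), (\rank B' <= r)%N -> frob (A - B) <= frob (A - B').

(* The unitary group being compact, the infimum is a minimum. *)
Definition dist m r (Z M : 'M[C]_(m, r)) : R :=
  inf [set frob (Z - M *m Q) | Q in [set Q : 'M[C]_r | Q \is unitarymx]].

(* Frobenius projection onto { Z | norm2inf Z <= B }. *)
Definition clip m r (B : R) (Z : 'M[C]_(m, r)) : 'M[C]_(m, r) :=
  \matrix_(i, j) (if B < rownorm Z i then (B / rownorm Z i)%:C * Z i j else Z i j).

End LinearAlgebra.

Section Model.
Context {R : realType}.
Local Notation C := R[i].

Definition spectrally_sparse (n r : nat) (x : 'cV[C]_n) : Prop :=
  exists (f tau : 'I_r -> R) (d : 'I_r -> C),
    (forall k, 0 <= f k < 1) /\ (forall k, 0 <= tau k) /\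
    forall a : 'I_n,
      x a 0 = \sum_(k < r) d k * cexp (((- tau k) +i* (2 * pi * f k)) * a%:R).

Section Hankel.
Variables (n n1 n2 : nat).

(* When n1 + n2 = n + 1 the sum has exactly one term, namely z_(i+j): see
   [hankelE]. *)
Definition hankel (z : 'cV[C]_n) : 'M[C]_(n1, n2) :=
  \matrix_(i < n1, j < n2) \sum_(a < n | (a == i + j :> nat)%N) z a 0.

Definition weight (a : 'I_n) : nat :=
  #|[pred ij : 'I_n1 * 'I_n2 | (ij.1 + ij.2 == a :> nat)%N]|.

Definition opD (z : 'cV[C]_n) : 'cV[C]_n :=
  \col_a ((Num.sqrt (weight a)%:R)%:C * z a 0).

Definition opDinv (z : 'cV[C]_n) : 'cV[C]_n :=
  \col_a ((Num.sqrt (weight a)%:R)^-1%:C * z a 0).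

Definition opG (z : 'cV[C]_n) : 'M[C]_(n1, n2) := hankel (opDinv z).

(* The adjoint of G, computed on the canonical basis: see [opG_adjoint]. *)
Definition opGadj (Z : 'M[C]_(n1, n2)) : 'cV[C]_n :=
  \col_a mxdot (opG (delta_mx a 0)) Z.

Definition c_s : R := Num.max (n%:R / n1%:R) (n%:R / n2%:R).

Definition incoherent (r : nat) (mu0 : R)
    (U : 'M[C]_(n1, r)) (V : 'M[C]_(n2, r)) : Prop :=
  norm2inf U <= Num.sqrt (mu0 * c_s * r%:R / n%:R) /\
  norm2inf V <= Num.sqrt (mu0 * c_s * r%:R / n%:R).

Lemma hankelE (z : 'cV[C]_n) (i : 'I_n1) (j : 'I_n2) (a : 'I_n) :
  a = (i + j)%N :> nat -> hankel z i j = z a 0.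
Proof.
by move=> aE; rewrite mxE (big_pred1 a) // => b; rewrite /= -aE.
Qed.

Lemma weight_gt0 (a : 'I_n) : (0 < n1)%N -> (0 < n2)%N ->
  (n1 + n2 = n.+1)%N -> (0 < weight a)%N.
Proof.
move=> n1_gt0 n2_gt0 n12; have := ltn_ord a.
have i_lt : (minn a n1.-1 < n1)%N by lia.
move=> a_lt; have j_lt : (a - minn a n1.-1 < n2)%N by lia.
apply/card_gt0P; exists (Ordinal i_lt, Ordinal j_lt).
by rewrite inE /=; apply/eqP; lia.
Qed.

Lemma opG_adjoint (z : 'cV[C]_n) (Z : 'M[C]_(n1, n2)) :
  (n1 + n2 = n.+1)%N -> mxdot (opG z) Z = mxdot z (opGadj Z).
Proof.
move=> n12; rewrite [RHS]mxdotE.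
under eq_bigr => a _ do rewrite big_ord1 [opGadj _ _ _]mxE mxdotE mulr_sumr.
rewrite exchange_big mxdotE; apply: eq_bigr => i _ /=.
under [RHS]eq_bigr => a _ do rewrite mulr_sumr.
rewrite exchange_big; apply: eq_bigr => j _ /=.
under [RHS]eq_bigr => a _ do rewrite mulrA.
rewrite -mulr_suml; congr (_ * _).
have ij_lt : (i + j < n)%N by have := ltn_ord i; have := ltn_ord j; lia.
rewrite (hankelE _ (a := Ordinal ij_lt)) //.
rewrite (bigD1 (Ordinal ij_lt)) //= big1 => [|b bD]; last first.
  rewrite (hankelE _ (a := Ordinal ij_lt)) // !mxE eq_sym (negbTE bD).
  by rewrite !mulr0 rmorph0 mulr0.
rewrite (hankelE _ (a := Ordinal ij_lt)) // addr0 !mxE !eqxx mulr1 rmorphM.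
by rewrite mulrC.
Qed.

End Hankel.

Lemma opGK (n n1 n2 : nat) (z : 'cV[C]_n) : (0 < n1)%N -> (0 < n2)%N ->
  (n1 + n2 = n.+1)%N -> opGadj n (opG n1 n2 z) = z.
Proof.
move=> n1_gt0 n2_gt0 n12; apply/matrixP => a k; rewrite ord1 mxE mxdotE.
have w_gt0 := weight_gt0 a n1_gt0 n2_gt0 n12.
rewrite pair_bigA /=.
pose c : C := ((Num.sqrt (weight n1 n2 a)%:R)^-1%:C).
rewrite (bigID (fun ij : 'I_n1 * 'I_n2 => (ij.1 + ij.2 == a :> nat)%N)) /=.
rewrite [X in _ + X]big1 ?addr0; last first.
  move=> [i j] /= /negbTE ij; rewrite mxE big1 ?rmorph0 ?mul0r// => b /eqP bE.
  by rewrite !mxE -val_eqE /= bE ij mulr0.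
transitivity (\sum_(ij : 'I_n1 * 'I_n2 | (ij.1 + ij.2 == a :> nat)%N) (c * c * z a 0)).
  apply: eq_bigr => -[i j] /= /eqP ij.
  rewrite !(hankelE _ (a := a)) // !mxE !eqxx mulr1 -/c mulrA; congr (_ * _ * _).
  exact: conjc_real.
rewrite sumr_const.
rewrite (_ : #|[pred ij : 'I_n1 * 'I_n2 | (ij.1 + ij.2 == a :> nat)%N]| =
  weight n1 n2 a); last by [].
rewrite -mulr_natl mulrA.
have -> : (weight n1 n2 a)%:R * (c * c) = 1 :> C; last by rewrite mul1r.
rewrite /c -rmorphM -invfM -expr2 sqr_sqrtr // -(rmorph_nat (real_complex R)) -rmorphM.
by rewrite mulfV ?rmorph1 // pnatr_eq0 -lt0n.
Qed.

Definition opP (n m : nat) (a : 'I_m -> 'I_n) (z : 'cV[C]_n) : 'cV[C]_n :=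
  \sum_(k < m) z (a k) 0 *: delta_mx (a k) 0.

Section Algorithm.
Variables (n n1 n2 m r : nat) (y : 'cV[C]_n) (a : 'I_m -> 'I_n).

Let p : R := m%:R / n%:R.
Local Notation G := (@opG n n1 n2).
Local Notation Gadj := (@opGadj n n1 n2).
Local Notation ZU Z := (usubmx Z : 'M[C]_(n1, r)).
Local Notation ZV Z := (dsubmx Z : 'M[C]_(n2, r)).

Definition objective (lam : R) (Z : 'M[C]_(n1 + n2, r)) : R :=
  let X := ZU Z *m (ZV Z)^t* in
  frob (X - G (Gadj X)) ^+ 2
  + p^-1 * complex.Re (mxdot (opP a (Gadj X - y)) (Gadj X - y))
  + lam / 2 * frob ((ZU Z)^t* *m ZU Z - (ZV Z)^t* *m ZV Z) ^+ 2.

(* The Wirtinger gradient of [objective]: at t = 0 the derivative of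
   t |-> objective (Z + t W), for real t, is 2 Re <gradient Z, W>. *)
Definition gradient (lam : R) (Z : 'M[C]_(n1 + n2, r)) : 'M[C]_(n1 + n2, r) :=
  let X := ZU Z *m (ZV Z)^t* in
  let A := X - G (Gadj X) + p^-1%:C *: G (opP a (Gadj X - y)) in
  let E := (ZU Z)^t* *m ZU Z - (ZV Z)^t* *m ZV Z in
  col_mx (A *m ZV Z + lam%:C *: (ZU Z *m E))
         (A^t* *m ZU Z + lam%:C *: (ZV Z *m (- E))).

(* L0 with singular value decomposition U0 diag(s0) V0^* is a possible outcome
   of the spectral initialization. *)
Definition pgd_init (L0 : 'M[C]_(n1, n2))
    (U0 : 'M[C]_(n1, r)) (s0 : 'rV[R]_r) (V0 : 'M[C]_(n2, r)) : Prop :=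
  (exists2 T : 'M[C]_(n1, n2),
     best_rank_approx r (G (opP a y)) T & L0 = p^-1%:C *: T) /\
  is_svd L0 U0 s0 V0.

(* Row bound defining the feasible set C; [sig] is the parameter sigma. *)
Definition feasible_bound (mu sig : R) : R :=
  Num.sqrt (mu * c_s n n1 n2 * r%:R * sig / n%:R).

Definition pgd_iter (lam mu sig eta : R) (Ztilde0 : 'M[C]_(n1 + n2, r)) (k : nat) :
    'M[C]_(n1 + n2, r) :=
  let B := feasible_bound mu sig in
  iter k (fun Z => clip B (Z - eta%:C *: gradient lam Z)) (clip B Ztilde0).

End Algorithm.

End Model.

Section Sampling.
Context {R : realType} {d : measure_display} {T : measurableType d}.
Variables (P : probability T R) (m n : nat) (a : 'I_m -> T -> 'I_n).

(* The index set 'I_n carries its discrete sigma-algebra. *)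
Definition mutually_independent : Prop :=
  forall (J : {set 'I_m}) (B : 'I_m -> set 'I_n),
    P (\bigcap_(k in [set` J]) a k @^-1` B k) =
    (\prod_(k in J) P (a k @^-1` B k))%E.

Definition iid_uniform : Prop :=
  [/\ forall k (B : set 'I_n), measurable (a k @^-1` B),
      mutually_independent
    & forall k (j : 'I_n), P (a k @^-1` [set j]) = (n%:R^-1)%:E].

End Sampling.

(* Main.v *)
Require Import Defs.
From HB Require Import structures.
From mathcomp Require Import all_boot all_order all_algebra.
From mathcomp Require Import all_classical all_reals all_analysis.
From mathcomp Require Import cyclic separable cyclotomic.
From mathcomp Require Import complex.
From mathcomp Require Import ring lra zify.
Set Implicit Arguments.
Unset Strict Implicit.
Unset Printing Implicit Defensive.
Import Order.TTheory GRing.Theory Num.Theory.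
Import numFieldNormedType.Exports.
Local Open Scope classical_set_scope.
Local Open Scope ring_scope.

(* The discrete Fourier transform diagonalizes Hankel matrices up to
   contractions, so the operator norm of [hankel z] is at most the largest modulus
   of the transform of [z]. A Bernstein inequality for each of the [n] frequencies
   therefore bounds the operator norm of the sampling error of [x], hence the
   initialization error by [eps0 sigma_r], and that of the all-ones signal, hence
   the sampled energy of [A B^*] for any [A], [B] with small rows. A
   dimension-free (Hilbert space) Bernstein inequality, applied to the kernel of
   the quadratic form [L |-> (n / m) |P_Omega (G^* P_T L)|^2] with values in the
   Hilbert-Schmidt operators, gives the restricted isometry on the tangent space at
   [G y].

   Outside these exceptional samples everything is deterministic. For the optimal
   rotation [Q] and [H = Z - M Q], the matrix [Z^* M Q] is positive semidefinite.
   The first-order term [L = M_U H_V^* + H_U M_V^*] of [Z_U Z_V^* - M_U M_V^*] is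
   tangent, so the restricted isometry and the balancing term give the gradient a
   curvature of order [sigma_r |H|^2]; the quadratic remainder [H_U H_V^*] is
   controlled by the row bounds of the feasible set. Hence one gradient step
   contracts [|H|^2] by [1 - eta nu], and clipping the rows does not increase the
   distance to [M Q], which is itself feasible. *)

(** * The real inner product of complex matrices *)

(** Factors are determined only up to a unitary rotation, so no fixed target is available: each step
    takes the optimal rotation of the current iterate, while the induction remembers only that some
    rotation is within squared distance [sigma_r / 10]. All exceptional events are counted: a set of
    functions from ['I_m] to ['I_n] has probability its cardinality over [n^m], and moments become
    finite sums over functions. The union over [n] frequencies costs a factor [n], hence the
    exponents [3 ln n]; a net of matrices would cost far more, hence a dimension-free inequality for
    the restricted isometry. Constants, with [m0 = mu c_s r] and [s1 = sigma_1]: the strictest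
    demand on [m] comes from the all-ones signal, whose relative error must be at most
    [sigma_r / (100 m0 s1)]; it yields [c2 = 3 * 4 * 100^2]. Three families of exceptional samples,
    each of proportion at most [2 n^-2], yield [c1 = 6]. The bound [1/11] is where
    [(1 + eps0) / (1 - eps0)] reaches [6/5], the factor by which [sigma] may exceed [s1]. *)

Section RealInnerProduct.
Local Open Scope complex_scope.
Local Open Scope sesquilinear_scope.
Context {R : realType}.
Local Notation C := R[i].

(** Gradients of a real objective pair with this real inner product. Most norm bounds are stated for
    [rdot A A] rather than [frob A], so that they stay polynomial. *)
Definition rdot m n (A B : 'M[C]_(m, n)) : R := complex.Re (mxdot A B).

Lemma cReD (x y : C) : complex.Re (x + y) = complex.Re x + complex.Re y.
Proof. by case: x; case: y. Qed.

Lemma cImD (x y : C) : complex.Im (x + y) = complex.Im x + complex.Im y.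
Proof. by case: x; case: y. Qed.

Lemma cReM (x y : C) :
  complex.Re (x * y) = complex.Re x * complex.Re y - complex.Im x * complex.Im y.
Proof. by case: x; case: y. Qed.

Lemma cImM (x y : C) :
  complex.Im (x * y) = complex.Re x * complex.Im y + complex.Im x * complex.Re y.
Proof. by case: x; case: y. Qed.

Lemma cReJ (x : C) : complex.Re x^* = complex.Re x.
Proof. by case: x. Qed.

Lemma cImJ (x : C) : complex.Im x^* = - complex.Im x.
Proof. by case: x. Qed.

Lemma cRe_sum (I : Type) (r : seq I) (P : pred I) (F : I -> C) :
  complex.Re (\sum_(i <- r | P i) F i) = \sum_(i <- r | P i) complex.Re (F i).
Proof. by apply: (big_morph (@complex.Re R)) => // x y; rewrite cReD. Qed.

Lemma cIm_sum (I : Type) (r : seq I) (P : pred I) (F : I -> C) :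
  complex.Im (\sum_(i <- r | P i) F i) = \sum_(i <- r | P i) complex.Im (F i).
Proof. by apply: (big_morph (@complex.Im R)) => // x y; rewrite cImD. Qed.

Definition nrm2 (z : C) : R := complex.Re z ^+ 2 + complex.Im z ^+ 2.

Lemma nrm2_ge0 z : 0 <= nrm2 z.
Proof. by rewrite addr_ge0 // sqr_ge0. Qed.

Lemma nrm2M x y : nrm2 (x * y) = nrm2 x * nrm2 y.
Proof. by rewrite /nrm2 cReM cImM; ring. Qed.

Lemma nrm2J x : nrm2 x^* = nrm2 x.
Proof. by rewrite /nrm2 cReJ cImJ sqrrN. Qed.

Lemma nrm2_real (x : R) : nrm2 x%:C = x ^+ 2.
Proof. by rewrite /nrm2 /= expr0n /= addr0. Qed.

Lemma nrm2_eq0 z : nrm2 z = 0 -> z = 0.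
Proof.
case: z => a b; rewrite /nrm2 /= => ab0.
have /eqP : a ^+ 2 = 0 by have := sqr_ge0 a; have := sqr_ge0 b; lra.
have /eqP : b ^+ 2 = 0 by have := sqr_ge0 a; have := sqr_ge0 b; lra.
by rewrite !sqrf_eq0 => /eqP -> /eqP ->.
Qed.

Lemma nrm2C (z : C) : (nrm2 z)%:C = z^* * z.
Proof. by case: z => a b; rewrite /nrm2; simpc; congr (_ +i* _); ring. Qed.

Lemma normc_sqr (z : C) : ComplexField.Normc.normc z ^+ 2 = nrm2 z.
Proof. by case: z => a b; rewrite /= sqr_sqrtr // addr_ge0 // sqr_ge0. Qed.

Lemma rdotE m n (A B : 'M[C]_(m, n)) : rdot A B = \sum_i \sum_j
  (complex.Re (A i j) * complex.Re (B i j) + complex.Im (A i j) * complex.Im (B i j)).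
Proof.
rewrite /rdot mxdotE cRe_sum; apply: eq_bigr => i _; rewrite cRe_sum.
by apply: eq_bigr => j _; rewrite cReM cReJ cImJ mulNr opprK.
Qed.

Lemma rdotC m n (A B : 'M[C]_(m, n)) : rdot A B = rdot B A.
Proof.
rewrite !rdotE; apply: eq_bigr => i _; apply: eq_bigr => j _.
by rewrite mulrC [X in _ + X]mulrC.
Qed.

Lemma rdotDr m n (A B D : 'M[C]_(m, n)) : rdot A (B + D) = rdot A B + rdot A D.
Proof. by rewrite /rdot /mxdot mulmxDr raddfD cReD. Qed.

Lemma rdotDl m n (A B D : 'M[C]_(m, n)) : rdot (B + D) A = rdot B A + rdot D A.
Proof. by rewrite rdotC rdotDr !(rdotC A). Qed.

Lemma rdotZr m n (A B : 'M[C]_(m, n)) (c : R) : rdot A (c%:C *: B) = c * rdot A B.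
Proof.
by rewrite /rdot /mxdot -scalemxAr mxtraceZ cReM /= mul0r subr0.
Qed.

Lemma rdotZl m n (A B : 'M[C]_(m, n)) (c : R) : rdot (c%:C *: B) A = c * rdot B A.
Proof. by rewrite rdotC rdotZr rdotC. Qed.

Lemma rdotNr m n (A B : 'M[C]_(m, n)) : rdot A (- B) = - rdot A B.
Proof.
by rewrite (_ : - B = (-1 : R)%:C *: B) ?rdotZr ?mulN1r // rmorphN rmorph1 scaleN1r.
Qed.

Lemma rdotNl m n (A B : 'M[C]_(m, n)) : rdot (- B) A = - rdot B A.
Proof. by rewrite rdotC rdotNr rdotC. Qed.

Lemma rdot0r m n (A : 'M[C]_(m, n)) : rdot A 0 = 0.
Proof. by rewrite -(scale0r (0 : 'M[C]_(m, n))) (rdotZr _ _ 0) mul0r. Qed.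

Lemma rdot_sumr m n (A : 'M[C]_(m, n)) (I : Type) (r : seq I) (P : pred I) F :
  rdot A (\sum_(i <- r | P i) F i) = \sum_(i <- r | P i) rdot A (F i).
Proof.
apply: (big_morph (rdot A)); first exact: rdotDr.
exact: rdot0r.
Qed.

Lemma rdot_nrm2 m n (A : 'M[C]_(m, n)) : rdot A A = \sum_i \sum_j nrm2 (A i j).
Proof. by rewrite rdotE; apply: eq_bigr => i _; apply: eq_bigr => j _. Qed.

Lemma rdot_ge0 m n (A : 'M[C]_(m, n)) : 0 <= rdot A A.
Proof.
by rewrite rdot_nrm2; apply: sumr_ge0 => i _; apply: sumr_ge0 => j _; exact: nrm2_ge0.
Qed.

Lemma frob_sqr m n (A : 'M[C]_(m, n)) : frob A ^+ 2 = rdot A A.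
Proof.
have E : \sum_i \sum_j ComplexField.Normc.normc (A i j) ^+ 2 = rdot A A.
  rewrite rdot_nrm2; apply: eq_bigr => i _; apply: eq_bigr => j _.
  exact: normc_sqr.
by rewrite /frob E sqr_sqrtr // rdot_ge0.
Qed.

Lemma frobE m n (A : 'M[C]_(m, n)) : frob A = Num.sqrt (rdot A A).
Proof. by rewrite -frob_sqr sqrtr_sqr ger0_norm // sqrtr_ge0. Qed.

Lemma frob_ge0 m n (A : 'M[C]_(m, n)) : 0 <= frob A.
Proof. exact: sqrtr_ge0. Qed.

Lemma rdot_eq0 m n (A : 'M[C]_(m, n)) : rdot A A = 0 -> A = 0.
Proof.
rewrite rdot_nrm2 => /eqP; rewrite psumr_eq0 => [/allP A0|i _]; last first.
  by apply: sumr_ge0 => j _; exact: nrm2_ge0.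
apply/matrixP => i j; rewrite mxE; apply: nrm2_eq0.
have := A0 i (mem_index_enum _); rewrite psumr_eq0 => [/allP/(_ j (mem_index_enum _))|k _].
  by move=> /eqP.
exact: nrm2_ge0.
Qed.

Lemma rdot_CS2 m n (A B : 'M[C]_(m, n)) : rdot A B ^+ 2 <= rdot A A * rdot B B.
Proof.
have [B0|B0] := eqVneq (rdot B B) 0.
  by rewrite (rdot_eq0 B0) rdot0r expr0n /= rdot0r mulr0.
have Bgt0 : 0 < rdot B B by rewrite lt_def B0 rdot_ge0.
have := rdot_ge0 ((rdot B B)%:C *: A - (rdot A B)%:C *: B).
rewrite rdotDl !rdotDr !rdotNl !rdotNr !rdotZl !rdotZr (rdotC B A).
set b := rdot B B; set c := rdot A B; set a := rdot A A => h.
have {}h : 0 <= b * (a * b - c ^+ 2) by move: h; rewrite -/b; nra.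
by move: h; rewrite pmulr_rge0 // subr_ge0.
Qed.

Lemma rdot_CS m n (A B : 'M[C]_(m, n)) : `|rdot A B| <= frob A * frob B.
Proof.
rewrite -ler_sqr ?nnegrE ?mulr_ge0 ?frob_ge0 //.
by rewrite real_normK ?num_real // exprMn !frob_sqr rdot_CS2.
Qed.

Lemma rdot_CSw m n (A B : 'M[C]_(m, n)) : rdot A B <= frob A * frob B.
Proof. exact: le_trans (ler_norm _) (rdot_CS _ _). Qed.

Lemma frobD m n (A B : 'M[C]_(m, n)) : frob (A + B) <= frob A + frob B.
Proof.
rewrite -ler_sqr ?nnegrE ?addr_ge0 ?frob_ge0 // sqrrD !frob_sqr rdotDl !rdotDr.
by rewrite (rdotC B A); have := rdot_CSw A B; lra.
Qed.

Lemma rdot_adjl m n p (A : 'M[C]_(m, n)) (B : 'M[C]_(n, p)) D :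
  rdot (A *m B) D = rdot B (A^t* *m D).
Proof. by rewrite /rdot /mxdot trmx_mul map_mxM mulmxA. Qed.

Lemma rdot_adjr m n p (A : 'M[C]_(m, n)) (B : 'M[C]_(n, p)) D :
  rdot (A *m B) D = rdot A (D *m B^t*).
Proof.
by rewrite /rdot /mxdot trmx_mul map_mxM -mulmxA mxtrace_mulC mulmxA.
Qed.

Lemma rdot_adj m n (A B : 'M[C]_(m, n)) : rdot (A^t*) (B^t*) = rdot A B.
Proof.
rewrite !rdotE exchange_big; apply: eq_bigr => i _; apply: eq_bigr => j _.
by rewrite !mxE !cReJ !cImJ mulrNN.
Qed.

Lemma frob_adj m n (A : 'M[C]_(m, n)) : frob (A^t*) = frob A.
Proof. by rewrite !frobE rdot_adj. Qed.

Lemma adjM m n p (A : 'M[C]_(m, n)) (B : 'M[C]_(n, p)) : (A *m B)^t* = B^t* *m A^t*.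
Proof. by rewrite trmx_mul map_mxM. Qed.

Lemma adjD m n (A B : 'M[C]_(m, n)) : (A + B)^t* = A^t* + B^t*.
Proof. by rewrite raddfD map_mxD. Qed.

Lemma adjN m n (A : 'M[C]_(m, n)) : (- A)^t* = - A^t*.
Proof. by rewrite raddfN map_mxN. Qed.

Lemma rdot_col m1 m2 n (A1 B1 : 'M[C]_(m1, n)) (A2 B2 : 'M[C]_(m2, n)) :
  rdot (col_mx A1 A2) (col_mx B1 B2) = rdot A1 B1 + rdot A2 B2.
Proof.
rewrite !rdotE big_split_ord /=; congr (_ + _); apply: eq_bigr => i _;
  by apply: eq_bigr => j _; rewrite ?col_mxEu ?col_mxEd.
Qed.

Lemma rdot_rows m n (A B : 'M[C]_(m, n)) : rdot A B = \sum_i rdot (row i A) (row i B).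
Proof.
rewrite rdotE; apply: eq_bigr => i _; rewrite rdotE big_ord1.
by apply: eq_bigr => j _; rewrite !mxE.
Qed.

Lemma rdot_row_col m n (A B : 'M[C]_(m, n)) : rdot A B = \sum_j rdot (col j A) (col j B).
Proof.
rewrite rdotE exchange_big; apply: eq_bigr => j _; rewrite rdotE.
by apply: eq_bigr => i _; rewrite big_ord1 !mxE.
Qed.

(** Complex Cauchy-Schwarz from the real one: scaling the row by the value [z] of the product makes
    the inner product the real number [nrm2 z]. *)
Lemma nrm2_mulmx m n p (A : 'M[C]_(m, n)) (B : 'M[C]_(n, p)) i j :
  nrm2 ((A *m B) i j) <= rdot (row i A) (row i A) * rdot (col j B) (col j B).
Proof.
set z := (A *m B) i j.
have zE : z = ((row i A) *m col j B) 0 0.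
  by rewrite /z !mxE; apply: eq_bigr => k _; rewrite !mxE.
have [z0|z0] := eqVneq (nrm2 z) 0.
  by rewrite z0 mulr_ge0 ?rdot_ge0.
have zgt0 : 0 < nrm2 z by rewrite lt_def z0 nrm2_ge0.
have E : rdot (z *: (row i A)^t*) (col j B) = nrm2 z.
  rewrite /rdot /mxdot linearZ /= map_mxZ trmxCK -scalemxAl.
  rewrite /mxtrace big_ord1 !mxE -/z.
  transitivity (complex.Re (z^* * z)); last by rewrite -nrm2C.
  by rewrite zE !mxE; congr complex.Re; congr (_ * _); apply: eq_bigr => k _; rewrite !mxE /= conjCK.
have := rdot_CS2 (z *: (row i A)^t*) (col j B).
have -> : rdot (z *: (row i A)^t*) (z *: (row i A)^t*) = nrm2 z * rdot (row i A) (row i A).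
  rewrite -(rdot_adj (row i A)) !rdot_nrm2 big_distrr /=; apply: eq_bigr => k _.
  by rewrite big_distrr /=; apply: eq_bigr => l _; rewrite !mxE nrm2M.
by rewrite E expr2 -mulrA ler_pM2l.
Qed.

Lemma rdot_mulmx m n p (A : 'M[C]_(m, n)) (B : 'M[C]_(n, p)) :
  rdot (A *m B) (A *m B) <= rdot A A * rdot B B.
Proof.
rewrite rdot_nrm2 (rdot_rows A) (rdot_row_col B) big_distrl /=.
apply: ler_sum => i _; rewrite big_distrr /=; apply: ler_sum => j _.
exact: nrm2_mulmx.
Qed.

Lemma frob_mulmx m n p (A : 'M[C]_(m, n)) (B : 'M[C]_(n, p)) :
  frob (A *m B) <= frob A * frob B.
Proof.
by rewrite !frobE -sqrtrM ?rdot_ge0 // ler_wsqrtr // rdot_mulmx.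
Qed.

Lemma rdot_isoml m n p (U : 'M[C]_(m, n)) (A B : 'M[C]_(n, p)) :
  U^t* *m U = 1%:M -> rdot (U *m A) (U *m B) = rdot A B.
Proof. by move=> U1; rewrite rdot_adjl mulmxA U1 mul1mx. Qed.

Lemma rdot_isomr m n p (U : 'M[C]_(p, n)) (A B : 'M[C]_(m, n)) :
  U^t* *m U = 1%:M -> rdot (A *m U^t*) (B *m U^t*) = rdot A B.
Proof. by move=> U1; rewrite rdot_adjr trmxCK -mulmxA U1 mulmx1. Qed.

(** Bessel's inequality, from [|A - U U^* A|^2 >= 0]. *)
Lemma rdot_coisoml m n p (U : 'M[C]_(m, n)) (A : 'M[C]_(m, p)) :
  U^t* *m U = 1%:M -> rdot (U^t* *m A) (U^t* *m A) <= rdot A A.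
Proof.
move=> U1; have := rdot_ge0 (A - U *m (U^t* *m A)).
rewrite rdotDl !rdotDr !rdotNl !rdotNr rdot_isoml // (rdotC A) !rdot_adjl.
by rewrite -rdot_adjl rdotC; have := rdotC (U^t* *m A) (U^t* *m A); lra.
Qed.

Lemma rdot_coisomr m n p (U : 'M[C]_(n, p)) (A : 'M[C]_(m, n)) :
  U^t* *m U = 1%:M -> rdot (A *m U) (A *m U) <= rdot A A.
Proof.
by move=> U1; rewrite -rdot_adj -(rdot_adj A A) adjM rdot_coisoml.
Qed.

End RealInnerProduct.

(** * Polar decomposition and optimal rotations *)

Section Procrustes.
Local Open Scope complex_scope.
Local Open Scope sesquilinear_scope.
Context {R : realType}.
Local Notation C := R[i].

Lemma realC_sum (I : Type) (r : seq I) (P : pred I) (F : I -> R) :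
  (\sum_(i <- r | P i) F i)%:C = \sum_(i <- r | P i) (F i)%:C :> C.
Proof. exact: rmorph_sum. Qed.

Lemma adj_realdiag k (s : 'rV[R]_k) : (realdiag s)^t* = realdiag s.
Proof.
apply/matrixP => i j; rewrite !mxE eq_sym.
have [->|_] := eqVneq i j; last by rewrite !mulr0n rmorph0.
by rewrite !mulr1n; exact: conjc_real.
Qed.

Lemma mul_realdiag k (s t : 'rV[R]_k) :
  realdiag s *m realdiag t = realdiag (\row_i (s 0 i * t 0 i)).
Proof.
apply/matrixP => i j; rewrite mul_diag_mx !mxE.
have [->|_] := eqVneq i j; last by rewrite !mulr0n mulr0.
by rewrite !mulr1n rmorphM.
Qed.

Lemma realdiag1 k (s : 'rV[R]_k) : (forall i, s 0 i = 1) -> realdiag s = 1%:M.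
Proof.
move=> s1; apply/matrixP => i j; rewrite !mxE s1.
by case: (i == j); rewrite ?mulr1n ?mulr0n // rmorph1.
Qed.

Lemma adj_unitary n (Q : 'M[C]_n) : Q \is unitarymx -> Q^t* \is unitarymx.
Proof. by move=> Qu; rewrite trmxC_unitary. Qed.

Lemma unitary_adjK n (Q : 'M[C]_n) : Q \is unitarymx -> Q^t* *m Q = 1%:M.
Proof. by move=> Qu; rewrite -invmx_unitary // mulVmx // unitarymx_unit. Qed.

Lemma unitary_Kadj n (Q : 'M[C]_n) : Q \is unitarymx -> Q *m Q^t* = 1%:M.
Proof. by move/unitarymxP. Qed.

Lemma unitmx_ker n (A : 'M[C]_n) :
  (forall k (X : 'M[C]_(k, n)), X *m A = 0 -> X = 0) -> A \in unitmx.
Proof.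
by move=> inj; rewrite -row_free_unit -kermx_eq0; apply/eqP/inj; rewrite mulmx_ker.
Qed.

(* With [A^* A = P^* diag(l) P], the unitary factor is [A P^* diag(l)^{-1/2} P]. *)
Lemma polar n (A : 'M[C]_n) : A \in unitmx ->
  exists Q T : 'M[C]_n, Q \is unitarymx /\ Q^t* *m A = T^t* *m T.
Proof.
move=> Au; pose P := spectralmx (A^t* *m A).
have Pu : P \is unitarymx by exact: spectral_unitarymx.
pose B := A *m P^t*.
have nA : A^t* *m A \is normalmx.
  by apply/normalmxP; rewrite !adjM !trmxCK.
have /orthomx_spectralP AE := nA.
have BB : B^t* *m B = diag_mx (spectral_diag (A^t* *m A)).
  rewrite /B adjM trmxCK mulmxA -(mulmxA P) {1}AE -/P invmx_unitary //.
  by rewrite !mulmxA (unitary_Kadj Pu) mul1mx -mulmxA (unitary_Kadj Pu) mulmx1.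
pose l : 'rV[R]_n := \row_j rdot (col j B) (col j B).
have BE : B^t* *m B = realdiag l.
  apply/matrixP => i j; have [<-|ij] := eqVneq i j; last first.
    by rewrite BB !mxE (negbTE ij).
  rewrite !mxE eqxx mulr1n rdot_nrm2 realC_sum; apply: eq_bigr => k _.
  by rewrite big_ord1 nrm2C !mxE.
have Bu : B \in unitmx by rewrite unitmx_mul Au (unitarymx_unit (adj_unitary Pu)).
have l_gt0 j : 0 < l 0 j.
  rewrite mxE lt_def rdot_ge0 andbT; apply/eqP => /rdot_eq0 Bj0.
  have : delta_mx j 0 = 0 :> 'cV[C]_n.
    by rewrite -(mulKmx Bu (delta_mx j 0)) -colE Bj0 mulmx0.
  by move/matrixP/(_ j 0); rewrite !mxE !eqxx => /eqP; rewrite oner_eq0.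
pose s : 'rV[R]_n := \row_j Num.sqrt (l 0 j).
pose si : 'rV[R]_n := \row_j (Num.sqrt (l 0 j))^-1.
pose t : 'rV[R]_n := \row_j Num.sqrt (s 0 j).
have s_gt0 j : 0 < s 0 j by rewrite mxE sqrtr_gt0.
have ss : realdiag si *m realdiag l = realdiag s.
  rewrite mul_realdiag; congr realdiag; apply/rowP => j; rewrite !mxE.
  rewrite -{2}(sqr_sqrtr (rdot_ge0 _)) expr2 mulrA mulVf ?mul1r //.
  by have := s_gt0 j; rewrite !mxE => /gt_eqF ->.
have tt : realdiag t *m realdiag t = realdiag s.
  rewrite mul_realdiag; congr realdiag; apply/rowP => j.
  by rewrite mxE -expr2 mxE sqr_sqrtr // ltW.
have sis : realdiag s *m realdiag si = 1%:M.
  rewrite mul_realdiag realdiag1 // => j; rewrite !mxE mulfV //.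
  by have := s_gt0 j; rewrite !mxE => /gt_eqF ->.
exists (B *m realdiag si *m P), (realdiag t *m P); split.
  apply: mul_unitarymx Pu; rewrite -(trmxCK (_ *m _)); apply: adj_unitary.
  apply/unitarymxP; rewrite trmxCK adjM adj_realdiag mulmxA -(mulmxA _ _ B) BE.
  by rewrite ss sis.
have AB : A = B *m P by rewrite /B -mulmxA (unitary_adjK Pu) mulmx1.
clearbody B; rewrite [in LHS]AB !adjM !adj_realdiag !mulmxA; congr (_ *m P).
by rewrite -2!mulmxA BE -[RHS]mulmxA tt ss.
Qed.

Section Distance.
Variables (m r : nat) (Z M : 'M[C]_(m, r)).

Lemma rdot_mul_unitary k (A B : 'M[C]_(k, r)) (Q : 'M[C]_r) :
  Q \is unitarymx -> rdot (A *m Q) (B *m Q) = rdot A B.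
Proof. by move=> Qu; rewrite rdot_adjr -mulmxA (unitary_Kadj Qu) mulmx1. Qed.

Lemma dist_le (Q : 'M[C]_r) : Q \is unitarymx -> dist Z M <= frob (Z - M *m Q).
Proof.
move=> Qu; apply: ge_inf; last by exists Q.
by exists 0 => _ [Q' _ <-]; exact: frob_ge0.
Qed.

(** Since [|M Q'|] does not depend on [Q'], the optimal rotation maximizes [rdot (M Q') Z]. This
    equals [rdot (T Y) T] with [Y = Q^* Q'] unitary, and [|T Y - T|^2 >= 0] bounds it by [|T|^2],
    the value at [Q' = Q]. *)
Lemma dist_polar (Q T : 'M[C]_r) : Q \is unitarymx ->
  Q^t* *m (M^t* *m Z) = T^t* *m T -> dist Z M = frob (Z - M *m Q).
Proof.
move=> Qu QT; apply/eqP; rewrite eq_le dist_le //=.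
apply: lb_le_inf; first by exists (frob (Z - M *m Q)), Q.
move=> _ [Q' /= Qu' <-]; rewrite !frobE ler_wsqrtr //.
have MZ : M^t* *m Z = Q *m (T^t* *m T).
  by rewrite -QT !mulmxA (unitary_Kadj Qu) mul1mx.
have ZQ Q1 : Q1 \is unitarymx ->
    rdot (M *m Q1) Z = rdot (T *m (Q^t* *m Q1)) T.
  by move=> Q1u; rewrite rdot_adjl MZ rdotC rdot_adjl rdot_adjl rdotC.
rewrite !rdotDl !rdotDr !rdotNl !rdotNr opprK (rdot_mul_unitary _ _ Qu).
rewrite (rdot_mul_unitary _ _ Qu') !(rdotC Z (M *m _)) (ZQ _ Qu) (ZQ _ Qu').
rewrite (unitary_adjK Qu) mulmx1.
have := rdot_ge0 (T *m (Q^t* *m Q') - T).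
rewrite !rdotDl !rdotDr !rdotNl !rdotNr (rdotC T).
have Yu : Q^t* *m Q' \is unitarymx by exact: mul_unitarymx (adj_unitary Qu) Qu'.
by rewrite (rdot_mul_unitary _ _ Yu); lra.
Qed.

Hypothesis (g : R) (g_gt0 : 0 < g).
Hypothesis M_min : forall k (X : 'M[C]_(r, k)), g * rdot X X <= rdot (M *m X) (M *m X).

Lemma M_minr k (X : 'M[C]_(k, r)) : g * rdot X X <= rdot (X *m M^t*) (X *m M^t*).
Proof. by rewrite -(rdot_adj X) -(rdot_adj (X *m _)) adjM trmxCK. Qed.

(** With [a = |X M^*|^2 = <X, X M^* M>] and [b = |X M^* M|^2], Cauchy-Schwarz gives
    [a^2 <= |X|^2 b], while [g |X|^2 <= a]. *)
Lemma gram_min k (X : 'M[C]_(k, r)) : g * rdot (X *m M^t*) (X *m M^t*) <=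
  rdot (X *m (M^t* *m M)) (X *m (M^t* *m M)).
Proof.
set a := rdot (X *m _) _; set b := rdot _ _.
have a0 : 0 <= a by exact: rdot_ge0.
have b0 : 0 <= b by exact: rdot_ge0.
have aE : a = rdot X (X *m (M^t* *m M)) by rewrite /a rdot_adjr trmxCK mulmxA.
have := rdot_CS2 X (X *m (M^t* *m M)); rewrite -aE -/b => CS.
have ga := M_minr X; rewrite -/a in ga.
have : g * a ^+ 2 <= a * b.
  apply: le_trans (_ : g * (rdot X X * b) <= _); first by rewrite ler_pM2l.
  by rewrite mulrA ler_wpM2r.
have [->|a_neq0] := eqVneq a 0; first by rewrite mulr0.
have a_gt0 : 0 < a by rewrite lt_def a_neq0.
by rewrite expr2 mulrCA ler_pM2l.
Qed.

(** Supplies the invertibility that [polar] requires. If [X M^* Z = 0], then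
    [X M^* M Q = - X M^* (Z - M Q)]; the left side has squared norm at least [g |X M^*|^2], the
    right side less unless [X M^* = 0]. *)
Lemma unitmx_close (Q : 'M[C]_r) : Q \is unitarymx ->
  rdot (Z - M *m Q) (Z - M *m Q) < g -> M^t* *m Z \in unitmx.
Proof.
move=> Qu Hg; apply: unitmx_ker => k X X0.
have XH : X *m (M^t* *m M) *m Q = - (X *m M^t* *m (Z - M *m Q)).
  by rewrite mulmxBr -!mulmxA X0 sub0r opprK.
have := gram_min X; rewrite -(rdot_mul_unitary _ _ Qu) XH rdotNl rdotNr opprK.
have := rdot_mulmx (X *m M^t*) (Z - M *m Q).
have := rdot_ge0 (X *m M^t*); have := M_minr X; have := rdot_ge0 X.
set x := rdot X X; set a := rdot (X *m _) _; set h := rdot (Z - _) _ in Hg *.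
set c := rdot _ _ => x0 gxa a0 h1 h2; apply: rdot_eq0; rewrite -/x.
have a00 : a = 0 by apply/eqP; rewrite eq_le a0 andbT; nra.
apply/eqP; rewrite eq_le x0 andbT.
by move: gxa; rewrite a00 pmulr_rle0.
Qed.

(** The variant for the initialization, where closeness is known for the Gram matrices before any
    rotation is available. *)
Lemma unitmx_gram_close :
  rdot (Z *m Z^t* - M *m M^t*) (Z *m Z^t* - M *m M^t*) < g ^+ 2 ->
  M^t* *m Z \in unitmx.
Proof.
move=> Eg; apply: unitmx_ker => k X X0; set E := _ - _ in Eg.
have XE : X *m (M^t* *m M) *m M^t* = - (X *m M^t* *m E).
  rewrite /E mulmxBr !mulmxA -(mulmxA X _ Z) X0 mul0mx sub0r opprK.
  by rewrite -!mulmxA.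
have := M_minr (X *m (M^t* *m M)); rewrite XE rdotNl rdotNr opprK.
have := rdot_mulmx (X *m M^t*) E; have := gram_min X.
have := rdot_ge0 (X *m M^t*); have := M_minr X; have := rdot_ge0 X.
set x := rdot X X; set a := rdot (X *m M^t*) _; set e := rdot E _ in Eg *.
set b := rdot (X *m (_ *m _)) _; set c := rdot (X *m M^t* *m E) _ => x0 gxa a0 h1 h2 h3.
have a00 : a = 0.
  apply/eqP; rewrite eq_le a0 andbT -(pmulr_rle0 a (_ : 0 < g ^+ 2 - e)) ?subr_gt0 //.
    rewrite mulrBl subr_le0 (mulrC e) expr2 -mulrA.
    by apply: le_trans (le_trans h3 h2); rewrite ler_pM2l.
apply: rdot_eq0; rewrite -/x; apply/eqP; rewrite eq_le x0 andbT.
  by move: gxa; rewrite a00 pmulr_rle0.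
Qed.

End Distance.

End Procrustes.

(** * Factor errors controlled by product errors *)

Section ProcrustesGap.
Local Open Scope complex_scope.
Local Open Scope sesquilinear_scope.
Context {R : realType}.
Local Notation C := R[i].

(* With [h = H^* H], [b = H^* M], the claim follows from [|h + 7/5 b|^2 >= 0]
   and [<Z^* M, h> >= 0]. *)
Lemma procrustes_gap m r (Z M : 'M[C]_(m, r)) (S : 'M[C]_r) :
  M^t* *m Z = S^t* *m S ->
  4 / 5 * rdot (M *m (Z - M)^t*) (M *m (Z - M)^t*) <=
  rdot (Z *m Z^t* - M *m M^t*) (Z *m Z^t* - M *m M^t*).
Proof.
move=> ZM; set H := Z - M; have ZE : Z = M + H by rewrite addrC subrK.
clearbody H.
have ZZ : Z *m Z^t* - M *m M^t* = H *m M^t* + M *m H^t* + H *m H^t*.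
  rewrite ZE adjD mulmxDl !mulmxDr addrAC [M *m M^t* + _]addrC addrK addrA.
  by rewrite (addrC (M *m _)).
pose h := H^t* *m H; pose b := H^t* *m M; pose G := M^t* *m M.
have ZM' : Z^t* *m M = S^t* *m S by rewrite -(trmxCK (_ *m M)) adjM trmxCK ZM adjM trmxCK.
have bE : b = S^t* *m S - G.
  by rewrite /b /G -ZM' ZE adjD mulmxDl addrAC subrr add0r.
have bH : b^t* = b by rewrite bE adjD adjN !adjM !trmxCK.
have MH : M^t* *m H = b by rewrite -bH adjM trmxCK.
set c := rdot (M *m _) _.
have e1 : rdot (H *m M^t*) (H *m M^t*) = c by rewrite -rdot_adj !adjM trmxCK.
have e2 : rdot (H *m M^t*) (M *m H^t*) = rdot b b.
  by rewrite rdot_adjl mulmxA -/b -(rdot_adjr (M^t*) H) MH.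
have e3 : rdot (H *m H^t*) (H *m H^t*) = rdot h h.
  by rewrite rdot_adjl mulmxA -/h -(rdot_adjr (H^t*) H).
have e4 : rdot (H *m M^t*) (H *m H^t*) = rdot b h.
  by rewrite rdot_adjl mulmxA -/h -(rdot_adjr (M^t*) H) MH.
have e5 : rdot (M *m H^t*) (H *m H^t*) = rdot b h.
  by rewrite -rdot_adj !adjM !trmxCK.
have p1 := rdot_ge0 (h + (7/5 : R)%:C *: b).
have p2 : 0 <= c + rdot b h.
  have -> : c + rdot b h = rdot (S^t* *m S) h.
    rewrite -ZM' ZE adjD mulmxDl -/b -/G rdotDl; congr (_ + _).
    by rewrite /c rdot_adjl mulmxA -/G -(rdot_adjr (H^t*) H) -/h; exact: rdotC.
  by rewrite rdot_adjl trmxCK /h mulmxA -[X in rdot S (_ *m X)]trmxCK -rdot_adjr rdot_ge0.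
move: p1; rewrite ZZ !rdotDl !rdotDr !rdotZl !rdotZr.
rewrite (rdotC (M *m _) (H *m M^t*)) (rdotC (H *m H^t*) (H *m M^t*)).
rewrite (rdotC (H *m H^t*) (M *m _)) e1 e2 e3 e4 e5 (rdotC h b) -/c.
move: p2 (rdot_ge0 b).
move: (rdot b h) (rdot b b) (rdot h h) c {e1 e2 e3 e4 e5} => x y z c.
by clear; lra.
Qed.

Lemma rdot_outer r m1 m2 (A B : 'M[C]_(m1, r)) (A' B' : 'M[C]_(m2, r)) :
  rdot (A *m A'^t*) (B *m B'^t*) = rdot (A^t* *m B) (A'^t* *m B').
Proof. by rewrite rdot_adjl mulmxA -(rdot_adjr (A'^t*) B'); exact: rdotC. Qed.

Lemma adj_col_mul n1 n2 r (A B : 'M[C]_(n1, r)) (A' B' : 'M[C]_(n2, r)) :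
  (col_mx A A')^t* *m col_mx B B' = A^t* *m B + A'^t* *m B'.
Proof. by rewrite tr_col_mx map_row_mx mul_row_col. Qed.

(** The right side minus the left side is [2 |P - S|^2] with [P = ZU^* MU] and [S = ZV^* MV]. *)
Lemma balanced_gap n1 n2 r (ZU MU : 'M[C]_(n1, r)) (ZV MV : 'M[C]_(n2, r))
    (Z := col_mx ZU ZV) (M := col_mx MU MV) :
  ZU^t* *m ZU = ZV^t* *m ZV -> MU^t* *m MU = MV^t* *m MV ->
  rdot (Z *m Z^t* - M *m M^t*) (Z *m Z^t* - M *m M^t*) <=
  4 * rdot (ZU *m ZV^t* - MU *m MV^t*) (ZU *m ZV^t* - MU *m MV^t*).
Proof.
rewrite {}/Z {}/M => Zb Mb.
rewrite !rdotDl !rdotDr !rdotNl !rdotNr opprK.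
rewrite (rdotC (col_mx MU MV *m _) (col_mx ZU ZV *m _)).
rewrite (rdotC (MU *m _) (ZU *m _)) !rdot_outer !adj_col_mul -!Zb -!Mb.
rewrite !rdotDl !rdotDr (rdotC (ZV^t* *m MV) (ZU^t* *m MU)).
have := rdot_ge0 (ZU^t* *m MU - ZV^t* *m MV).
rewrite !rdotDl !rdotDr !rdotNl !rdotNr opprK (rdotC (ZV^t* *m MV)).
move: (rdot _ _) (rdot _ _) (rdot _ _) (rdot _ _) (rdot _ _) => a b c d e.
by clear; lra.
Qed.

End ProcrustesGap.

(** Sylvester's identity: [K] is made block triangular once by column operations and once by row
    operations, and its determinant is read off both ways. It compares spectra across non-square
    factors. *)
Lemma char_poly_mulmxC (F : comNzRingType) m n (A : 'M[F]_(m, n)) (B : 'M[F]_(n, m)) :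
  'X ^+ n * char_poly (A *m B) = 'X ^+ m * char_poly (B *m A).
Proof.
pose A' := map_mx (@polyC F) A; pose B' := map_mx (@polyC F) B.
pose K := block_mx (@scalar_mx _ m 'X) A' B' (@scalar_mx _ n 1).
have K1 : \det K = char_poly (A *m B).
  have : K *m block_mx 1%:M 0 (- B') 1%:M = block_mx ('X%:M - A' *m B') A' 0 1%:M.
    by rewrite mulmx_block !mulmx1 !mulmx0 mulmxN !mul1mx subrr !add0r.
  move=> /(congr1 determinant); rewrite det_mulmx det_lblock det_ublock !det1 !mulr1.
  by move=> ->; rewrite /char_poly /char_poly_mx map_mxM.
have : block_mx 1%:M 0 (- B') 'X%:M *m K = block_mx 'X%:M A' 0 ('X%:M - B' *m A').
  rewrite mulmx_block !mul1mx !mul0mx !addr0 mulmx1 !mulNmx [- _ + 'X%:M]addrC.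
  by rewrite scalar_mxC addNr.
move=> /(congr1 determinant); rewrite det_mulmx det_lblock det_ublock det1 mul1r.
by rewrite !det_scalar K1 /char_poly /char_poly_mx !map_mxM.
Qed.

(** * Singular values *)

Section SingularValues.
Local Open Scope complex_scope.
Local Open Scope sesquilinear_scope.
Context {R : realType}.
Local Notation C := R[i].

Lemma char_poly_diag n (d : 'rV[C]_n) :
  char_poly (diag_mx d) = \prod_(z <- [seq d 0 i | i <- enum 'I_n]) ('X - z%:P).
Proof.
rewrite char_poly_trig ?diag_mx_is_trig // big_map big_enum.
by apply: eq_bigr => i _; rewrite mxE eqxx.
Qed.

Lemma char_poly_unitary n (D P : 'M[C]_n) : P \is unitarymx ->
  char_poly (P^t* *m D *m P) = char_poly D.
Proof.
move=> Pu; apply: (@mulfI _ ('X ^+ n)); first by rewrite expf_neq0 ?polyX_eq0.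
by rewrite -mulmxA char_poly_mulmxC -mulmxA (unitary_Kadj Pu) mulmx1.
Qed.

Lemma prod_XsubC0 n : \prod_(z <- nseq n (0 : C)) ('X - z%:P) = 'X ^+ n.
Proof. by rewrite big_nseq subr0 -Monoid.iteropE. Qed.

(** [A^* A = V diag(s^2) V^*] with [V] of size [n] by [k]. Padding both lists with zeros makes the
    spectra comparable without the difference [n - k]. *)
Lemma perm_spectral_svd m n k (A : 'M[C]_(m, n)) U s V : is_svd A U s V ->
  perm_eq (nseq k 0 ++ [seq spectral_diag (A^t* *m A) 0 j | j <- enum 'I_n])
    (nseq n 0 ++ [seq (s 0 i ^+ 2)%:C | i <- enum 'I_k]).
Proof.
move=> [UU VV _ AE]; apply/prod_XsubC_eq; rewrite !big_cat /= !prod_XsubC0.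
have nA : A^t* *m A \is normalmx by apply/normalmxP; rewrite !adjM !trmxCK.
set P := spectralmx (A^t* *m A); set d := spectral_diag (A^t* *m A).
have Pu : P \is unitarymx by exact: spectral_unitarymx.
have e1 : char_poly (A^t* *m A) = \prod_(z <- [seq d 0 j | j <- enum 'I_n]) ('X - z%:P).
  have E := orthomx_spectralP nA; rewrite -/P -/d (invmx_unitary Pu) in E.
  by rewrite E (char_poly_unitary _ Pu) char_poly_diag.
have AA : A^t* *m A = V *m (realdiag s *m realdiag s *m V^t*).
  by rewrite AE !adjM trmxCK adj_realdiag !mulmxA -(mulmxA _ _ U) UU mulmx1.
rewrite -e1 AA -char_poly_mulmxC.
rewrite -(mulmxA (_ *m _) (V^t*)) VV mulmx1 mul_realdiag; congr (_ * _).
rewrite /realdiag char_poly_diag; congr (\prod_(z <- _) _).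
by apply: eq_map => i; rewrite !mxE expr2.
Qed.

(** After padding by zeros both lists are nonincreasing and are permutations of each other, hence
    equal. *)
Lemma singvals_svd m n k (A : 'M[C]_(m, n)) U s V : is_svd A U s V ->
  singvals A ++ nseq k 0 = [seq s 0 i | i <- enum 'I_k] ++ nseq n 0.
Proof.
move=> Asvd; have [_ _ [s_ge0 s_sorted] _] := Asvd.
set leT := fun x y : R => y <= x.
have leT_tot : total leT by move=> x y; exact: le_total.
have leT_tr : transitive leT by move=> x y z; rewrite /leT => ? /le_trans; exact.
have cat0_sorted q (t : seq R) : all (>= 0) t -> sorted leT t -> sorted leT (t ++ nseq q 0).
  move=> t0 ts; rewrite (sorted_pairwise leT_tr) pairwise_cat -(sorted_pairwise leT_tr) ts.
  rewrite -(sorted_pairwise leT_tr) andbC /=; apply/andP; split.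
    by case: q => //= q; elim: q => //= q; rewrite /leT lexx.
  by apply/allrelP => x y xt /nseqP[-> _]; rewrite /leT; move/allP: t0 => /(_ x xt).
apply: (sorted_eq leT_tr).
- by move=> x y; rewrite /leT => /le_anti.
- apply: cat0_sorted; last exact: sort_sorted.
  apply/allP => x; rewrite mem_sort => /mapP[j _ ->]; exact: sqrtr_ge0.
- apply: cat0_sorted; first by apply/allP => x /mapP[j _ ->].
  rewrite sorted_map; apply: (@sub_sorted _ (relpre val ltn)).
    by move=> i j /ltnW; exact: s_sorted.
  by rewrite -sorted_map val_enum_ord iota_ltn_sorted.
rewrite perm_catC perm_sym perm_catC perm_sym.
pose f (z : C) := Num.sqrt (complex.Re z).
have f0 : f 0 = 0 by rewrite /f sqrtr0.
have := perm_map f (perm_spectral_svd Asvd).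
rewrite !map_cat !map_nseq f0 -!(map_comp f) => sp.
apply: (@perm_trans _ (nseq k 0 ++
  [seq (f \o (spectral_diag (A^t* *m A) 0)) j | j <- enum 'I_n])).
  by rewrite perm_cat2l /singvals perm_sort.
apply: perm_trans sp _; rewrite perm_cat2l.
rewrite (_ : map _ _ = [seq s 0 i | i <- enum 'I_k]) //; apply: eq_map => i.
by rewrite /f /= sqrtr_sqr ger0_norm.
Qed.

Lemma sigma_svd m n k (A : 'M[C]_(m, n)) U s V (i : 'I_k) : is_svd A U s V ->
  sigma i.+1 A = s 0 i.
Proof.
move=> Asvd; rewrite /sigma /=.
(* Padding by zeros is invisible to [nth], whose default value is also [0]. *)
have pad (t : seq R) q : nth 0 t i = nth 0 (t ++ nseq q 0) i.
  rewrite nth_cat; case: ltnP => // ti; rewrite nth_nseq if_same.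
  by rewrite nth_default.
rewrite (pad _ k) (singvals_svd Asvd) -pad (nth_map i) ?size_enum_ord //.
by rewrite nth_ord_enum.
Qed.

End SingularValues.

(** * Bernstein inequality in a Hilbert space *)

Section HilbertBernstein.
Local Open Scope complex_scope.
Local Open Scope sesquilinear_scope.
Context {R : realType}.
Implicit Types b c u v w x : R.

Definition csh x : R := (expR x + expR (- x)) / 2.
Definition snh x : R := (expR x - expR (- x)) / 2.

(** The induction step rests on Chebyshev's inequality [(x - y) (x^k - y^k) >= 0]. *)
Lemma convex_pow k (p x y : R) : 0 <= p -> p <= 1 -> 0 <= x -> 0 <= y ->
  (p * x + (1 - p) * y) ^+ k <= p * x ^+ k + (1 - p) * y ^+ k.
Proof.
move=> p0 p1 x0 y0; elim: k => [|k IH]; first by rewrite !expr0 !mulr1; lra.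
have xy : 0 <= (x - y) * (x ^+ k - y ^+ k).
  have [xy|/ltW yx] := leP x y.
    by rewrite mulr_le0 // subr_le0 // lerXn2r ?nnegrE.
  by rewrite mulr_ge0 // subr_ge0 // lerXn2r ?nnegrE.
rewrite exprS; set q := p * x + _.
have q0 : 0 <= q by rewrite addr_ge0 // mulr_ge0 // subr_ge0.
apply: le_trans (ler_wpM2l q0 IH) _; rewrite /q !exprS.
have : 0 <= p * (1 - p) * ((x - y) * (x ^+ k - y ^+ k)).
  by apply: mulr_ge0 xy; rewrite mulr_ge0 ?subr_ge0.
by move: (x ^+ k) (y ^+ k) => X Y; lra.
Qed.

Lemma cvg_series_expR x : series (exp_coeff x) @ \oo --> expR x.
Proof. exact: is_cvg_series_exp_coeff. Qed.

Lemma csh_cvg x :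
  (fun n => (series (exp_coeff x) n + series (exp_coeff (- x)) n) / 2) @ \oo --> csh x.
Proof. by apply: cvgMr_tmp; apply: cvgD; exact: cvg_series_expR. Qed.

(** The function [t |-> cosh (sqrt t)] is convex on nonnegative [t], because its power series has
    nonnegative coefficients; [convex_pow] is applied to each term of the partial sums. *)
Lemma csh_chord (p : R) u v w : 0 <= p -> p <= 1 ->
  w ^+ 2 = p * u ^+ 2 + (1 - p) * v ^+ 2 -> csh w <= p * csh u + (1 - p) * csh v.
Proof.
move=> p0 p1 wE; pose C x n : R := (series (exp_coeff x) n + series (exp_coeff (- x)) n) / 2.
have H n : C w n <= p * C u n + (1 - p) * C v n.
  rewrite /C /series /= -!big_split /= !mulr_suml !mulr_sumr -big_split /=.
  apply: ler_sum => i _; rewrite /exp_coeff /=.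
  rewrite -!mulrDl !(mulrA p) !(mulrA (1 - p)) -!mulrDl.
  rewrite !ler_pM2r ?invr_gt0 ?ltr0n ?fact_gt0 //.
  have E x : x ^+ i + (- x) ^+ i = (x ^+ 2) ^+ i./2 * (if odd i then 0 else 2).
    rewrite -exprM mul2n -{1 2}(odd_double_half i); case: (odd i).
      by rewrite mulr0 add1n !exprS !mulNr -mul2n !exprM sqrrN subrr.
    by rewrite add0n -mul2n !exprM sqrrN; lra.
  rewrite !E wE; set c := (if _ then _ else _).
  have c0 : 0 <= c by rewrite /c; case: odd.
  apply: le_trans (ler_wpM2r c0 (convex_pow _ p0 p1 (sqr_ge0 u) (sqr_ge0 v))) _.
  by rewrite mulrDl !mulrA.
have h1 : C w @ \oo --> csh w by exact: csh_cvg.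
have h2 : (fun n => p * C u n + (1 - p) * C v n) @ \oo --> p * csh u + (1 - p) * csh v.
  by apply: cvgD; apply: cvgMl_tmp; exact: csh_cvg.
apply: (ler_cvg_to h1 h2); near=> n; exact: H.
Unshelve. all: by end_near. Qed.

Lemma snh_ge b : 0 <= b -> b <= snh b.
Proof.
move=> b0.
have H : (fun n => (series (exp_coeff b) n - series (exp_coeff (- b)) n) / 2) @ \oo --> snh b.
  by apply: cvgMr_tmp; apply: cvgB; exact: cvg_series_expR.
have hb : (fun _ : nat => b) @ \oo --> b by exact: cvg_cst.
apply: (ler_cvg_to hb H).
exists 2%N => //= n n2; rewrite /series /= -sumrB -(subnKC n2) /index_iota subn0.
rewrite iotaD big_cat /= !big_cons !big_nil /exp_coeff /=.
rewrite !expr0 !expr1 subrr add0r addr0 divr1 -[b in X in X <= _]addr0.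
suff : 0 <= \sum_(i <- iota 2 (n - 2)) (b ^+ i / i`!%:R - (- b) ^+ i / i`!%:R) by rewrite !divr1; lra.
apply: sumr_ge0 => i _; rewrite -mulrBl mulr_ge0 ?invr_ge0 ?ler0n // subr_ge0.
apply: le_trans (ler_norm _) _; by rewrite normrX normrN ger0_norm.
Qed.

(** Squaring [expR (- b / 2) >= 1 - b / 2] bounds [expR (- b)] from below by [1 - b + b^2 / 4], and
    [(1 + b + b^2) (1 - b + b^2 / 4) = 1 + b^2 (1 - 3 b) / 4 + b^4 / 4]. This is where the threshold
    [1/3] comes from. *)
Lemma expR_le_quad b : 0 <= b -> b <= 3^-1 -> expR b <= 1 + b + b ^+ 2.
Proof.
move=> b0 b3; have := expR_ge1Dx (- (b / 2)); set e := expR _ => he.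
have e0 : 0 < e by exact: expR_gt0.
have eE : expR b * e ^+ 2 = 1.
  by rewrite expr2 -!expRD (_ : _ + _ = 0) ?expR0 //; field.
have h1 : (1 - b + b ^+ 2 / 4) <= e ^+ 2.
  by rewrite (_ : 1 - b + b ^+ 2 / 4 = (1 - b / 2) ^+ 2) ?lerXn2r ?nnegrE //; [lra|lra|field].
have e20 : 0 < e ^+ 2 by rewrite exprn_gt0.
rewrite -(ler_pM2r e20) eE.
have h2 : 1 <= (1 + b + b ^+ 2) * (1 - b + b ^+ 2 / 4).
  have : 0 <= b ^+ 2 * (1 - 3 * b) by rewrite mulr_ge0 ?sqr_ge0 //; lra.
  have : 0 <= b ^+ 4 by rewrite exprn_ge0.
  by rewrite !expr2 !exprS expr0; lra.
apply: le_trans h2 _; rewrite ler_wpM2l //.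
by have := sqr_ge0 b; lra.
Qed.

Lemma csh_ge_snh (a : R) : snh a <= csh a.
Proof. by rewrite /csh /snh; have := expR_gt0 (- a); lra. Qed.

Lemma csh_gt0 (a : R) : 0 < csh a.
Proof. by rewrite divr_gt0 ?addr_gt0 ?expR_gt0. Qed.

(** Here [a], [b], [w] are the norms of [V], [Y], [V + Y] and [c] is the inner product of [V] and
    [Y]. The chord between [(a - b)^2] and [(a + b)^2] gives [csh a csh b + t snh a snh b] with
    [t = c / (a b)]. Replacing [snh b] by [b] in the second term makes it linear in [c], so that it
    averages to zero over centered steps; the cost leaves the factor [expR b - b <= 1 + b^2]. *)
Lemma csh_step (a b c w : R) : 0 <= a -> 0 <= b -> b <= 3^-1 -> `|c| <= a * b ->
  w ^+ 2 = a ^+ 2 + b ^+ 2 + 2 * c ->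
  csh w <= csh a * (1 + b ^+ 2) + c * (snh a / a).
Proof.
move=> a0 b0 b3 cab wE.
have snha0 : 0 <= snh a by apply: le_trans a0 (snh_ge a0).
have key : csh b + snh b - b <= 1 + b ^+ 2.
  by have := expR_le_quad b0 b3; rewrite /csh /snh; lra.
have c1 := csh_gt0 a; have s1 := snh_ge b0.
(* In the degenerate case [c = 0], so the value of [snh a / a] at [a = 0] is harmless. *)
have [ab0|ab_neq0] := eqVneq (a * b) 0.
  have c0 : c = 0 by apply/eqP; rewrite -normr_eq0 eq_le normr_ge0 -ab0 cab.
  have cshE x y : x ^+ 2 = y ^+ 2 -> csh x = csh y.
    move=> /eqP; rewrite eqf_sqr => /orP[/eqP ->//|/eqP ->].
    by rewrite /csh opprK addrC.
  rewrite c0 mul0r addr0; move/eqP: ab0; rewrite mulf_eq0 => /orP[] /eqP h0.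
    rewrite (cshE w b) ?wE ?h0 ?c0; last by ring.
    have -> : csh 0 = 1 by rewrite /csh oppr0 expR0; field.
    by rewrite mul1r; lra.
  rewrite (cshE w a) ?wE ?h0 ?c0; last by ring.
  by rewrite expr0n addr0 mulr1.
have ab_gt0 : 0 < a * b by rewrite lt_def ab_neq0 mulr_ge0.
have a_gt0 : 0 < a by rewrite lt_def a0 andbT; apply: contraNneq ab_neq0 => ->; rewrite mul0r.
have b_gt0 : 0 < b by rewrite lt_def b0 andbT; apply: contraNneq ab_neq0 => ->; rewrite mulr0.
pose t := c / (a * b).
have t1 : `|t| <= 1.
  by rewrite /t normrM normfV (gtr0_norm ab_gt0) ler_pdivrMr // mul1r.
have cE : c = t * (a * b) by rewrite /t mulfVK.
have /andP[t1' t1''] : -1 <= t <= 1 by rewrite -ler_norml.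
have chord : csh w <= (1 + t) / 2 * csh (a + b) + (1 - (1 + t) / 2) * csh (a - b).
  by apply: csh_chord; [lra|lra|rewrite wE cE; field].
apply: le_trans chord _.
have -> : csh (a + b) = csh a * csh b + snh a * snh b.
  by rewrite /csh /snh opprD !expRD; field.
have -> : csh (a - b) = csh a * csh b - snh a * snh b.
  by rewrite /csh /snh opprD opprK !expRD; field.
have -> : c * (snh a / a) = t * b * snh a by rewrite cE; field; rewrite gt_eqF.
have h : t * (snh a * (snh b - b)) <= csh a * (snh b - b).
  apply: le_trans (_ : 1 * (snh a * (snh b - b)) <= _).
    by rewrite ler_wpM2r // mulr_ge0 // subr_ge0.
  by rewrite mul1r ler_wpM2r ?csh_ge_snh // subr_ge0.
have h' : csh a * (csh b + snh b - b) <= csh a * (1 + b ^+ 2) by rewrite ler_pM2l.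
lra.
Qed.

Section Walk.
Variable J : finType.
Implicit Types V W : J -> R.

Definition sqn V : R := \sum_j V j ^+ 2.

Lemma sqn_ge0 V : 0 <= sqn V.
Proof. by apply: sumr_ge0 => j _; rewrite sqr_ge0. Qed.

Lemma sum_CS V W : (\sum_j V j * W j) ^+ 2 <= sqn V * sqn W.
Proof.
set c := \sum_j _; set a := sqn V; set b := sqn W.
have a0 : 0 <= a by exact: sqn_ge0.
have b0 : 0 <= b by exact: sqn_ge0.
have H (s t : R) : 0 <= s ^+ 2 * a + 2 * s * t * c + t ^+ 2 * b.
  have -> : s ^+ 2 * a + 2 * s * t * c + t ^+ 2 * b = sqn (fun j => s * V j + t * W j).
    rewrite /a /b /c /sqn !mulr_sumr -!big_split /=; apply: eq_bigr => j _; ring.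
  exact: sqn_ge0.
have [bz|bn] := eqVneq b 0.
  have [->|cn] := eqVneq c 0; first by rewrite expr0n mulr_ge0.
  have := H 1 (- (a + 1) / (2 * c)); rewrite bz.
  have -> : 1 ^+ 2 * a + 2 * 1 * (- (a + 1) / (2 * c)) * c +
    (- (a + 1) / (2 * c)) ^+ 2 * 0 = - 1 by field.
  by move=> ?; exfalso; lra.
have bgt0 : 0 < b by rewrite lt_def bn.
have := H b (- c); have -> : b ^+ 2 * a + 2 * b * - c * c + (- c) ^+ 2 * b = b * (a * b - c ^+ 2) by ring.
by rewrite pmulr_rge0 // subr_ge0.
Qed.

(** Summing [csh_step] over all steps kills the linear terms, since the steps are centered. *)
Lemma csh_walk_step n V (Y : 'I_n -> J -> R) :
  (forall j, \sum_a Y a j = 0) -> (forall a, sqn (Y a) <= 9^-1) ->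
  \sum_a csh (Num.sqrt (sqn (fun j => V j + Y a j))) <=
  csh (Num.sqrt (sqn V)) * \sum_a (1 + sqn (Y a)).
Proof.
move=> Y0 Y9; set A := Num.sqrt (sqn V).
have step a : csh (Num.sqrt (sqn (fun j => V j + Y a j))) <=
    csh A * (1 + sqn (Y a)) + (\sum_j V j * Y a j) * (snh A / A).
  rewrite -[in 1 + sqn _](sqr_sqrtr (sqn_ge0 (Y a))); apply: csh_step; rewrite ?sqrtr_ge0 //.
  - rewrite -(@ler_pXn2r _ 2) ?nnegrE ?sqrtr_ge0 ?invr_ge0 //.
    by rewrite sqr_sqrtr ?sqn_ge0 // (le_trans (Y9 a)) // exprVn; lra.
  - rewrite -(@ler_pXn2r _ 2) ?nnegrE ?mulr_ge0 ?sqrtr_ge0 //.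
    by rewrite real_normK ?num_real // exprMn !sqr_sqrtr ?sqn_ge0 // sum_CS.
  - rewrite !sqr_sqrtr ?sqn_ge0 // /sqn mulr_sumr -!big_split /=.
    by apply: eq_bigr => j _; ring.
apply: le_trans (ler_sum _ (fun a _ => step a)) _.
rewrite big_split /= -mulr_sumr -mulr_suml exchange_big /=.
by rewrite [X in _ + X * _]big1 ?mul0r ?addr0 // => j _; rewrite -mulr_sumr Y0 mulr0.
Qed.

Lemma sum_ffunS (n m : nat) (F : {ffun 'I_m.+1 -> 'I_n} -> R) :
  \sum_f F f = \sum_(f : {ffun 'I_m -> 'I_n}) \sum_a
    F [ffun k => if unlift ord0 k is Some k' then f k' else a].
Proof.
rewrite pair_big /=.
pose h (p : {ffun 'I_m -> 'I_n} * 'I_n) : {ffun 'I_m.+1 -> 'I_n} :=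
  [ffun k => if unlift ord0 k is Some k' then p.1 k' else p.2].
rewrite (reindex h) //=; exists (fun f => ([ffun k => f (lift ord0 k)], f ord0)).
  move=> [f a] _; rewrite /h /= ffunE unlift_none; congr pair.
  by apply/ffunP => k; rewrite !ffunE liftK.
move=> f _; apply/ffunP => k; rewrite ffunE /=.
by case: unliftP => [k' ->|->] //; rewrite ffunE.
Qed.

(** The supermartingale bound in counting form: the left side is [n^m] times an expectation. An
    arbitrary starting point [V] lets the induction peel off the first step. *)
Lemma csh_walk n (Y : 'I_n -> J -> R) m V :
  (forall j, \sum_a Y a j = 0) -> (forall a, sqn (Y a) <= 9^-1) ->
  \sum_(f : {ffun 'I_m -> 'I_n})
    csh (Num.sqrt (sqn (fun j => V j + \sum_k Y (f k) j))) <=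
  csh (Num.sqrt (sqn V)) * (\sum_a (1 + sqn (Y a))) ^+ m.
Proof.
move=> Y0 Y9; elim: m V => [|m IH] V.
  rewrite expr0 mulr1 (_ : \sum_f _ = \sum_(f : {ffun 'I_0 -> 'I_n}) csh (Num.sqrt (sqn V))).
    by rewrite sumr_const card_ffun !card_ord expn0 mulr1n.
  apply: eq_bigr => f _; congr (csh (Num.sqrt _)); apply: eq_bigr => j _.
  by rewrite big_ord0 addr0.
rewrite sum_ffunS exchange_big /=.
apply: le_trans (_ : \sum_a csh (Num.sqrt (sqn (fun j => V j + Y a j))) *
    (\sum_a (1 + sqn (Y a))) ^+ m <= _).
  apply: ler_sum => a _; apply: le_trans (IH (fun j => V j + Y a j)).
  apply: ler_sum => f _; rewrite le_eqVlt; apply/orP; left; apply/eqP.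
  congr (csh (Num.sqrt _)); apply: eq_bigr => j _; rewrite big_ord_recl ffunE unlift_none.
  congr (_ ^+ 2); rewrite addrA; congr (_ + _); apply: eq_bigr => k _.
  by rewrite ffunE liftK.
rewrite -mulr_suml exprS mulrA ler_wpM2r ?csh_walk_step //.
by rewrite exprn_ge0 // sumr_ge0 // => a _; rewrite addr_ge0 // sqn_ge0.
Qed.

(* Pinelis' form of Bernstein's inequality: the bound does not depend on the
   dimension [#|J|]. *)
Lemma bernstein_count n (Y : 'I_n -> J -> R) m (B v th t : R) :
  (forall j, \sum_a Y a j = 0) -> (forall a, sqn (Y a) <= B ^+ 2) ->
  \sum_a sqn (Y a) <= n%:R * v -> 0 <= th -> 0 <= B -> th * B <= 3^-1 -> 0 <= t ->
  #|[set f : {ffun 'I_m -> 'I_n} | t ^+ 2 <= sqn (fun j => \sum_k Y (f k) j)]%SET|%:R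
    <= 2 * expR (m%:R * (th ^+ 2 * v) - th * t) * n%:R ^+ m :> R.
Proof.
move=> Y0 YB Yv th0 B0 thB t0; set S := [set f | _]%SET.
pose Z a j := th * Y a j.
have sqZ (W : J -> R) : sqn (fun j => th * W j) = th ^+ 2 * sqn W.
  by rewrite /sqn mulr_sumr; apply: eq_bigr => j _; rewrite exprMn.
have := @csh_walk n Z m (fun=> 0).
have -> : sqn (fun _ : J => 0) = 0 by rewrite /sqn big1 // => j _; rewrite expr0n.
have -> : csh (Num.sqrt 0) = 1 by rewrite sqrtr0 /csh oppr0 expR0; field.
rewrite mul1r => /(_ _ _)/le_trans H.
have {}H : \sum_(f : {ffun 'I_m -> 'I_n})
    csh (th * Num.sqrt (sqn (fun j => \sum_k Y (f k) j))) <= (n%:R * expR (th ^+ 2 * v)) ^+ m.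
  rewrite [leLHS](_ : _ = \sum_(f : {ffun 'I_m -> 'I_n})
    csh (Num.sqrt (sqn (fun j => 0 + \sum_k Z (f k) j)))); last first.
    apply: eq_bigr => f _; congr csh.
    rewrite -[th in LHS](ger0_norm th0) -sqrtr_sqr -sqrtrM ?sqr_ge0 // -sqZ.
    congr (Num.sqrt _); apply: eq_bigr => j _; congr (_ ^+ 2).
    by rewrite add0r mulr_sumr.
  apply: H.
  - by move=> j; rewrite -mulr_sumr Y0 mulr0.
  - move=> a; rewrite sqZ (le_trans (ler_wpM2l (sqr_ge0 _) (YB a))) // -exprMn.
    rewrite (_ : 9^-1 = 3^-1 ^+ 2); last by field.
    by rewrite lerXn2r ?nnegrE ?mulr_ge0.
  - rewrite lerXn2r ?nnegrE ?mulr_ge0 ?expR_ge0 //.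
      by rewrite sumr_ge0 // => a _; rewrite addr_ge0 ?sqn_ge0.
    rewrite big_split /= sumr_const card_ord; under eq_bigr do rewrite sqZ.
    rewrite -mulr_sumr; apply: le_trans (_ : n%:R * (1 + th ^+ 2 * v) <= _).
      by rewrite mulrDr mulr1 lerD2l mulrCA ler_wpM2l ?sqr_ge0.
    by rewrite ler_wpM2l // expR_ge1Dx.
(* Markov's inequality: on [S] each summand is at least [expR (th t) / 2]. *)
have count : #|S|%:R * (expR (th * t) / 2) <= (n%:R * expR (th ^+ 2 * v)) ^+ m.
  apply: le_trans H; rewrite -sum1_card natr_sum mulr_suml [leRHS](bigID (mem S)) /=.
  rewrite -[leLHS]addr0 lerD //; last by apply: sumr_ge0 => f _; rewrite ltW ?csh_gt0.
  apply: ler_sum => f; rewrite inE => tf; rewrite mul1r /csh ler_pM2r ?invr_gt0 //.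
  rewrite -[leLHS]addr0 lerD ?expR_ge0 // ler_expR ler_wpM2l //.
  by rewrite -(ger0_norm t0) -sqrtr_sqr ler_wsqrtr.
rewrite expRB expRM_natl; move: count; rewrite exprMn.
move: (expR_gt0 (th * t)) (_ ^+ m) (expR _ ^+ m) => {H}.
set E := expR _ => E0 N F count.
rewrite (_ : 2 * (F / E) * N = 2 * F * N / E); last by field; rewrite gt_eqF.
by rewrite ler_pdivlMr //; lra.
Qed.

End Walk.
End HilbertBernstein.

(** * From counting samples to probabilities *)

Section UniformSampling.
Local Open Scope complex_scope.
Local Open Scope sesquilinear_scope.
Context {R : realType} {d : measure_display} {T : measurableType d}.
Variables (P : probability T R) (m n : nat) (a : 'I_m -> T -> 'I_n).
Hypothesis a_iid : iid_uniform P a.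

Definition cylinder (f : {ffun 'I_m -> 'I_n}) : set T := [set w | forall k, a k w = f k].

Lemma cylinderE f : cylinder f = \bigcap_(k in [set` [set: 'I_m]%SET]) a k @^-1` [set f k].
Proof.
apply/seteqP; split=> w /=; first by move=> wf k _; exact: wf.
by move=> wf k; apply: (wf k); rewrite /= inE.
Qed.

Lemma cylinder_measurable f : measurable (cylinder f).
Proof.
rewrite cylinderE; have [am _ _] := a_iid.
by apply: fin_bigcap_measurable => // k _; exact: am.
Qed.

Lemma cylinder_prob f : P (cylinder f) = (n%:R ^- m)%:E.
Proof.
rewrite cylinderE; have [_ ind unif] := a_iid; rewrite ind.
under eq_bigr do rewrite unif.
by rewrite prodEFin prodr_const cardsT card_ord exprVn.
Qed.

(** Any event that depends on the samples only is a finite union of cylinders, each of probability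
    [n^-m]. It is therefore measurable for an arbitrary predicate [G], and the exceptional set is
    bounded by its cardinality. *)
Lemma prob_sample_ge (n_gt0 : (0 < n)%N) (G : ('I_m -> 'I_n) -> Prop) (B : {set {ffun 'I_m -> 'I_n}}) (e : R) :
  (forall f : {ffun 'I_m -> 'I_n}, f \notin B -> G f) ->
  #|B|%:R <= e * n%:R ^+ m -> ((1 - e)%:E <= P [set w | G (a ^~ w)])%E.
Proof.
move=> BG Be.
pose E (s : seq {ffun 'I_m -> 'I_n}) : set T := \big[setU/set0]_(f <- s) cylinder f.
have Em s : measurable (E s).
  by apply: bigsetU_measurable => f _; exact: cylinder_measurable.
have EP s w : E s w <-> exists2 f, f \in s & forall k, a k w = f k.
  rewrite /E; elim: s => [|f s IH].
    by rewrite big_nil; split => // -[f].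
  rewrite big_cons; split.
    case=> [wf|/IH[g gs wg]]; first by exists f; rewrite ?mem_head.
    by exists g; rewrite // in_cons gs orbT.
  case=> g; rewrite in_cons => /orP[/eqP -> wf|gs wg]; first by left.
  by right; apply/IH; exists g.
have Ele s : (P (E s) <= ((size s)%:R * n%:R ^- m)%:E)%E.
  rewrite /E; elim: s => [|f s IH]; first by rewrite big_nil measure0 mul0r.
  rewrite big_cons; apply: le_trans (measureU2 _ _ _) _.
  - exact: cylinder_measurable.
  - exact: Em.
  rewrite -[size _]/(1 + size s)%N natrD mulrDl mul1r EFinD.
  by have := cylinder_prob f => /= ->; exact: leeD.
have GE : [set w | G (a ^~ w)] = E [seq f : {ffun _} <- enum {ffun 'I_m -> 'I_n} | `[< G f >]].
  apply/seteqP; split => w /=.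
    move=> Gw; apply/EP; exists [ffun k => a k w]; last by move=> k; rewrite ffunE.
    rewrite mem_filter mem_enum andbT; apply/asboolP.
    by rewrite (_ : fun_of_fin _ = a ^~ w) //; apply/funext => k; rewrite ffunE.
  move=> /EP[f]; rewrite mem_filter => /andP[/asboolP Gf _] wf.
  by rewrite (_ : a ^~ w = f) //; apply/funext.
have mG : measurable [set w | G (a ^~ w)] by rewrite GE.
have sub : ~` (E (enum B)) `<=` [set w | G (a ^~ w)].
  move=> w nEw /=; pose f : {ffun 'I_m -> 'I_n} := [ffun k => a k w].
  have -> : a ^~ w = f by apply/funext => k; rewrite ffunE.
  apply: BG; apply/negP => fB; apply: nEw; apply/EP; exists f; rewrite ?mem_enum //.
  by move=> k; rewrite ffunE.
apply: le_trans (le_measure _ _ _ sub); last 2 first.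
- by rewrite inE; exact: measurableC.
- by rewrite inE.
rewrite [leRHS](_ : _ = (1 - P (E (enum B)))%E); last exact: probability_setC.
rewrite EFinB leeB //; apply: le_trans (Ele _) _.
rewrite lee_fin -cardE.
by rewrite ler_pdivrMr ?exprn_gt0 ?ltr0n.
Qed.

End UniformSampling.

(** * Hankel matrices and the discrete Fourier transform *)

Section Fourier.
Local Open Scope complex_scope.
Local Open Scope sesquilinear_scope.
Context {R : realType}.
Local Notation C := R[i].

(** An algebraic argument: [X^n - 1] is separable in characteristic 0 and splits, so it has [n]
    distinct roots. *)
Lemma prim_root_exists n : (0 < n)%N -> exists w : C, n.-primitive_root w.
Proof.
move=> n_gt0; have [r rE] := closed_field_poly_normal ('X^n - 1 : {poly C}).
rewrite (monicP (monicXnsubC _ n_gt0)) scale1r in rE.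
have r_uniq : uniq r.
  by rewrite -separable_prod_XsubC -rE separable_Xn_sub_1 // pnatr_eq0 -lt0n.
have r_size : (n < (size r).+1)%N by rewrite -(size_prod_XsubC r id) -rE size_XnsubC.
have r_unity : all n.-unity_root r.
  by apply/allP => z zr; rewrite /root_of_unity rE root_prod_XsubC.
by have /hasP[z _ zP] := has_prim_root n_gt0 r_unity r_uniq r_size; exists z.
Qed.

Variables (n : nat) (w : C).
Hypotheses (n_gt0 : (0 < n)%N) (w_prim : n.-primitive_root w).

Lemma prim_nrm2 : nrm2 w = 1.
Proof.
have : nrm2 w ^+ n = 1.
  have: nrm2 (w ^+ n) = 1 by rewrite (prim_expr_order w_prim) /nrm2 /= expr1n expr0n addr0.
  move=> <-; elim: (n) => [|k IH]; first by rewrite !expr0 /nrm2 /= expr1n expr0n addr0.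
  by rewrite !exprS nrm2M IH.
by move/eqP; rewrite pexpr_eq1 ?nrm2_ge0 -?lt0n // => /eqP.
Qed.

Lemma prim_conjK : w^* * w = 1.
Proof. by rewrite -nrm2C prim_nrm2. Qed.

Lemma nrm2_primX k : nrm2 (w ^+ k) = 1.
Proof.
elim: k => [|k IH]; first by rewrite expr0 /nrm2 /= expr1n expr0n addr0.
by rewrite exprS nrm2M IH prim_nrm2 mulr1.
Qed.

Lemma prim_orthogonal (i j : nat) : (i < n)%N -> (j < n)%N ->
  \sum_(l < n) (w^* ^+ i * w ^+ j) ^+ l = (n * (i == j))%:R.
Proof.
move=> i_lt j_lt; have [->|ij] := eqVneq i j.
  rewrite -exprMn prim_conjK expr1n; under eq_bigr do rewrite expr1n.
  by rewrite sumr_const card_ord muln1.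
rewrite muln0; set q := _ * _.
have q1 : q != 1.
  apply: contraNneq ij => q1; rewrite -(modn_small i_lt) -(modn_small j_lt).
  rewrite -(eq_prim_root_expr w_prim).
  have : w ^+ i * q = w ^+ j by rewrite /q mulrA -exprMn (mulrC w) prim_conjK expr1n mul1r.
  by rewrite q1 mulr1 => ->.
have qn : q ^+ n = 1.
  rewrite /q exprMn -!exprM ![(_ * n)%N]mulnC !exprM (prim_expr_order w_prim).
  by rewrite -rmorphXn /= (prim_expr_order w_prim) rmorph1 !expr1n mulr1.
have := subrX1 q n; rewrite qn subrr => /esym/eqP; rewrite mulf_eq0 subr_eq0.
by rewrite (negbTE q1) => /eqP.
Qed.

Definition dft (z : 'cV[C]_n) (l : 'I_n) : C := \sum_(a < n) w ^+ (l * a) * z a 0.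

(** The first [k] columns of the unitary inverse Fourier matrix of size [n]. *)
Definition dftmx (k : nat) : 'M[C]_(n, k) :=
  \matrix_(l, i) ((Num.sqrt n%:R)^-1%:C * w^* ^+ (i * l)).

Lemma dftmx_iso k : (k <= n)%N -> (dftmx k)^t* *m dftmx k = 1%:M.
Proof.
move=> kn; apply/matrixP => i j; rewrite !mxE.
transitivity (\sum_(l < n) ((n%:R)^-1 : R)%:C * (w^* ^+ j * w ^+ i) ^+ l).
  apply: eq_bigr => l _; rewrite !mxE.
  have -> : (((n%:R)^-1 : R)%:C = ((Num.sqrt n%:R)^-1)%:C * ((Num.sqrt n%:R)^-1)%:C :> C).
    by rewrite -rmorphM -invfM -expr2 sqr_sqrtr.
  rewrite rmorphM rmorphXn /= conjCK mulrACA; congr (_ * _).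
    by congr (_ * _); exact: conjc_real.
  by rewrite exprMn -!exprM mulrC.
rewrite -mulr_sumr prim_orthogonal ?(leq_trans (ltn_ord _) kn) //.
have -> : ((j : nat) == i)%N = (i == j) by rewrite eq_sym.
case: (i == j) => /=.
  by rewrite muln1 -(rmorph_nat (real_complex R)) -rmorphM mulVf ?rmorph1 // pnatr_eq0 -lt0n.
by rewrite muln0 mulr0.
Qed.

(** Fourier inversion at index [i + j], whose character splits as a product of one factor in [i] and
    one in [j]. Since [i + j < n] there is no wrap-around. *)
Lemma hankel_dft n1 n2 (z : 'cV[C]_n) : (n1 + n2 = n.+1)%N ->
  hankel n1 n2 z = (dftmx n1)^T *m diag_mx (\row_l dft z l) *m dftmx n2.
Proof.
move=> n12; apply/matrixP => i j.
have ij_lt : (i + j < n)%N by have := ltn_ord i; have := ltn_ord j; lia.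
rewrite (hankelE _ (a := Ordinal ij_lt)) // mxE.
transitivity (\sum_(a < n) z a 0 * ((((n%:R)^-1 : R)%:C) *
    \sum_(l < n) (w^* ^+ (i + j) * w ^+ a) ^+ l)).
  rewrite (bigD1 (Ordinal ij_lt)) //= [X in _ + X]big1 => [|a aD]; last first.
    rewrite prim_orthogonal // (_ : (_ == _) = false) ?muln0 ?mulr0 //.
    by apply: contraNF aD => /eqP ija; apply/eqP/val_inj.
  rewrite prim_orthogonal // eqxx muln1 addr0.
  rewrite -(rmorph_nat (real_complex R)) -rmorphM mulVf ?rmorph1 ?mulr1 //.
  by rewrite pnatr_eq0 -lt0n.
under eq_bigr do rewrite mulrA mulr_sumr.
rewrite exchange_big; apply: eq_bigr => l _ /=.
rewrite mul_mx_diag !mxE /dft mulr_sumr mulr_suml; apply: eq_bigr => a _.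
have -> : (((n%:R)^-1 : R)%:C = ((Num.sqrt n%:R)^-1)%:C * ((Num.sqrt n%:R)^-1)%:C :> C).
  by rewrite -rmorphM -invfM -expr2 sqr_sqrtr.
by rewrite exprMn -!exprM mulnDl exprD (mulnC a); ring.
Qed.

Variables (n1 n2 : nat) (z : 'cV[C]_n) (dl : R).
Hypotheses (n12 : (n1 + n2 = n.+1)%N) (n1_gt0 : (0 < n1)%N) (n2_gt0 : (0 < n2)%N).
Hypothesis z_dft : forall l, nrm2 (dft z l) <= dl ^+ 2.

Lemma rdot_diag_le k p (d : 'rV[C]_p) (X : 'M[C]_(p, k)) (c : R) :
  (forall l, nrm2 (d 0 l) <= c) ->
  rdot (diag_mx d *m X) (diag_mx d *m X) <= c * rdot X X.
Proof.
move=> dc; rewrite mul_diag_mx !rdot_nrm2 mulr_sumr; apply: ler_sum => i _.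
rewrite mulr_sumr; apply: ler_sum => j _.
by rewrite mxE nrm2M ler_wpM2r ?nrm2_ge0.
Qed.

(** The left factor of [hankel_dft] is a transpose; conjugating its entries turns it into the
    adjoint of an isometry. *)
Lemma hankel_factor : exists2 U : 'M[C]_(n, n1), U^t* *m U = 1%:M &
  hankel n1 n2 z = U^t* *m diag_mx (\row_l dft z l) *m dftmx n2.
Proof.
exists (map_mx (@Num.conj_op C) (dftmx n1)).
  have n1n : (n1 <= n)%N by lia.
  have := congr1 (map_mx (@Num.conj_op C)) (dftmx_iso n1n).
  by rewrite map_mxM map_mx1 !map_trmx.
rewrite (_ : _^t* = (dftmx n1)^T) ?(hankel_dft _ n12) //.
by apply/matrixP => i j; rewrite !mxE /= conjCK.
Qed.

Lemma hankel_opnorm k (X : 'M[C]_(n2, k)) :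
  rdot (hankel n1 n2 z *m X) (hankel n1 n2 z *m X) <= dl ^+ 2 * rdot X X.
Proof.
have [U U1 ->] := hankel_factor.
have n2n : (n2 <= n)%N by lia.
rewrite -!mulmxA; apply: le_trans (rdot_coisoml _ U1) _.
apply: le_trans (rdot_diag_le _ (c := dl ^+ 2) _) _; first by move=> l; rewrite mxE.
by rewrite rdot_isoml // dftmx_iso.
Qed.

Lemma hankel_opnormr k (X : 'M[C]_(k, n1)) :
  rdot (X *m hankel n1 n2 z) (X *m hankel n1 n2 z) <= dl ^+ 2 * rdot X X.
Proof.
have [U U1 ->] := hankel_factor.
have n2n : (n2 <= n)%N by lia.
rewrite -rdot_adj !adjM trmxCK -!mulmxA.
apply: le_trans (rdot_coisoml _ (dftmx_iso n2n)) _.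
rewrite tr_diag_mx map_diag_mx.
apply: le_trans (rdot_diag_le _ (c := dl ^+ 2) _) _.
  by move=> l; rewrite !mxE; have := z_dft l; rewrite -nrm2J.
by rewrite rdot_isoml // rdot_adj.
Qed.

End Fourier.

(** * Bernstein bounds for the sampling error *)

Section Deviation.
Local Open Scope complex_scope.
Local Open Scope sesquilinear_scope.
Context {R : realType}.
Local Notation C := R[i].

(** Subtracting the mean does not increase the sum of squares and at most doubles the largest norm,
    hence the bound [2 K] on the centered steps. *)
Lemma bernstein_centered (J : finType) n (U : 'I_n -> J -> R) m (K v t : R) :
  (0 < n)%N -> (0 < m)%N ->
  (forall a, sqn (U a) <= K ^+ 2) -> \sum_a sqn (U a) <= n%:R * v ->
  0 <= K -> 0 < v -> 0 <= t -> t * K <= m%:R * v / 3 ->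
  #|[set f : {ffun 'I_m -> 'I_n} | t ^+ 2 <=
      sqn (fun j => \sum_k U (f k) j - m%:R / n%:R * \sum_a U a j)]%SET|%:R
    <= 2 * expR (- (t ^+ 2 / (4 * m%:R * v))) * n%:R ^+ m :> R.
Proof.
move=> n_gt0 m_gt0 UK Uv K0 v0 t0 tK.
have nR : 0 < n%:R :> R by rewrite ltr0n.
have mR : 0 < m%:R :> R by rewrite ltr0n.
pose mu j := n%:R^-1 * \sum_a U a j; pose Y a j := U a j - mu j.
have muE j : \sum_a U a j = n%:R * mu j by rewrite /mu mulrA mulfV ?mul1r ?gt_eqF.
have Y0 j : \sum_a Y a j = 0.
  by rewrite sumrB muE sumr_const card_ord -[mu j *+ n]mulr_natl subrr.
have sYE : \sum_a sqn (Y a) = \sum_a sqn (U a) - n%:R * sqn mu.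
  rewrite /sqn exchange_big [in RHS]exchange_big /= mulr_sumr -sumrB.
  apply: eq_bigr => j _; rewrite /Y.
  under eq_bigr do rewrite sqrrB.
  rewrite big_split sumrB /= sumrMnl -mulr_suml muE sumr_const card_ord.
  by rewrite -[mu j ^+ 2 *+ n]mulr_natl; ring.
have smu : n%:R * sqn mu <= \sum_a sqn (U a).
  by rewrite -subr_ge0 -sYE; apply: sumr_ge0 => a _; exact: sqn_ge0.
have sYU : \sum_a sqn (Y a) <= \sum_a sqn (U a).
  by rewrite sYE gerBl mulr_ge0 ?sqn_ge0 // ltW.
have muK : sqn mu <= K ^+ 2.
  rewrite -(ler_pM2l nR); apply: le_trans smu _.
  apply: le_trans (ler_sum _ (fun a _ => UK a)) _.
  by rewrite sumr_const card_ord -[K ^+ 2 *+ n]mulr_natl.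
have YK a : sqn (Y a) <= (2 * K) ^+ 2.
  apply: le_trans (_ : 2 * sqn (U a) + 2 * sqn mu <= _); last first.
    by rewrite exprMn; have := UK a; move: muK; lra.
  rewrite /sqn !mulr_sumr -big_split /=; apply: ler_sum => j _; rewrite /Y.
  by have := sqr_ge0 (U a j + mu j); rewrite sqrrD sqrrB; lra.
(* The minimizer of [m th^2 v - th t]. With it the condition [th * (2 K) <= 1/3] is the hypothesis
   on [t * K]. *)
pose th := t / (2 * m%:R * v).
have mv : 0 < m%:R * v by rewrite mulr_gt0.
have thK : th * (2 * K) <= 3^-1.
  rewrite /th (_ : _ * _ = t * K / (m%:R * v)); last by field; rewrite !gt_eqF.
  by rewrite ler_pdivrMr //; lra.
have th0 : 0 <= th by rewrite divr_ge0 // ltW // -mulrA mulr_gt0.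
have := bernstein_count m Y0 YK (le_trans sYU Uv) th0 (mulr_ge0 (ler0n R 2) K0) thK t0.
rewrite (_ : _ - th * t = - (t ^+ 2 / (4 * m%:R * v))); last first.
  by rewrite /th; field; rewrite !gt_eqF.
apply: le_trans; rewrite ler_nat; apply: subset_leq_card; apply/fintype.subsetP => f.
rewrite !inE => /le_trans; apply; rewrite le_eqVlt; apply/orP; left; apply/eqP.
apply: eq_bigr => j _; congr (_ ^+ 2).
rewrite muE sumrB sumr_const card_ord -[mu j *+ m]mulr_natl; congr (_ - _).
by field; rewrite gt_eqF.
Qed.

Definition dev m n (f : 'I_m -> 'I_n) (x : 'cV[C]_n) : 'cV[C]_n :=
  (m%:R / n%:R)^-1%:C *: opP f x - x.

(** A complex number as a vector of two real coordinates indexed by [bool], the form in which the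
    real vector inequality applies. *)
Definition cvec (z : C) (b : bool) : R := if b then complex.Re z else complex.Im z.

Lemma sqn_cvec z : sqn (cvec z) = nrm2 z.
Proof. by rewrite /sqn big_bool. Qed.

Lemma cvec_sum (I : finType) (F : I -> C) b :
  cvec (\sum_i F i) b = \sum_i cvec (F i) b.
Proof. by case: b; rewrite /cvec ?cRe_sum ?cIm_sum. Qed.

Lemma cvecZ (c : R) z b : cvec (c%:C * z) b = c * cvec z b.
Proof. by case: b; case: z => p q; rewrite /cvec; simpc. Qed.

Lemma cvecB z z' b : cvec (z - z') b = cvec z b - cvec z' b.
Proof. by case: b; case: z; case: z'. Qed.

Lemma dft_dev m n (w : C) (f : 'I_m -> 'I_n) (x : 'cV[C]_n) (l : 'I_n) :
  dft w (dev f x) l =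
  (n%:R / m%:R)%:C * \sum_k w ^+ (l * f k) * x (f k) 0 - \sum_(a < n) w ^+ (l * a) * x a 0.
Proof.
rewrite /dft /dev; under eq_bigr do rewrite !mxE mulrBr.
rewrite sumrB; congr (_ - _); rewrite invf_div mulr_sumr.
under eq_bigr do rewrite summxE !mulr_sumr.
rewrite exchange_big; apply: eq_bigr => k _ /=.
rewrite (bigD1 (f k)) //= big1 ?addr0 => [|a /negbTE fk].
  by rewrite !mxE !eqxx mulr1 mulrCA.
by rewrite !mxE fk /= !mulr0.
Qed.

(** [X] bounds the largest entry and [W] the total energy; [dl * X <= W / 3] keeps the deviation in
    the range where the variance governs the exponent. *)
Lemma dft_dev_count m n (w : C) (x : 'cV[C]_n) (l : 'I_n) (X W dl : R) :
  (0 < n)%N -> (0 < m)%N -> n.-primitive_root w ->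
  (forall a, nrm2 (x a 0) <= X ^+ 2) -> \sum_a nrm2 (x a 0) <= W ->
  0 <= X -> 0 < W -> 0 <= dl -> dl * X <= W / 3 ->
  #|[set f : {ffun 'I_m -> 'I_n} | dl ^+ 2 <= nrm2 (dft w (dev f x) l)]%SET|%:R
    <= 2 * expR (- (dl ^+ 2 * m%:R / (4 * n%:R * W))) * n%:R ^+ m :> R.
Proof.
move=> n_gt0 m_gt0 w_prim xX xW X0 W0 dl0 dlX.
have nR : 0 < n%:R :> R by rewrite ltr0n.
have mR : 0 < m%:R :> R by rewrite ltr0n.
pose U (a : 'I_n) := cvec ((n%:R / m%:R)%:C * (w ^+ (l * a) * x a 0)).
have UE a : sqn (U a) = (n%:R / m%:R) ^+ 2 * nrm2 (x a 0).
  by rewrite sqn_cvec !nrm2M nrm2_real (nrm2_primX n_gt0 w_prim) mul1r.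
have nm0 : 0 < n%:R / m%:R :> R by rewrite divr_gt0.
have := @bernstein_centered _ n U m (n%:R / m%:R * X) (n%:R * W / m%:R ^+ 2) dl n_gt0 m_gt0.
rewrite (_ : dl ^+ 2 / _ = dl ^+ 2 * m%:R / (4 * n%:R * W)); last first.
  by field; rewrite !gt_eqF.
have h1 a : sqn (U a) <= (n%:R / m%:R * X) ^+ 2.
  by rewrite UE [leRHS]exprMn ler_wpM2l ?sqr_ge0.
have h2 : \sum_a sqn (U a) <= n%:R * (n%:R * W / m%:R ^+ 2).
  under eq_bigr do rewrite UE.
  rewrite -mulr_sumr [leRHS](_ : _ = (n%:R / m%:R) ^+ 2 * W); last first.
    by field; rewrite gt_eqF.
  by rewrite ler_wpM2l // sqr_ge0.
have h3 : 0 <= n%:R / m%:R * X by rewrite mulr_ge0 // ltW.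
have h4 : 0 < n%:R * W / m%:R ^+ 2 by rewrite divr_gt0 ?mulr_gt0 ?exprn_gt0.
have h5 : dl * (n%:R / m%:R * X) <= m%:R * (n%:R * W / m%:R ^+ 2) / 3.
  rewrite [leLHS](_ : _ = n%:R / m%:R * (dl * X)); last by ring.
  rewrite [leRHS](_ : _ = n%:R / m%:R * (W / 3)); last by field; rewrite gt_eqF.
  by rewrite ler_pM2l.
move=> /(_ h1 h2 h3 h4 dl0 h5); apply: le_trans.
rewrite ler_nat; apply: subset_leq_card; apply/fintype.subsetP => f; rewrite !inE.
rewrite dft_dev -sqn_cvec => /le_trans; apply; rewrite le_eqVlt; apply/orP; left.
apply/eqP; apply: eq_bigr => b _; congr (_ ^+ 2); rewrite cvecB; congr (_ - _).
  by rewrite mulr_sumr cvec_sum.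
rewrite cvec_sum mulr_sumr; apply: eq_bigr => a _; rewrite /U cvecZ.
by field; rewrite !gt_eqF.
Qed.

(** The real coordinates of the rank-one operator attached to [X], the kernel of the quadratic form
    [L |-> |<X, L>|^2]. *)
Definition gramvec n1 n2 (X : 'M[C]_(n1, n2)) (pq : ('I_n1 * 'I_n2) * ('I_n1 * 'I_n2) * bool) : R :=
  cvec ((X pq.1.1.1 pq.1.1.2)^* * X pq.1.2.1 pq.1.2.2) pq.2.

Lemma sum_pair (I J : finType) (F : I * J -> R) : \sum_p F p = \sum_i \sum_j F (i, j).
Proof. by rewrite (eq_bigr (fun p => F (p.1, p.2))) => [|[]//]; rewrite -(pair_bigA _ (fun i j => F (i, j))). Qed.

Lemma sqn_gramvec n1 n2 (X : 'M[C]_(n1, n2)) : sqn (gramvec X) = rdot X X ^+ 2.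
Proof.
have -> : rdot X X = \sum_p nrm2 (X p.1 p.2) by rewrite rdot_nrm2 pair_bigA.
rewrite /sqn [LHS]sum_pair [LHS]sum_pair expr2 mulr_suml.
apply: eq_bigr => p _; rewrite mulr_sumr; apply: eq_bigr => q _.
by rewrite big_bool /gramvec /= -[LHS]/(nrm2 _) nrm2M nrm2J.
Qed.

(** The quadratic form is linear in its kernel, being the Hilbert-Schmidt pairing of two rank-one
    operators. A deviation bound on kernels is thus uniform in [L]. *)
Lemma gramvec_pairing n1 n2 (X L : 'M[C]_(n1, n2)) :
  nrm2 (mxdot X L) = \sum_pq gramvec X pq * gramvec L pq.
Proof.
have -> : nrm2 (mxdot X L) = complex.Re (mxdot X L * (mxdot X L)^*).
  by rewrite cReM cReJ cImJ mulrN opprK -!expr2.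
rewrite mxdotE pair_bigA rmorph_sum /= mulr_suml cRe_sum [RHS]sum_pair [RHS]sum_pair.
apply: eq_bigr => p _; rewrite mulr_sumr cRe_sum; apply: eq_bigr => q _ /=.
rewrite big_bool rmorphM /= /gramvec /=.
set a := X _ _; set b := X _ _; set c := L _ _; set e := L _ _.
by case: a b c e => [a a'] [b b'] [c c'] [e e'] /=; ring.
Qed.

(* The quadratic form [L |-> \sum_a nrm2 <X a, L>] has a kernel of
   Hilbert-Schmidt norm at most [\sum_a |X a|^2], so that the dimension-free
   bound above controls it uniformly in [L]. *)
Lemma quadratic_form_count m n n1 n2 (X : 'I_n -> 'M[C]_(n1, n2)) (K e : R) :
  (0 < n)%N -> (0 < m)%N -> (forall a, n%:R * rdot (X a) (X a) <= K) ->
  0 < K -> 0 <= e -> e <= K / 3 ->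
  exists2 B : {set {ffun 'I_m -> 'I_n}},
    #|B|%:R <= 2 * expR (- (e ^+ 2 * m%:R / (4 * K ^+ 2))) * n%:R ^+ m :> R &
    forall f, f \notin B -> forall L : 'M[C]_(n1, n2),
      `|n%:R / m%:R * (\sum_k nrm2 (mxdot (X (f k)) L)) - \sum_a nrm2 (mxdot (X a) L)|
        <= e * rdot L L.
Proof.
move=> n_gt0 m_gt0 XK K0 e0 eK.
have nR : 0 < n%:R :> R by rewrite ltr0n.
have mR : 0 < m%:R :> R by rewrite ltr0n.
pose U a pq := n%:R * gramvec (X a) pq.
have UE a : sqn (U a) = (n%:R * rdot (X a) (X a)) ^+ 2.
  rewrite exprMn -sqn_gramvec /sqn mulr_sumr; apply: eq_bigr => pq _.
  by rewrite exprMn.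
have h1 a : sqn (U a) <= K ^+ 2.
  by rewrite UE lerXn2r ?nnegrE ?(ltW K0) // mulr_ge0 ?rdot_ge0.
have h2 : \sum_a sqn (U a) <= n%:R * K ^+ 2.
  apply: le_trans (ler_sum _ (fun a _ => h1 a)) _.
  by rewrite sumr_const card_ord -[K ^+ 2 *+ n]mulr_natl.
have h4 : 0 < K ^+ 2 by rewrite exprn_gt0.
have h3 : 0 <= m%:R * e by rewrite mulr_ge0 // ltW.
have h5 : m%:R * e * K <= m%:R * K ^+ 2 / 3.
  rewrite [leRHS](_ : _ = m%:R * (K / 3 * K)); last by field.
  by rewrite -[leLHS]mulrA (ler_pM2l mR) (ler_pM2r K0).
have := bernstein_centered n_gt0 m_gt0 h1 h2 (ltW K0) h4 h3 h5.
rewrite (_ : (m%:R * e) ^+ 2 / _ = e ^+ 2 * m%:R / (4 * K ^+ 2)); last first.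
  by field; rewrite !gt_eqF.
move=> cnt; eexists; first exact: cnt.
move=> f; rewrite inE -ltNge; set S := (fun j => _) => Slt L.
have E : m%:R * (n%:R / m%:R * (\sum_k nrm2 (mxdot (X (f k)) L)) - \sum_a nrm2 (mxdot (X a) L))
    = \sum_pq S pq * gramvec L pq.
  rewrite /S; under [RHS]eq_bigr do rewrite mulrBl.
  rewrite sumrB mulrBr; congr (_ - _).
    rewrite mulrA (_ : m%:R * _ = n%:R); last by field; rewrite gt_eqF.
    under [RHS]eq_bigr do rewrite mulr_suml.
    rewrite exchange_big mulr_sumr; apply: eq_bigr => k _; rewrite gramvec_pairing mulr_sumr.
    by apply: eq_bigr => pq _; rewrite mulrA.
  transitivity (\sum_pq \sum_a m%:R * (gramvec (X a) pq * gramvec L pq)).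
    rewrite exchange_big mulr_sumr; apply: eq_bigr => a _.
    by rewrite gramvec_pairing mulr_sumr.
  apply: eq_bigr => pq _; rewrite mulr_sumr mulr_suml; apply: eq_bigr => a _.
  by rewrite /U; field; rewrite gt_eqF.
rewrite -(ler_pM2l mR) -{1}(gtr0_norm mR) -normrM E.
rewrite -(@ler_pXn2r _ 2) // ?nnegrE ?mulr_ge0 ?rdot_ge0 ?(ltW mR) //.
rewrite real_normK ?num_real // (le_trans (sum_CS _ _)) // sqn_gramvec.
rewrite [leRHS](_ : _ = (m%:R * e) ^+ 2 * rdot L L ^+ 2); last by ring.
by rewrite ler_wpM2r ?sqr_ge0 // ltW.
Qed.

End Deviation.

(** * One gradient step *)

Section Contraction.
Local Open Scope complex_scope.
Local Open Scope sesquilinear_scope.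
Context {R : realType}.
Local Notation C := R[i].

Lemma mx_identity1 n (P S S' : 'M[C]_n) : P + (P + S' - S) - (S' + S) = P - S + (P - S).
Proof. by apply/matrixP => i j; rewrite !mxE; ring. Qed.

Lemma mx_identity2 n (a b c d e g h : 'M[C]_n) :
  a + b + (c + d) - (a + e + (g + h)) = b + c - (e + g) + (d - h).
Proof. by apply/matrixP => i j; rewrite !mxE; ring. Qed.

Lemma mx_identity3 n (b c d e g h : 'M[C]_n) :
  b + d - (e + h) + (c + d - (g + h)) = b + c - (e + g) + (d - h) + (d - h).
Proof. by apply/matrixP => i j; rewrite !mxE; ring. Qed.

Section Curvature.

Variables (n1 n2 r : nat) (MU HU : 'M[C]_(n1, r)) (MV HV : 'M[C]_(n2, r)) (sr : R).
Hypothesis bal : MU^t* *m MU = MV^t* *m MV.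
Hypothesis M_min : forall k (X : 'M[C]_(r, k)), sr * rdot X X <= rdot (MU *m X) (MU *m X).
Hypothesis herm : HU^t* *m MU + HV^t* *m MV = MU^t* *m HU + MV^t* *m HV.

Let D := MU^t* *m HU + HU^t* *m MU - (MV^t* *m HV + HV^t* *m MV).
Let K := HU^t* *m HU - HV^t* *m HV.
Let L := MU *m HV^t* + HU *m MV^t*.

Lemma frob_le m n (A : 'M[C]_(m, n)) (x : R) : 0 <= x -> rdot A A <= x ^+ 2 -> frob A <= x.
Proof. by move=> x0 Ax; rewrite -ler_sqr ?nnegrE ?frob_ge0 // frob_sqr. Qed.

Lemma M_minU k (X : 'M[C]_(k, r)) : sr * rdot X X <= rdot (X *m MU^t*) (X *m MU^t*).
Proof. by rewrite -(rdot_adj X) -(rdot_adj (X *m _)) adjM trmxCK. Qed.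

Lemma M_minV k (X : 'M[C]_(k, r)) : sr * rdot X X <= rdot (X *m MV^t*) (X *m MV^t*).
Proof.
apply: le_trans (M_minU X) _.
by rewrite !(rdot_adjr X) !trmxCK -!mulmxA bal.
Qed.

(* For the balanced factorization the regularizer compensates exactly the
   indefinite part of [|L|^2]: the sum exceeds [sr |H|^2] by [|P + S^*|^2 / 2]. *)
Lemma curvature : sr * (rdot HU HU + rdot HV HV) <= rdot L L + 1 / 8 * rdot D D.
Proof.
pose P := MU^t* *m HU; pose S := HV^t* *m MV.
have PE : HU^t* *m MU = P^t* by rewrite adjM trmxCK.
have SE : MV^t* *m HV = S^t* by rewrite adjM trmxCK.
have DE : D = (2 : R)%:C *: (P - S).
  have h := herm; rewrite PE SE -/P -/S in h.
  rewrite /D PE SE -/P -/S.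
  rewrite (_ : (2 : R)%:C = 1 + 1); last by rewrite -(rmorphD (real_complex R)).
  rewrite scalerDl scale1r.
  have -> : P^t* = P + S^t* - S by rewrite -h addrK.
  exact: mx_identity1.
have LL : rdot L L = rdot (MU *m HV^t*) (MU *m HV^t*) + rdot (HU *m MV^t*) (HU *m MV^t*) + 2 * rdot P S.
  rewrite /L !rdotDl !rdotDr (rdotC (HU *m _) (MU *m _)) (rdot_outer MU HU HV MV) -/P -/S.
  by move: (rdot _ _) (rdot _ _) (rdot _ _) => a b c; lra.
have h1 : sr * rdot HV HV <= rdot (MU *m HV^t*) (MU *m HV^t*).
  by rewrite -(rdot_adj (MU *m _)) adjM trmxCK M_minU.
have h2 := M_minV HU; have h3 := rdot_ge0 (P + S).
rewrite LL DE rdotZl rdotZr; move: h3 h1 h2.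
rewrite !rdotDl !rdotDr !rdotNl !rdotNr (rdotC S P).
move: (rdot P P) (rdot P S) (rdot S S) (rdot (MU *m _) _) (rdot (HU *m _) _) (rdot HU HU) (rdot HV HV).
by move=> *; lra.
Qed.

Let ZU := MU + HU.
Let ZV := MV + HV.
Let E := ZU^t* *m ZU - ZV^t* *m ZV.

Lemma imbalanceE : E = D + K.
Proof.
rewrite /E /D /K /ZU /ZV !adjD !mulmxDl !mulmxDr bal.
exact: mx_identity2.
Qed.

Lemma frob_K : rdot K K <= (rdot HU HU + rdot HV HV) ^+ 2.
Proof.
rewrite -(frob_sqr K) lerXn2r ?nnegrE ?frob_ge0 ?addr_ge0 ?rdot_ge0 //.
apply: le_trans (frobD _ _) _; rewrite [frob (- _)]frobE rdotNl rdotNr opprK -frobE.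
by apply: lerD; apply: le_trans (frob_mulmx _ _) _; rewrite frob_adj -expr2 frob_sqr.
Qed.

(** In the imbalance [E = D + K], [D] is linear and [K] quadratic in [H]. As [E] is Hermitian, only
    Hermitian parts pair with it, and the right side becomes [<D + K, D + 2 K> / 8]. This exceeds
    [|D|^2 / 16 - 5 |K|^2 / 16] by [|D + 3 K|^2 / 16]. *)
Lemma regularizer_lower :
  1 / 16 * rdot D D - 5 / 16 * (rdot HU HU + rdot HV HV) ^+ 2 <=
  1 / 4 * (rdot (ZU *m E) HU - rdot (ZV *m E) HV).
Proof.
have EH : E^t* = E by rewrite /E adjD adjN !adjM !trmxCK.
have tw (X : 'M[C]_r) : rdot E X = 1 / 2 * rdot E (X + X^t*).
  have := rdot_adj E X; rewrite EH rdotDr; move: (rdot _ _) (rdot _ _) => a b; lra.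
have -> : rdot (ZU *m E) HU - rdot (ZV *m E) HV = 1 / 2 * rdot (D + K) (D + K + K).
  rewrite !rdot_adjl -rdotNr -rdotDr tw imbalanceE; congr (_ * rdot _ _).
  rewrite /D /K /ZU /ZV !(adjD, adjN, adjM, trmxCK) !mulmxDl !mulmxDr.
  exact: mx_identity3.
have := frob_K; have := rdot_ge0 (D + (3 : R)%:C *: K).
move: (D) (K) => D' K'.
rewrite !rdotDl !rdotDr !rdotZl !rdotZr (rdotC K' D').
move: (rdot D' D') (rdot D' K') (rdot K' K') ((_ + _) ^+ 2) => a b c e; lra.
Qed.

End Curvature.
End Contraction.

Section Descent.
Local Open Scope complex_scope.
Local Open Scope sesquilinear_scope.
Context {R : realType}.
Local Notation C := R[i].

Definition row_bounded m n (b : R) (A : 'M[C]_(m, n)) : Prop :=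
  forall i, rdot (row i A) (row i A) <= b.

Lemma row_bounded_rdot m n k (b : R) (A : 'M[C]_(m, k)) :
  (m <= n)%N -> 0 <= b -> row_bounded b A -> rdot A A <= n%:R * b.
Proof.
move=> mn b0 Ab; rewrite rdot_rows; apply: le_trans (ler_sum _ (fun i _ => Ab i)) _.
by rewrite sumr_const card_ord -[b *+ m]mulr_natl ler_wpM2r // ler_nat.
Qed.

Lemma row_boundedB m n (b : R) (A B : 'M[C]_(m, n)) :
  row_bounded b A -> row_bounded b B -> row_bounded (4 * b) (A - B).
Proof.
move=> Ab Bb i; rewrite linearB /=.
have := rdot_ge0 (row i A + row i B); move: (Ab i) (Bb i).
rewrite !rdotDl !rdotDr !rdotNl !rdotNr (rdotC (row i B)).
by move: (rdot _ _) (rdot _ _) (rdot _ _) => x y z; lra.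
Qed.

(** With [f = |z|] and [t = B / f], the decrease is [(1 - t) ((1 + t) f^2 - 2 <z, y>)], and
    Cauchy-Schwarz gives [<z, y> <= f B = t f^2]. *)
Lemma clip_row_le n (B : R) (z y : 'rV[C]_n) : 0 <= B -> rdot y y <= B ^+ 2 ->
  B ^+ 2 < rdot z z ->
  rdot ((B / frob z)%:C *: z - y) ((B / frob z)%:C *: z - y) <= rdot (z - y) (z - y).
Proof.
move=> B0 yB zB; set f := frob z.
have fB : B < f by rewrite -ltr_sqr ?nnegrE ?frob_ge0 // frob_sqr.
have f0 : 0 < f by exact: le_lt_trans fB.
have zE : rdot z z = f ^+ 2 by rewrite frob_sqr.
pose t := B / f.
have tf : t * f = B by rewrite /t divfK // gt_eqF.
have t1 : t <= 1 by rewrite ler_pdivrMr // mul1r ltW.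
have t0 : 0 <= t by rewrite divr_ge0 // ltW.
have cs : rdot z y <= f * B.
  apply: le_trans (rdot_CSw _ _) _; rewrite ler_wpM2l ?frob_ge0 //.
  by rewrite -ler_sqr ?nnegrE ?frob_ge0 // frob_sqr.
rewrite -/t !rdotDl !rdotDr !rdotNl !rdotNr !rdotZl !rdotZr zE (rdotC y z).
move: (rdot z y) cs (rdot y y) => x cs w.
have h : 0 <= (1 - t) * (f * B - x) by rewrite mulr_ge0 // subr_ge0.
have h2 : 0 <= (1 - t) * (f * (f - B)).
  by rewrite mulr_ge0 ?subr_ge0 // mulr_ge0 ?ltW // subr_gt0.
have -> : t * (t * f ^+ 2) = B ^+ 2 by rewrite -tf; ring.
have h3 : t * (f * B) = B ^+ 2 by rewrite mulrA tf.
have h4 : t * (f * f) = B * f by rewrite mulrA tf.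
move: h h2 h3 h4; rewrite !mulrBl !mulrBr !mul1r !expr2 => *; lra.
Qed.

Lemma clip_le m n (B : R) (Z Y : 'M[C]_(m, n)) : 0 <= B -> row_bounded (B ^+ 2) Y ->
  rdot (clip B Z - Y) (clip B Z - Y) <= rdot (Z - Y) (Z - Y).
Proof.
move=> B0 YB; rewrite rdot_rows [leRHS]rdot_rows; apply: ler_sum => i _.
rewrite !linearB /= .
have [ZB|ZB] := ltP B (rownorm Z i).
  have -> : row i (clip B Z) = (B / frob (row i Z))%:C *: row i Z.
    by apply/rowP => j; rewrite !mxE ZB.
  apply: clip_row_le => //; rewrite -frob_sqr ltr_sqr ?nnegrE ?frob_ge0 //.
suff -> : row i (clip B Z) = row i Z by [].
by apply/rowP => j; rewrite !mxE ltNge ZB.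
Qed.

Lemma clip_row_bounded m n (B : R) (Z : 'M[C]_(m, n)) : 0 <= B ->
  row_bounded (B ^+ 2) (clip B Z).
Proof.
move=> B0 i; have [ZB|ZB] := ltP B (rownorm Z i).
  have -> : row i (clip B Z) = (B / frob (row i Z))%:C *: row i Z.
    by apply/rowP => j; rewrite !mxE ZB.
  have f0 : 0 < frob (row i Z) by exact: le_lt_trans ZB.
  rewrite rdotZl rdotZr -frob_sqr mulrA -expr2 -exprMn divfK ?gt_eqF //.
have -> : row i (clip B Z) = row i Z.
  by apply/rowP => j; rewrite !mxE ltNge ZB.
by rewrite -frob_sqr ler_sqr ?nnegrE ?frob_ge0.
Qed.

Lemma expand_diff n1 n2 r (M H : 'M[C]_(n1, r)) (M' H' : 'M[C]_(n2, r)) :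
  (M + H) *m (M' + H')^t* - M *m M'^t* = M *m H'^t* + H *m M'^t* + H *m H'^t*.
Proof.
rewrite adjD mulmxDl !mulmxDr.
move: (M *m M'^t*) (M *m H'^t*) (H *m M'^t*) (H *m H'^t*) => a c d e.
by apply/matrixP => i j; rewrite !mxE; ring.
Qed.

Lemma expand_cross n1 n2 r (M H : 'M[C]_(n1, r)) (M' H' : 'M[C]_(n2, r)) :
  H *m (M' + H')^t* + (M + H) *m H'^t* =
  M *m H'^t* + H *m M'^t* + H *m H'^t* + H *m H'^t*.
Proof.
rewrite adjD mulmxDl !mulmxDr.
move: (M *m H'^t*) (H *m M'^t*) (H *m H'^t*) => c d e.
by apply/matrixP => i j; rewrite !mxE; ring.
Qed.

Lemma expand_imbalance n1 n2 r (M H : 'M[C]_(n1, r)) (M' H' : 'M[C]_(n2, r)) :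
  M^t* *m M = M'^t* *m M' ->
  (M + H)^t* *m (M + H) - (M' + H')^t* *m (M' + H') =
  (M + H)^t* *m H + H^t* *m M - ((M' + H')^t* *m H' + H'^t* *m M').
Proof.
move=> bal; rewrite !adjD !mulmxDl !mulmxDr bal.
move: (M'^t* *m M') (M^t* *m H) (H^t* *m M) (H^t* *m H) (M'^t* *m H') (H'^t* *m M') (H'^t* *m H').
by move=> a c d e f g k; apply/matrixP => i j; rewrite !mxE; ring.
Qed.

Lemma rdot_subZ m k (A B : 'M[C]_(m, k)) (e : R) :
  rdot (A - e%:C *: B) (A - e%:C *: B) = rdot A A - 2 * (e * rdot B A) + e * (e * rdot B B).
Proof.
rewrite !rdotDl !rdotDr !rdotNl !rdotNr !rdotZl !rdotZr (rdotC A B).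
by move: (rdot A A) (rdot B A) (rdot B B) => x y z; ring.
Qed.

Section Step.
Variables (n n1 n2 r : nat) (b tau sr c1 : R).
(** [S] stands for the form [sform] of a good sample. Keeping it an abstract positive semidefinite
    form separates the descent inequalities from the Hankel structure. *)
Variable S : 'M[C]_(n1, n2) -> 'M[C]_(n1, n2) -> R.
Hypotheses (SC : forall X Y, S X Y = S Y X)
  (SD : forall X Y Z, S X (Y + Z) = S X Y + S X Z)
  (S0 : forall X, 0 <= S X X)
  (SCS : forall X Y, S X Y ^+ 2 <= S X X * S Y Y).
Hypotheses (n1n : (n1 <= n)%N) (n2n : (n2 <= n)%N) (b0 : 0 <= b) (sr0 : 0 < sr).
Let be := n%:R * b.
Hypothesis Sl : forall (A : 'M[C]_(n1, r)) (B : 'M[C]_(n2, r)),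
  row_bounded b B -> S (A *m B^t*) (A *m B^t*) <= 2 * be * rdot A A.
Hypothesis Sr : forall (A : 'M[C]_(n1, r)) (B : 'M[C]_(n2, r)),
  row_bounded b A -> S (A *m B^t*) (A *m B^t*) <= 2 * be * rdot B B.
Hypothesis Sq : forall (A : 'M[C]_(n1, r)) (B : 'M[C]_(n2, r)),
  row_bounded (4 * b) A -> row_bounded (4 * b) B ->
  S (A *m B^t*) (A *m B^t*) <=
  2 * (rdot A A * rdot B B) + tau * (4 * be) * ((rdot A A + rdot B B) / 2).
Variables (MU ZU : 'M[C]_(n1, r)) (MV ZV : 'M[C]_(n2, r)).
Let HU := ZU - MU.
Let HV := ZV - MV.
Let h := rdot HU HU + rdot HV HV.
Hypotheses (MUb : row_bounded b MU) (MVb : row_bounded b MV)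
  (ZUb : row_bounded b ZU) (ZVb : row_bounded b ZV).
Hypothesis bal : MU^t* *m MU = MV^t* *m MV.
Hypothesis M_min : forall k (X : 'M[C]_(r, k)), sr * rdot X X <= rdot (MU *m X) (MU *m X).
Hypothesis herm : HU^t* *m MU + HV^t* *m MV = MU^t* *m HU + MV^t* *m HV.
Let L := MU *m HV^t* + HU *m MV^t*.
Hypothesis SL : 9 / 10 * rdot L L <= S L L.
Hypothesis h_small : h <= sr / 10.
Hypothesis tau_small : tau * (4 * be) <= sr * (48 / 1000).
Let E := ZU^t* *m ZU - ZV^t* *m ZV.
Let X := ZU *m ZV^t* - MU *m MV^t*.
Variables (gU : 'M[C]_(n1, r)) (gV : 'M[C]_(n2, r)).
(** The gradient enters only through its pairings: [W = H] yields the curvature and [W] equal to the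
    gradient itself yields its norm. *)
Hypothesis gradE : forall (WU : 'M[C]_(n1, r)) (WV : 'M[C]_(n2, r)),
  rdot gU WU + rdot gV WV = S X (WU *m ZV^t* + ZU *m WV^t*)
    + 1 / 4 * (rdot (ZU *m E) WU - rdot (ZV *m E) WV).

Lemma S0r Y : S Y 0 = 0.
Proof. by have := SD Y 0 0; rewrite addr0; move: (S Y 0) => z; lra. Qed.

Lemma SNr Y Z : S Y (- Z) = - S Y Z.
Proof. by have := SD Y Z (- Z); rewrite subrr S0r; move: (S Y Z) (S Y _) => s t; lra. Qed.

Lemma S_sum_le Y Z : S (Y + Z) (Y + Z) <= 2 * S Y Y + 2 * S Z Z.
Proof.
have SDl Y1 Y2 Y3 : S (Y1 + Y2) Y3 = S Y1 Y3 + S Y2 Y3 by rewrite SC SD !(SC Y3).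
have SNl Y1 Y2 : S (- Y1) Y2 = - S Y1 Y2 by rewrite SC SNr SC.
have := S0 (Y - Z); rewrite !SD !SDl !SNr !SNl (SC Z Y).
by move: (S Y Y) (S Y Z) (S Z Z) => x y z; lra.
Qed.

(** The difference of the sides is half of [S] at [Y + 3 Z], the same completion of squares as for
    the regularizer. [Y] will be the first-order term and [Z] the quadratic remainder. *)
Lemma S_quadratic_lower Y Z : 1 / 2 * S Y Y - 5 / 2 * S Z Z <= S (Y + Z) (Y + Z + Z).
Proof.
have SDl Y1 Y2 Y3 : S (Y1 + Y2) Y3 = S Y1 Y3 + S Y2 Y3 by rewrite SC SD !(SC Y3).
have := S0 (Y + Z + Z + Z); rewrite !SD !SDl (SC Z Y).
by move: (S Y Y) (S Y Z) (S Z Z) => x y z; lra.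
Qed.

Lemma ZUE : ZU = MU + HU. Proof. by rewrite addrC subrK. Qed.
Lemma ZVE : ZV = MV + HV. Proof. by rewrite addrC subrK. Qed.

(** In units of [sr * h]: [SL] and [curvature] contribute [9/20], the remainder costs
    [5/2 * 74/1000] and the quadratic part of the regularizer [5/16 * 1/10], which leaves more than
    [1/5]. *)
Lemma descent_lower : 1 / 5 * sr * h <= rdot gU HU + rdot gV HV.
Proof.
rewrite gradE.
pose Q := HU *m HV^t*.
have XE : X = L + Q by have := expand_diff MU HU MV HV; rewrite -ZUE -ZVE.
have YE : HU *m ZV^t* + ZU *m HV^t* = L + Q + Q.
  by have := expand_cross MU HU MV HV; rewrite -ZUE -ZVE.
(* The coefficient is [1/20 + 24/1000]: the product of the two norms contributes [h^2 / 2], the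
   sampling error [48/1000 * sr * h / 2]. *)
have SQ : S Q Q <= 74 / 1000 * sr * h.
  apply: le_trans (Sq (row_boundedB ZUb MUb) (row_boundedB ZVb MVb)) _.
  rewrite -/HU -/HV; have := h_small; have := tau_small; rewrite /h.
  have := rdot_ge0 HU; have := rdot_ge0 HV.
  move: (rdot HU HU) (rdot HV HV) => u v v0 u0 ts hs.
  have h1 : tau * (4 * be) * ((u + v) / 2) <= sr * (48 / 1000) * ((u + v) / 2).
    by rewrite ler_wpM2r //; lra.
  have h2 : (u + v) * (u + v) <= sr / 10 * (u + v) by rewrite ler_wpM2r ?addr_ge0.
  have h3 := sqr_ge0 (u - v); rewrite sqrrB !expr2 in h3; lra.
have data : 1 / 2 * S L L - 5 / 2 * S Q Q <= S X (HU *m ZV^t* + ZU *m HV^t*).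
  by rewrite XE YE; exact: S_quadratic_lower.
have curv := curvature bal M_min herm.
have := regularizer_lower HU HV bal.
rewrite -ZUE -ZVE => reg.
have hh : h * h <= sr / 10 * h by rewrite ler_wpM2r ?addr_ge0 ?rdot_ge0.
have sh : 0 <= sr * h by rewrite mulr_ge0 ?addr_ge0 ?rdot_ge0 ?ltW.
move: data curv reg SL SQ hh sh; rewrite -/L -/E -/h expr2.
set D := MU^t* *m HU + _ - _.
have := rdot_ge0 D.
move: (S L L) (S Q Q) (S X _) (rdot L L) (rdot D D) (rdot (ZU *m E) HU) (rdot (ZV *m E) HV) => x y z t u v w.
by move: (h) (h * h) => h' hh'; lra.
Qed.

(** The gradient is tested against itself: with [k = 4 be sqrt (h N2)] the data part is at most [k]
    and the regularizer at most [k / 4]. Squaring [N2 <= 5/4 k] and dividing by [N2] gives the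
    constant [25]. *)
Lemma descent_upper : rdot gU gU + rdot gV gV <= 25 * be ^+ 2 * h.
Proof.
have be0 : 0 <= be by rewrite mulr_ge0.
set N2 := rdot gU gU + _; have N20 : 0 <= N2 by rewrite addr_ge0 ?rdot_ge0.
have h0 : 0 <= h by rewrite addr_ge0 ?rdot_ge0.
pose k := 4 * be * Num.sqrt (h * N2).
have k0 : 0 <= k by rewrite mulr_ge0 ?sqrtr_ge0 // mulr_ge0.
have k2 : k ^+ 2 = 16 * be ^+ 2 * (h * N2).
  by rewrite exprMn sqr_sqrtr ?mulr_ge0 //; ring.
(* This asymmetric splitting has no quadratic remainder, and each product keeps one factor with
   bounded rows. *)
have XE : X = HU *m ZV^t* + MU *m HV^t*.
  by rewrite /X /HU /HV adjD adjN mulmxBl mulmxBr addrA subrK.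
have qX : S X X <= 4 * be * h.
  rewrite XE; apply: le_trans (S_sum_le _ _) _.
  have := Sl HU ZVb; have := Sr HV MUb; rewrite /h mulrDr.
  by move: (S _ _) (S _ _) (rdot _ _) (rdot _ _) => x y z t; lra.
have qW : S (gU *m ZV^t* + ZU *m gV^t*) (gU *m ZV^t* + ZU *m gV^t*) <= 4 * be * N2.
  apply: le_trans (S_sum_le _ _) _.
  have := Sl gU ZVb; have := Sr gV ZUb; rewrite /N2 mulrDr.
  by move: (S _ _) (S _ _) (rdot _ _) (rdot _ _) => x y z t; lra.
have T1 : S X (gU *m ZV^t* + ZU *m gV^t*) <= k.
  apply: le_trans (ler_norm _) _.
  rewrite -ler_sqr ?nnegrE // real_normK ?num_real // k2.
  apply: le_trans (SCS _ _) _.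
  rewrite [leRHS](_ : _ = (4 * be * h) * (4 * be * N2)); last by ring.
  by rewrite ler_pM.
pose s := Num.sqrt be; have s0 : 0 <= s by exact: sqrtr_ge0.
have s2 : s ^+ 2 = be by rewrite sqr_sqrtr.
have fb m (A : 'M[C]_(m, r)) : (m <= n)%N -> row_bounded b A -> frob A <= s.
  move=> mn Ab; apply: frob_le => //; rewrite s2; exact: row_bounded_rdot.
have EE : E = ZU^t* *m HU + HU^t* *m MU - (ZV^t* *m HV + HV^t* *m MV).
  by have := expand_imbalance HU HV bal; rewrite -ZUE -ZVE.
have fprod m1 m2 m3 (A : 'M[C]_(m1, m2)) (B : 'M[C]_(m2, m3)) x y :
    frob A <= x -> frob B <= y -> frob (A *m B) <= x * y.
  by move=> Ax By; apply: le_trans (frob_mulmx _ _) _; rewrite ler_pM ?frob_ge0.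
have frobN m1 m2 (A : 'M[C]_(m1, m2)) : frob (- A) = frob A.
  by rewrite !frobE rdotNl rdotNr opprK.
have fE : frob E <= 2 * s * (frob HU + frob HV).
  rewrite EE; apply: le_trans (frobD _ _) _; rewrite frobN.
  have := frobD (ZU^t* *m HU) (HU^t* *m MU); have := frobD (ZV^t* *m HV) (HV^t* *m MV).
  have h1 : frob (ZU^t* *m HU) <= s * frob HU by apply: fprod => //; rewrite frob_adj fb.
  have h2 : frob (ZV^t* *m HV) <= s * frob HV by apply: fprod => //; rewrite frob_adj fb.
  have h3 : frob (HU^t* *m MU) <= frob HU * s by apply: fprod; rewrite ?frob_adj // fb.
  have h4 : frob (HV^t* *m MV) <= frob HV * s by apply: fprod; rewrite ?frob_adj // fb.
  move: h1 h2 h3 h4; rewrite mulrDr.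
  move: (frob (_ *m HU)) (frob (_ *m MU)) (frob (_ *m HV)) (frob (_ *m MV)) (frob (_ + _)) (frob (_ + _)).
  by move: (frob HU) (frob HV) => u v *; lra.
have T2 : rdot (ZU *m E) gU - rdot (ZV *m E) gV <= k.
  have CS2 (x y z t : R) : 0 <= x -> 0 <= y -> 0 <= z -> 0 <= t ->
      (x + y) * (z + t) <= 2 * Num.sqrt ((x ^+ 2 + y ^+ 2) * (z ^+ 2 + t ^+ 2)).
    move=> x0 y0 z0 t0; rewrite -ler_sqr ?nnegrE ?mulr_ge0 ?addr_ge0 ?sqrtr_ge0 //.
    rewrite !exprMn sqr_sqrtr ?mulr_ge0 ?addr_ge0 ?sqr_ge0 //.
    rewrite [leRHS](_ : _ = (2 * (x ^+ 2 + y ^+ 2)) * (2 * (z ^+ 2 + t ^+ 2))); last by ring.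
    by rewrite ler_pM ?sqr_ge0 //; [have := sqr_ge0 (x - y)|have := sqr_ge0 (z - t)];
      rewrite sqrrB sqrrD; lra.
  rewrite !rdot_adjl -rdotNr -rdotDr; apply: le_trans (rdot_CSw _ _) _.
  have fg : frob (ZU^t* *m gU - ZV^t* *m gV) <= s * (frob gU + frob gV).
    apply: le_trans (frobD _ _) _; rewrite frobN mulrDr.
    by apply: lerD; apply: fprod => //; rewrite frob_adj fb.
  apply: le_trans (ler_pM (frob_ge0 _) (frob_ge0 _) fE fg) _.
  rewrite [leLHS](_ : _ = 2 * be * ((frob HU + frob HV) * (frob gU + frob gV))); last first.
    by rewrite -s2; ring.
  rewrite /k [leRHS](_ : _ = 2 * be * (2 * Num.sqrt (h * N2))); last by ring.
  rewrite ler_wpM2l ?mulr_ge0 //; apply: le_trans (CS2 _ _ _ _ _ _ _ _) _; rewrite ?frob_ge0 //.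
  by rewrite !frob_sqr.
have N2k : N2 <= 5 / 4 * k by have := gradE gU gV; rewrite -/N2 => ->; lra.
have [->|N2n] := eqVneq N2 0; first by rewrite !mulr_ge0 // sqr_ge0.
have N2gt : 0 < N2 by rewrite lt_def N2n.
rewrite -(ler_pM2r N2gt).
have : N2 ^+ 2 <= (5 / 4 * k) ^+ 2 by rewrite ler_sqr ?nnegrE // mulr_ge0.
by rewrite exprMn k2 !expr2; move: (h * N2) (h) => *; lra.
Qed.

Variable eta : R.
Hypotheses (eta0 : 0 < eta) (eta_small : eta * (25 * be ^+ 2) <= sr * (6 / 100)).

(** The cross term gains [2/5] and the squared gradient loses at most [6/100], in units of
    [eta * sr * h], so the rate [1/10] holds with room to spare. *)
Lemma descent_step :
  rdot (HU - eta%:C *: gU) (HU - eta%:C *: gU) + rdot (HV - eta%:C *: gV) (HV - eta%:C *: gV)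
  <= (1 - eta * (1 / 10 * sr)) * h.
Proof.
have lo := descent_lower; have up := descent_upper.
have h0 : 0 <= h by rewrite addr_ge0 ?rdot_ge0.
rewrite !rdot_subZ.
have H1 : eta * (1 / 5 * sr * h) <= eta * (rdot gU HU + rdot gV HV) by rewrite (ler_pM2l eta0).
have H2 : eta * (eta * (rdot gU gU + rdot gV gV)) <= eta * (sr * (6 / 100) * h).
  rewrite (ler_pM2l eta0); apply: le_trans (_ : eta * (25 * be ^+ 2 * h) <= _).
    by rewrite (ler_pM2l eta0).
  by rewrite mulrA ler_wpM2r.
have H3 : 0 <= eta * (sr * h) by rewrite !mulr_ge0 // ltW.
move: H1 H2 H3; rewrite /h mulrDr.
move: (rdot gU HU) (rdot gV HV) (rdot gU gU) (rdot gV gV) (rdot HU HU) (rdot HV HV).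
by move=> a1 a2 a3 a4 a5 a6; lra.
Qed.

End Step.
End Descent.

(** * Sampled Hankel quadratic forms *)

Section Operators.
Local Open Scope complex_scope.
Local Open Scope sesquilinear_scope.
Context {R : realType}.
Local Notation C := R[i].

Lemma two_term_CS (x y s t c p q : R) : 0 <= t -> 0 <= s -> 0 <= y -> 0 <= x -> 0 <= c ->
  p ^+ 2 <= x * y -> q ^+ 2 <= s * t -> (p + c * q) ^+ 2 <= (x + c * s) * (y + c * t).
Proof.
move=> t0 s0 y0 x0 c0 pxy qst.
have pq : 2 * (p * q) <= x * t + s * y.
  apply: le_trans (ler_norm _) _.
  rewrite -ler_sqr ?nnegrE ?addr_ge0 ?mulr_ge0 // real_normK ?num_real //.
  apply: le_trans (_ : 4 * ((x * y) * (s * t)) <= _); last first.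
    by have := sqr_ge0 (x * t - s * y); rewrite sqrrB sqrrD; move=> h; lra.
  rewrite [leLHS](_ : _ = 4 * (p ^+ 2 * q ^+ 2)); last by ring.
  by rewrite ler_pM2l // ler_pM ?sqr_ge0.
have h1 : c * (2 * (p * q)) <= c * (x * t + s * y) by rewrite ler_wpM2l.
have h2 : c ^+ 2 * q ^+ 2 <= c ^+ 2 * (s * t) by rewrite ler_wpM2l ?sqr_ge0.
rewrite [leLHS](_ : _ = p ^+ 2 + c * (2 * (p * q)) + c ^+ 2 * q ^+ 2); last by ring.
rewrite [leRHS](_ : _ = x * y + c * (x * t + s * y) + c ^+ 2 * (s * t)); last by ring.
by rewrite !lerD.
Qed.

Lemma nrm2_mxdot n1 n2 (X L : 'M[C]_(n1, n2)) : nrm2 (mxdot X L) <= rdot X X * rdot L L.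
Proof.
rewrite -(@ler_pXn2r _ 2) ?nnegrE ?nrm2_ge0 ?mulr_ge0 ?rdot_ge0 //.
by rewrite gramvec_pairing exprMn -!sqn_gramvec sum_CS.
Qed.

Lemma mxdotDr m k (A B D : 'M[C]_(m, k)) : mxdot A (B + D) = mxdot A B + mxdot A D.
Proof. by rewrite /mxdot mulmxDr raddfD. Qed.

Lemma mxdotNr m k (A B : 'M[C]_(m, k)) : mxdot A (- B) = - mxdot A B.
Proof. by rewrite /mxdot mulmxN raddfN. Qed.

Variables (n n1 n2 : nat).
Hypotheses (n1_gt0 : (0 < n1)%N) (n2_gt0 : (0 < n2)%N) (n12 : (n1 + n2 = n.+1)%N).
Local Notation G := (@opG R n n1 n2).
Local Notation Ga := (@opGadj R n n1 n2).

Lemma opGD (z t : 'cV[C]_n) : G (z + t) = G z + G t.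
Proof.
apply/matrixP => i j; rewrite !mxE -big_split; apply: eq_bigr => a _.
by rewrite !mxE mulrDr.
Qed.

Lemma opGN (z : 'cV[C]_n) : G (- z) = - G z.
Proof.
apply/matrixP => i j; rewrite !mxE -sumrN; apply: eq_bigr => a _.
by rewrite !mxE mulrN.
Qed.

Lemma opGadjD (X Y : 'M[C]_(n1, n2)) : Ga (X + Y) = Ga X + Ga Y.
Proof. by apply/matrixP => a j; rewrite !mxE mxdotDr. Qed.

Lemma opGadjN (X : 'M[C]_(n1, n2)) : Ga (- X) = - Ga X.
Proof. by apply/matrixP => a j; rewrite !mxE mxdotNr. Qed.

Lemma rdot_opG (z : 'cV[C]_n) (Z : 'M[C]_(n1, n2)) : rdot (G z) Z = rdot z (Ga Z).
Proof. by rewrite /rdot opG_adjoint. Qed.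

Lemma opGadjK (z : 'cV[C]_n) : Ga (G z) = z.
Proof. exact: opGK. Qed.

(** The orthogonal projection onto the complement of the range of [G], because [G^* G] is the
    identity. *)
Definition hankel_compl (X : 'M[C]_(n1, n2)) := X - G (Ga X).

Lemma hankel_complD X Y : hankel_compl (X + Y) = hankel_compl X + hankel_compl Y.
Proof. by rewrite /hankel_compl opGadjD opGD opprD addrACA. Qed.

Lemma opGadj_compl X : Ga (hankel_compl X) = 0.
Proof. by rewrite /hankel_compl opGadjD opGadjN opGadjK subrr. Qed.

Lemma rdot_hankel_compl X Y : rdot (hankel_compl X) Y = rdot (hankel_compl X) (hankel_compl Y).
Proof.
rewrite [in RHS]/hankel_compl [X in _ = X](_ : _ = rdot (hankel_compl X) (Y - G (Ga Y))) //.
by rewrite rdotDr rdotNr [rdot _ (G _)]rdotC rdot_opG opGadj_compl rdot0r subr0.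
Qed.

Lemma hankel_pythagoras X :
  rdot X X = rdot (hankel_compl X) (hankel_compl X) + rdot (Ga X) (Ga X).
Proof.
rewrite -rdot_hankel_compl [hankel_compl X](_ : _ = X - G (Ga X)) //.
by rewrite rdotDl rdotNl rdot_opG subrK.
Qed.

Lemma rdot_hankel_compl_le X : rdot (hankel_compl X) (hankel_compl X) <= rdot X X.
Proof. by rewrite [leRHS]hankel_pythagoras lerDl rdot_ge0. Qed.

(** The convolution of [u] and [v] at index [a]. *)
Definition antidiag (a : 'I_n) (u : 'I_n1 -> R) (v : 'I_n2 -> R) : R :=
  \sum_(i < n1) \sum_(j < n2) (if (i + j == a :> nat)%N then u i * v j else 0).

Lemma opG_delta (a : 'I_n) (i : 'I_n1) (j : 'I_n2) :
  (i + j != a :> nat)%N -> G (delta_mx a 0) i j = 0.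
Proof.
move=> ija; rewrite mxE big1 // => b /eqP bE; rewrite !mxE -val_eqE /= bE.
by rewrite (negbTE ija) mulr0.
Qed.

Lemma rdot_delta (a : 'I_n) : rdot (G (delta_mx a 0)) (G (delta_mx a 0)) = 1.
Proof.
rewrite rdot_opG opGadjK rdot_nrm2 (bigD1 a) //= big_ord1 !mxE !eqxx.
rewrite big1 ?addr0 => [|b ba]; last first.
  by rewrite big_ord1 !mxE (negbTE ba) /nrm2 /= expr0n addr0.
by rewrite /nrm2 /= expr1n expr0n addr0.
Qed.

(** The image of a basis vector under [G] has norm 1 and lives on one antidiagonal, so
    Cauchy-Schwarz is applied after restricting [A B^*] to that antidiagonal. *)
Lemma opGadj_le r (A : 'M[C]_(n1, r)) (B : 'M[C]_(n2, r)) (a : 'I_n) :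
  nrm2 (Ga (A *m B^t*) a 0) <=
  antidiag a (fun i => rdot (row i A) (row i A)) (fun j => rdot (row j B) (row j B)).
Proof.
pose Z := A *m B^t*.
pose Za : 'M[C]_(n1, n2) := \matrix_(i, j) (if (i + j == a :> nat)%N then Z i j else 0).
have -> : Ga (A *m B^t*) a 0 = mxdot (G (delta_mx a 0)) Za.
  rewrite mxE !mxdotE; apply: eq_bigr => i _; apply: eq_bigr => j _.
  rewrite [Za i j]mxE; case: ifPn => // /opG_delta ->.
  by rewrite rmorph0 !mul0r.
apply: le_trans (nrm2_mxdot _ _) _; rewrite rdot_delta mul1r rdot_nrm2.
apply: ler_sum => i _; apply: ler_sum => j _; rewrite mxE; case: ifP => _; last first.
  by rewrite /nrm2 /= expr0n addr0.
apply: le_trans (nrm2_mulmx _ _ _ _) _.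
rewrite (_ : rdot (col j (B^t*)) _ = rdot (row j B) (row j B)) //.
rewrite !rdot_nrm2 exchange_big; apply: eq_bigr => k _; apply: eq_bigr => l _.
by rewrite !mxE nrm2J.
Qed.

Lemma antidiag_lel a u v c : 0 <= c -> (forall i, 0 <= u i) -> (forall j, v j <= c) ->
  antidiag a u v <= c * \sum_i u i.
Proof.
move=> c0 u0 vc; rewrite mulr_sumr; apply: ler_sum => i _.
rewrite -big_mkcond /=.
have [j0 /eqP j0a|noj] := pickP (fun j : 'I_n2 => (i + j == a :> nat)%N).
  rewrite (big_pred1 j0) => [|j /=]; first by rewrite mulrC ler_wpM2r.
  by rewrite -j0a eqn_add2l.
by rewrite big_pred0 // mulr_ge0.
Qed.

Lemma antidiag_ler a u v c : 0 <= c -> (forall j, 0 <= v j) -> (forall i, u i <= c) ->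
  antidiag a u v <= c * \sum_j v j.
Proof.
move=> c0 v0 uc; rewrite /antidiag exchange_big mulr_sumr; apply: ler_sum => j _.
rewrite -big_mkcond /=.
have [i0 /eqP i0a|noi] := pickP (fun i : 'I_n1 => (i + j == a :> nat)%N).
  rewrite (big_pred1 i0) => [|i /=]; first by rewrite ler_wpM2r.
  by rewrite -i0a eqn_add2r.
by rewrite big_pred0 // mulr_ge0.
Qed.

Variables (m : nat) (f : 'I_m -> 'I_n).
Hypothesis m_gt0 : (0 < m)%N.

Definition sampled (X : 'M[C]_(n1, n2)) : 'cV[C]_m := \col_k Ga X (f k) 0.

(** A bilinear form whose quadratic form at [X - G y] is the data part of [objective], with repeated
    samples counted. *)
Definition sform (X Y : 'M[C]_(n1, n2)) : R :=
  rdot (hankel_compl X) (hankel_compl Y) + n%:R / m%:R * rdot (sampled X) (sampled Y).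

Lemma nm_ge0 : 0 <= n%:R / m%:R :> R.
Proof. by rewrite divr_ge0. Qed.

Lemma sampledD X Y : sampled (X + Y) = sampled X + sampled Y.
Proof. by apply/matrixP => k j; rewrite mxE opGadjD !mxE. Qed.

Lemma sformC X Y : sform X Y = sform Y X.
Proof. by rewrite /sform rdotC (rdotC (sampled _)). Qed.

Lemma sformD X Y Z : sform X (Y + Z) = sform X Y + sform X Z.
Proof.
rewrite /sform hankel_complD sampledD !rdotDr mulrDr.
exact: addrACA.
Qed.

Lemma sform_ge0 X : 0 <= sform X X.
Proof. by rewrite addr_ge0 ?rdot_ge0 // mulr_ge0 ?rdot_ge0 ?nm_ge0. Qed.

Lemma sform_CS X Y : sform X Y ^+ 2 <= sform X X * sform Y Y.
Proof. by apply: two_term_CS; rewrite ?rdot_ge0 ?nm_ge0 ?rdot_CS2. Qed.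

Lemma sampledE X : rdot (sampled X) (sampled X) = \sum_k nrm2 (Ga X (f k) 0).
Proof. by rewrite rdot_nrm2; apply: eq_bigr => k _; rewrite big_ord1 mxE. Qed.

Lemma sampled_le X c : (forall k, nrm2 (Ga X (f k) 0) <= c) ->
  n%:R / m%:R * rdot (sampled X) (sampled X) <= n%:R * c.
Proof.
move=> Xc; apply: le_trans (_ : n%:R / m%:R * (m%:R * c) <= _); last first.
  rewrite le_eqVlt; apply/orP; left; apply/eqP; field.
  by rewrite pnatr_eq0 -lt0n.
rewrite ler_wpM2l ?nm_ge0 // sampledE.
apply: le_trans (ler_sum _ (fun k _ => Xc k)) _.
by rewrite sumr_const card_ord mulr_natl.
Qed.

(** Valid for every sample: each observed entry contributes at most [b |A|^2], so the weight [n / m]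
    gives [n b |A|^2] whatever the multiplicities. *)
Lemma sform_le_l r (A : 'M[C]_(n1, r)) (B : 'M[C]_(n2, r)) b : 0 <= b -> row_bounded b B ->
  sform (A *m B^t*) (A *m B^t*) <= 2 * (n%:R * b) * rdot A A.
Proof.
move=> b0 Bb; have n2n : (n2 <= n)%N by lia.
have h1 : rdot (hankel_compl (A *m B^t*)) (hankel_compl (A *m B^t*)) <= n%:R * b * rdot A A.
  apply: le_trans (rdot_hankel_compl_le _) _; apply: le_trans (rdot_mulmx _ _) _.
  by rewrite rdot_adj mulrC ler_wpM2r ?rdot_ge0 // row_bounded_rdot.
have h2 : n%:R / m%:R * rdot (sampled (A *m B^t*)) (sampled (A *m B^t*)) <= n%:R * (b * rdot A A).
  apply: sampled_le => k; apply: le_trans (opGadj_le _ _ _) _.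
  by rewrite (rdot_rows A); apply: antidiag_lel => // i; exact: rdot_ge0.
rewrite -mulrA mulr_natl mulr2n; apply: lerD => //.
by rewrite -[leRHS]mulrA.
Qed.

Lemma sform_le_r r (A : 'M[C]_(n1, r)) (B : 'M[C]_(n2, r)) b : 0 <= b -> row_bounded b A ->
  sform (A *m B^t*) (A *m B^t*) <= 2 * (n%:R * b) * rdot B B.
Proof.
move=> b0 Ab; have n1n : (n1 <= n)%N by lia.
have h1 : rdot (hankel_compl (A *m B^t*)) (hankel_compl (A *m B^t*)) <= n%:R * b * rdot B B.
  apply: le_trans (rdot_hankel_compl_le _) _; apply: le_trans (rdot_mulmx _ _) _.
  by rewrite rdot_adj ler_wpM2r ?rdot_ge0 // row_bounded_rdot.
have h2 : n%:R / m%:R * rdot (sampled (A *m B^t*)) (sampled (A *m B^t*)) <= n%:R * (b * rdot B B).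
  apply: sampled_le => k; apply: le_trans (opGadj_le _ _ _) _.
  by rewrite (rdot_rows B); apply: antidiag_ler => // i; exact: rdot_ge0.
rewrite -mulrA mulr_natl mulr2n; apply: lerD => //.
by rewrite -[leRHS]mulrA.
Qed.

Lemma dev_one (a : 'I_n) : dev f (const_mx 1 : 'cV[C]_n) a 0 =
  (n%:R / m%:R * (\sum_k (f k == a)%:R) - 1)%:C.
Proof.
rewrite /dev !mxE summxE invf_div [RHS]rmorphB rmorph1; congr (_ - _).
rewrite [RHS]rmorphM rmorph_sum; congr (_ * _); apply: eq_bigr => k _; rewrite !mxE mul1r andbT eq_sym.
by rewrite rmorph_nat.
Qed.

(* The sampling error of the all-ones signal controls the sampled energy of
   products [A B^*] with small rows. *)
Lemma antidiag_dev (u : 'I_n1 -> R) (v : 'I_n2 -> R) :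
  n%:R / m%:R * (\sum_k antidiag (f k) u v) = (\sum_i u i) * (\sum_j v j) +
  \sum_i \sum_j complex.Re (hankel n1 n2 (dev f (const_mx 1 : 'cV[C]_n)) i j) * (u i * v j).
Proof.
rewrite mulr_suml -big_split /= exchange_big mulr_sumr; apply: eq_bigr => i _ /=.
rewrite [X in _ = X + _]mulr_sumr -big_split /= exchange_big mulr_sumr; apply: eq_bigr => j _ /=.
have ij_lt : (i + j < n)%N by have := ltn_ord i; have := ltn_ord j; lia.
rewrite (hankelE _ (a := Ordinal ij_lt)) // dev_one /=.
have -> : \sum_k (if (i + j == f k :> nat)%N then u i * v j else 0) =
    (\sum_k (f k == Ordinal ij_lt)%:R) * (u i * v j).
  rewrite mulr_suml; apply: eq_bigr => k _; rewrite -val_eqE /= eq_sym.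
  by case: eqP => _; rewrite ?mul1r ?mul0r.
ring.
Qed.

Lemma sampled_antidiag r (A : 'M[C]_(n1, r)) (B : 'M[C]_(n2, r)) dl b : 0 <= dl -> 0 <= b ->
  (forall X : 'cV[C]_n2, rdot (hankel n1 n2 (dev f (const_mx 1 : 'cV[C]_n)) *m X)
     (hankel n1 n2 (dev f (const_mx 1 : 'cV[C]_n)) *m X) <= dl ^+ 2 * rdot X X) ->
  row_bounded b A -> row_bounded b B ->
  n%:R / m%:R * rdot (sampled (A *m B^t*)) (sampled (A *m B^t*)) <=
    rdot A A * rdot B B + dl * b * ((rdot A A + rdot B B) / 2).
Proof.
move=> dl0 b0 Hdl Ab Bb.
pose u i := rdot (row i A) (row i A); pose v j := rdot (row j B) (row j B).
(* For these vectors of squared row norms, the row bound gives [|u'|^2 <= b |A|^2] and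
   [|v'|^2 <= b |B|^2], so the sampling error costs only [dl b |A| |B|]. *)
pose u' : 'cV[C]_n1 := \col_i (u i)%:C; pose v' : 'cV[C]_n2 := \col_j (v j)%:C.
have u'u : rdot u' u' <= b * rdot A A.
  rewrite rdot_nrm2 (rdot_rows A) mulr_sumr; apply: ler_sum => i _.
  by rewrite big_ord1 mxE nrm2_real expr2 ler_wpM2r ?rdot_ge0 ?Ab.
have v'v : rdot v' v' <= b * rdot B B.
  rewrite rdot_nrm2 (rdot_rows B) mulr_sumr; apply: ler_sum => i _.
  by rewrite big_ord1 mxE nrm2_real expr2 ler_wpM2r ?rdot_ge0 ?Bb.
apply: le_trans (_ : n%:R / m%:R * (\sum_k antidiag (f k) u v) <= _).
  by rewrite ler_wpM2l ?nm_ge0 // sampledE; apply: ler_sum => k _; exact: opGadj_le.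
rewrite antidiag_dev -!rdot_rows lerD2l.
set Hk := hankel _ _ _ in Hdl *.
have -> : \sum_i \sum_j complex.Re (Hk i j) * (u i * v j) = rdot u' (Hk *m v').
  rewrite rdotE; apply: eq_bigr => i _; rewrite big_ord1.
  rewrite [u' i 0]mxE [(Hk *m v') i 0]mxE /= mul0r addr0 cRe_sum mulr_sumr.
  apply: eq_bigr => j _; rewrite cReM [v' j 0]mxE /= mulr0 subr0.
  by rewrite mulrCA.
apply: le_trans (rdot_CSw _ _) _.
have h1 : frob (Hk *m v') <= dl * Num.sqrt (b * rdot B B).
  apply: frob_le; first by rewrite mulr_ge0 ?sqrtr_ge0.
  rewrite exprMn sqr_sqrtr ?mulr_ge0 ?rdot_ge0 //; apply: le_trans (Hdl _) _.
  by rewrite ler_wpM2l ?sqr_ge0.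
have h2 : frob u' <= Num.sqrt (b * rdot A A) by rewrite frobE ler_wsqrtr.
apply: le_trans (ler_pM (frob_ge0 _) (frob_ge0 _) h2 h1) _.
rewrite !sqrtrM // -!frobE [leLHS](_ : _ = dl * (Num.sqrt b) ^+ 2 * (frob A * frob B)); last by ring.
rewrite sqr_sqrtr // ler_wpM2l ?mulr_ge0 // -!frob_sqr.
by have := sqr_ge0 (frob A - frob B); rewrite sqrrB; move=> h; lra.
Qed.

Lemma sform_le_prod r (A : 'M[C]_(n1, r)) (B : 'M[C]_(n2, r)) tau b : 0 <= tau -> 0 <= b ->
  (forall X : 'cV[C]_n2, rdot (hankel n1 n2 (dev f (const_mx 1 : 'cV[C]_n)) *m X)
     (hankel n1 n2 (dev f (const_mx 1 : 'cV[C]_n)) *m X) <= (tau * n%:R) ^+ 2 * rdot X X) ->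
  row_bounded b A -> row_bounded b B ->
  sform (A *m B^t*) (A *m B^t*) <=
    2 * (rdot A A * rdot B B) + tau * (n%:R * b) * ((rdot A A + rdot B B) / 2).
Proof.
move=> tau0 b0 H Ab Bb.
have h1 : rdot (hankel_compl (A *m B^t*)) (hankel_compl (A *m B^t*)) <= rdot A A * rdot B B.
  apply: le_trans (rdot_hankel_compl_le _) _; apply: le_trans (rdot_mulmx _ _) _.
  by rewrite rdot_adj.
have h2 := sampled_antidiag (mulr_ge0 tau0 (ler0n R n)) b0 H Ab Bb.
rewrite mulr_natl mulr2n -addrA mulrA; exact: lerD.
Qed.

Lemma rdot_opP (z t : 'cV[C]_n) : rdot (opP f z) t =
  rdot (\col_k z (f k) 0) (\col_k t (f k) 0).
Proof.
rewrite rdotC /opP rdot_sumr rdotE; apply: eq_bigr => k _; rewrite big_ord1 !mxE.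
rewrite rdotE (bigD1 (f k)) //= [X in _ + X]big1 ?addr0 => [|a /negbTE ak]; last first.
  by rewrite big_ord1 !mxE ak /= mulr0 /= !mulr0 addr0.
by rewrite big_ord1 !mxE !eqxx mulr1; ring.
Qed.

(* The left factor is the matrix [A] of [gradient]. *)
Lemma rdot_residual (y : 'cV[C]_n) (X0 W : 'M[C]_(n1, n2)) :
  rdot (X0 - G (Ga X0) + (m%:R / n%:R)^-1%:C *: G (opP f (Ga X0 - y))) W =
  sform (X0 - G y) W.
Proof.
have sE : (\col_k (Ga X0 - y) (f k) 0) = sampled (X0 - G y).
  by apply/matrixP => k j; rewrite [RHS]mxE opGadjD opGadjN opGadjK !mxE.
have hE : X0 - G (Ga X0) = hankel_compl (X0 - G y).
  rewrite /hankel_compl opGadjD opGadjN opGadjK opGD opGN opprB.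
  by rewrite -addrA [- G y + _]addrA addNr add0r.
rewrite rdotDl rdotZl rdot_opG rdot_opP invf_div sE hE rdot_hankel_compl.
by congr (_ + _ * _).
Qed.

End Operators.

(** * The tangent space and the restricted isometry *)

Section Tangent.
Local Open Scope complex_scope.
Local Open Scope sesquilinear_scope.
Context {R : realType}.
Local Notation C := R[i].
Variables (n1 n2 r : nat) (U : 'M[C]_(n1, r)) (V : 'M[C]_(n2, r)).
Hypotheses (UU : U^t* *m U = 1%:M) (VV : V^t* *m V = 1%:M).

Lemma mxdot_adjl m k p (A : 'M[C]_(m, k)) (B : 'M[C]_(k, p)) D :
  mxdot (A *m B) D = mxdot B (A^t* *m D).
Proof. by rewrite /mxdot adjM mulmxA. Qed.

Lemma mxdot_adjr m k p (A : 'M[C]_(m, k)) (B : 'M[C]_(k, p)) D :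
  mxdot (A *m B) D = mxdot A (D *m B^t*).
Proof. by rewrite /mxdot adjM -mulmxA mxtrace_mulC mulmxA. Qed.

(** The orthogonal projection onto the tangent space of matrices [U A + B V^*]. *)
Definition tproj (Y : 'M[C]_(n1, n2)) : 'M[C]_(n1, n2) :=
  U *m (U^t* *m Y) + (Y - U *m (U^t* *m Y)) *m V *m V^t*.

Lemma tproj_id (A : 'M[C]_(r, n2)) (B : 'M[C]_(n1, r)) :
  tproj (U *m A + B *m V^t*) = U *m A + B *m V^t*.
Proof.
have UL : U^t* *m (U *m A + B *m V^t*) = A + U^t* *m B *m V^t*.
  by rewrite mulmxDr mulmxA UU mul1mx mulmxA.
rewrite /tproj UL mulmxDr opprD addrACA subrr add0r mulmxBl.
rewrite mulmxBl -!mulmxA (mulmxA (V^t*)) VV mul1mx.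
by rewrite [B *m _ - _]addrC addrA addrK.
Qed.

Lemma mxdot_tprojC (Y L : 'M[C]_(n1, n2)) : mxdot (tproj Y) L = mxdot Y (tproj L).
Proof.
have mxdotBl (A B D : 'M[C]_(n1, n2)) : mxdot (A - B) D = mxdot A D - mxdot B D.
  by rewrite /mxdot adjD adjN mulmxBl raddfB.
have mxdotDl (A B D : 'M[C]_(n1, n2)) : mxdot (A + B) D = mxdot A D + mxdot B D.
  by rewrite /mxdot adjD mulmxDl raddfD.
have UUY Y' L' : mxdot (U *m (U^t* *m Y')) L' = mxdot Y' (U *m (U^t* *m L')).
  by rewrite !mxdot_adjl trmxCK.
rewrite /tproj mxdotDl UUY !mxdot_adjr trmxCK mxdotBl UUY mxdotDr -!mulmxA.
by congr (_ + _); rewrite mulmxBl mxdotDr mxdotNr !mulmxA.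
Qed.

Lemma rdot_compl_le k (Y : 'M[C]_(n1, k)) :
  rdot (Y - U *m (U^t* *m Y)) (Y - U *m (U^t* *m Y)) <= rdot Y Y.
Proof.
rewrite !rdotDl !rdotDr !rdotNl !rdotNr opprK rdot_isoml // [rdot Y (U *m _)]rdotC rdot_adjl.
by have := rdot_ge0 (U^t* *m Y); move: (rdot _ _) (rdot _ _) => a b; lra.
Qed.

(** The two summands of [tproj] are orthogonal, the second having its columns in the complement of
    the range of [U]. *)
Lemma rdot_tproj (Y : 'M[C]_(n1, n2)) :
  rdot (tproj Y) (tproj Y) <= rdot (U^t* *m Y) (U^t* *m Y) + rdot (Y *m V) (Y *m V).
Proof.
pose W := (Y - U *m (U^t* *m Y)) *m V.
have WE : W = Y *m V - U *m (U^t* *m (Y *m V)) by rewrite /W mulmxBl !mulmxA.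
have cross : rdot (U *m (U^t* *m Y)) (W *m V^t*) = 0.
  by rewrite rdot_adjl WE mulmxA mulmxBr !mulmxA UU mul1mx subrr mul0mx rdot0r.
rewrite /tproj -/W; clearbody W.
rewrite rdotDl !rdotDr (rdotC (W *m _) (U *m _)) cross rdot_isoml // rdot_isomr //.
rewrite addr0 add0r lerD2l WE; exact: rdot_compl_le.
Qed.

Lemma nrm2_sum_single (I : finType) (F : I -> C) :
  (forall i j, i != j -> F i = 0 \/ F j = 0) -> nrm2 (\sum_i F i) = \sum_i nrm2 (F i).
Proof.
move=> F1; have n0 : nrm2 (0 : C) = 0 by rewrite /nrm2 /= expr0n addr0.
have [i Fi|F0] := pickP (fun i => F i != 0).
  have F0 j : j != i -> F j = 0.
    by move=> /F1[//|Fi0]; rewrite Fi0 eqxx in Fi.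
  rewrite (bigD1 i) //= [X in _ + X]big1 ?addr0 => [|j /F0//].
  by rewrite (bigD1 i) //= [X in _ + X]big1 ?addr0 => [|j /F0 ->].
by rewrite !big1 // => i _; have /eqP -> := negbFE (F0 i).
Qed.

Variables (n : nat) (c : R).
Hypotheses (n1_gt0 : (0 < n1)%N) (n2_gt0 : (0 < n2)%N) (n12 : (n1 + n2 = n.+1)%N).
Hypotheses (Uc : row_bounded c U) (Vc : row_bounded c V).

(** Every column of [Y] has at most one nonzero entry. Each entry of [U^* Y] is then a single
    product, and the squared norm is an average of squared rows of [U] with weights [|Y i j|^2] of
    sum 1. *)
Lemma energyU (a : 'I_n) :
  rdot (U^t* *m opG n1 n2 (delta_mx a 0)) (U^t* *m opG n1 n2 (delta_mx a 0)) <= c.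
Proof.
set Y := opG n1 n2 _; have Y0 (i : 'I_n1) (j : 'I_n2) : (i + j != a :> nat)%N -> Y i j = 0 by exact: opG_delta.
rewrite rdot_nrm2 (_ : \sum_i _ = \sum_i \sum_j nrm2 (Y i j) * rdot (row i U) (row i U)).
  rewrite -[c]mul1r -(rdot_delta n1_gt0 n2_gt0 n12 a) -/Y rdot_nrm2 mulr_suml.
  apply: ler_sum => i _; rewrite mulr_suml; apply: ler_sum => j _.
  by rewrite ler_wpM2l ?nrm2_ge0.
rewrite [RHS](eq_bigr (fun i => \sum_k \sum_j nrm2 (Y i j) * nrm2 (U i k))) => [|i _]; last first.
  rewrite exchange_big; apply: eq_bigr => j _; rewrite -mulr_sumr rdot_nrm2 big_ord1.
  by congr (_ * _); apply: eq_bigr => k _; rewrite mxE.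
rewrite [RHS]exchange_big; apply: eq_bigr => k _.
rewrite [RHS]exchange_big; apply: eq_bigr => j _.
rewrite mxE nrm2_sum_single => [|i i' ii'].
  by apply: eq_bigr => i _; rewrite nrm2M mulrC !mxE nrm2J.
have [ia|ia] := eqVneq (i + j)%N a; last by left; rewrite Y0 // mulr0.
right; rewrite Y0 ?mulr0 //; apply: contraNneq ii' => i'a; apply/eqP/val_inj/eqP.
by rewrite -(eqn_add2r j) ia i'a.
Qed.

Lemma energyV (a : 'I_n) :
  rdot (opG n1 n2 (delta_mx a 0) *m V) (opG n1 n2 (delta_mx a 0) *m V) <= c.
Proof.
set Y := opG n1 n2 _; have Y0 (i : 'I_n1) (j : 'I_n2) : (i + j != a :> nat)%N -> Y i j = 0 by exact: opG_delta.
rewrite rdot_nrm2 (_ : \sum_i _ = \sum_i \sum_j nrm2 (Y i j) * rdot (row j V) (row j V)).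
  rewrite -[c]mul1r -(rdot_delta n1_gt0 n2_gt0 n12 a) -/Y rdot_nrm2 mulr_suml.
  apply: ler_sum => i _; rewrite mulr_suml; apply: ler_sum => j _.
  by rewrite ler_wpM2l ?nrm2_ge0.
apply: eq_bigr => i _.
rewrite [RHS](eq_bigr (fun j => \sum_k nrm2 (Y i j) * nrm2 (V j k))) => [|j _]; last first.
  rewrite -mulr_sumr rdot_nrm2 big_ord1.
  by congr (_ * _); apply: eq_bigr => k _; rewrite mxE.
rewrite [RHS]exchange_big; apply: eq_bigr => k _.
rewrite mxE nrm2_sum_single => [|j j' jj'].
  by apply: eq_bigr => j _; rewrite nrm2M.
have [ja|ja] := eqVneq (i + j)%N a; last by left; rewrite Y0 // mul0r.
right; rewrite Y0 ?mul0r //; apply: contraNneq jj' => j'a; apply/eqP/val_inj/eqP.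
by rewrite -(eqn_add2l i) ja j'a.
Qed.

Definition tdelta (a : 'I_n) : 'M[C]_(n1, n2) := tproj (opG n1 n2 (delta_mx a 0)).

Lemma rdot_tdelta (a : 'I_n) : rdot (tdelta a) (tdelta a) <= 2 * c.
Proof.
apply: le_trans (rdot_tproj _) _; have := energyU a; have := energyV a.
by move: (rdot _ _) (rdot _ _) => x y; lra.
Qed.

(** For tangent [L], pairing with [tdelta a] gives entry [a] of [G^* L]. By [hankel_pythagoras],
    [sform f L L] then differs from [|L|^2] only by the sampling error of the quadratic form. *)
Lemma tangent_rip m (f : 'I_m -> 'I_n) (e : R) (A : 'M[C]_(r, n2)) (B : 'M[C]_(n1, r))
    (L := U *m A + B *m V^t*) :
  (forall L : 'M[C]_(n1, n2),
     `|n%:R / m%:R * (\sum_k nrm2 (mxdot (tdelta (f k)) L))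
       - \sum_a nrm2 (mxdot (tdelta a) L)| <= e * rdot L L) ->
  (1 - e) * rdot L L <= sform f L L.
Proof.
move=> /(_ L); have LE a : mxdot (tdelta a) L = opGadj n L a 0.
  by rewrite mxdot_tprojC tproj_id mxE.
under eq_bigr do rewrite LE.
under [X in _ - X]eq_bigr do rewrite LE.
rewrite ler_norml => /andP[lo _].
rewrite /sform sampledE mulrBl mul1r {1}(hankel_pythagoras n1_gt0 n2_gt0 n12 L).
have -> : rdot (opGadj n L) (opGadj n L) = \sum_a nrm2 (opGadj n L a 0).
  by rewrite rdot_nrm2; apply: eq_bigr => a _; rewrite big_ord1.
by move: lo; move: (\sum_a _) (_ / _ * _) (rdot _ _) (_ * rdot _ _) => x y z t; lra.
Qed.

End Tangent.

(** * Singular value decompositions and balanced factors *)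

Section Svd.
Local Open Scope complex_scope.
Local Open Scope sesquilinear_scope.
Context {R : realType}.
Local Notation C := R[i].

Lemma rdot_realdiag_le k p (d : 'rV[R]_p) (X : 'M[C]_(p, k)) (c : R) :
  (forall i, d 0 i ^+ 2 <= c) ->
  rdot (realdiag d *m X) (realdiag d *m X) <= c * rdot X X.
Proof. by move=> dc; apply: rdot_diag_le => i; rewrite mxE nrm2_real. Qed.

Lemma rdot_realdiag_ge k p (d : 'rV[R]_p) (X : 'M[C]_(p, k)) (c : R) :
  (forall i, c <= d 0 i ^+ 2) ->
  c * rdot X X <= rdot (realdiag d *m X) (realdiag d *m X).
Proof.
move=> dc; rewrite mul_diag_mx !rdot_nrm2 mulr_sumr; apply: ler_sum => i _.
rewrite mulr_sumr; apply: ler_sum => j _.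
by rewrite !mxE nrm2M nrm2_real ler_wpM2r ?nrm2_ge0.
Qed.

Lemma svd_pos n1 n2 r (A : 'M[C]_(n1, n2)) U s V : is_svd A U s V -> \rank A = r ->
  forall i : 'I_r, 0 < s 0 i.
Proof.
move=> [_ _ [s0 _] AE] rA i; rewrite lt_def s0 andbT; apply/eqP => si0.
have : (r <= \rank (realdiag s))%N.
  by rewrite -{1}rA AE (leq_trans (mxrankM_maxl _ _)) // mxrankM_maxr.
rewrite leqNgt ltn_neqAle rank_leq_row andbT negbK => rk.
have : realdiag s \in unitmx by rewrite -row_free_unit.
rewrite unitmxE /realdiag det_diag unitfE => /prodf_neq0/(_ i isT).
by rewrite mxE si0 eqxx.
Qed.

Lemma rdot_orthonormal n r (U : 'M[C]_(n, r)) : U^t* *m U = 1%:M -> rdot U U = r%:R.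
Proof.
move=> UU; rewrite -[U in rdot U _]mulmx1 rdot_adjl UU rdot_nrm2.
rewrite (eq_bigr (fun=> 1)) ?sumr_const ?card_ord // => i _.
rewrite (bigD1 i) //= big1 ?addr0 => [|j ji]; rewrite !mxE ?eqxx.
  by rewrite /nrm2 /= expr1n expr0n addr0.
by rewrite eq_sym (negbTE ji) /nrm2 /= expr0n addr0.
Qed.

(** Weyl's inequality for the largest singular value, with the right singular vector [v] of [A] as
    test vector. *)
Lemma svd_head_le n1 n2 r (A B : 'M[C]_(n1, n2)) U s V U' s' V' (i0 : 'I_r) :
  is_svd A U s V -> is_svd B U' s' V' -> (forall i, s' 0 i <= s' 0 i0) ->
  s 0 i0 <= s' 0 i0 + frob (A - B).
Proof.
move=> [UU VV [s0 _] AE] [UU' VV' [s0' _] BE] s'max.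
pose e : 'cV[C]_r := delta_mx i0 0; pose v := V *m e.
have ee : rdot e e = 1.
  rewrite rdot_nrm2 (bigD1 i0) //= big_ord1 !mxE !eqxx big1 ?addr0 => [|j /negbTE ji].
    by rewrite /nrm2 /= expr1n expr0n addr0.
  by rewrite big_ord1 !mxE ji /nrm2 /= expr0n addr0.
have v1 : rdot v v = 1 by rewrite rdot_isoml.
have Av : frob (A *m v) = s 0 i0.
  rewrite frobE AE /v -!mulmxA (mulmxA (V^t*)) VV mul1mx rdot_isoml //.
  rewrite (_ : realdiag s *m e = (s 0 i0)%:C *: e).
    by rewrite rdotZl rdotZr ee mulr1 -expr2 sqrtr_sqr ger0_norm.
  apply/matrixP => i j; rewrite mul_diag_mx !mxE.
  by have [->//|_] := eqVneq i i0; rewrite !mulr0.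
have Bv : frob (B *m v) <= s' 0 i0.
  apply: frob_le; rewrite ?s0' // BE -!mulmxA rdot_isoml //.
  apply: le_trans (rdot_realdiag_le _ (c := s' 0 i0 ^+ 2) _) _.
    by move=> i; rewrite lerXn2r ?nnegrE.
  by rewrite -[leRHS]mulr1 ler_wpM2l ?sqr_ge0 // -v1 rdot_coisoml.
have AB : frob ((A - B) *m v) <= frob (A - B).
  by apply: le_trans (frob_mulmx _ _) _; rewrite [frob v]frobE v1 sqrtr1 mulr1.
rewrite -Av -[A](subrK B) mulmxDl; apply: le_trans (frobD _ _) _.
by rewrite [A in frob (A - B)](subrK B) addrC lerD.
Qed.

Lemma realdiag_sqrt k (s : 'rV[R]_k) : (forall i, 0 <= s 0 i) ->
  realdiag (map_mx Num.sqrt s) *m realdiag (map_mx Num.sqrt s) = realdiag s.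
Proof.
move=> s0; rewrite mul_realdiag; congr realdiag; apply/rowP => i.
by rewrite !mxE -expr2 sqr_sqrtr.
Qed.

Section Balanced.
Variables (n1 n2 r : nat) (A : 'M[C]_(n1, n2)) (U : 'M[C]_(n1, r)) (s : 'rV[R]_r)
  (V : 'M[C]_(n2, r)).
Hypothesis A_svd : is_svd A U s V.
Let D := realdiag (map_mx Num.sqrt s).

Lemma balancedE : balanced U s V = col_mx (U *m D) (V *m D). Proof. by []. Qed.

Lemma balanced_gramU : (U *m D)^t* *m (U *m D) = realdiag s.
Proof.
have [UU _ [s0 _] _] := A_svd.
by rewrite adjM adj_realdiag -mulmxA (mulmxA (U^t*)) UU mul1mx realdiag_sqrt.
Qed.

Lemma balanced_gramV : (V *m D)^t* *m (V *m D) = realdiag s.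
Proof.
have [_ VV [s0 _] _] := A_svd.
by rewrite adjM adj_realdiag -mulmxA (mulmxA (V^t*)) VV mul1mx realdiag_sqrt.
Qed.

Lemma balanced_prod : (U *m D) *m (V *m D)^t* = A.
Proof.
have [_ _ [s0 _] AE] := A_svd.
by rewrite adjM adj_realdiag mulmxA -(mulmxA U) realdiag_sqrt.
Qed.

Lemma balanced_minU sr k (X : 'M[C]_(r, k)) : (forall i, sr <= s 0 i) ->
  sr * rdot X X <= rdot (U *m D *m X) (U *m D *m X).
Proof.
have [UU _ [s0 _] _] := A_svd => sr_le.
rewrite -mulmxA rdot_isoml //; apply: rdot_realdiag_ge => i.
by rewrite mxE sqr_sqrtr.
Qed.

Lemma row_realdiag_le m (W : 'M[C]_(m, r)) c s1 : 0 <= s1 -> row_bounded c W ->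
  (forall i, s 0 i <= s1) -> row_bounded (s1 * c) (W *m D).
Proof.
have [_ _ [s0 _] _] := A_svd => s10 Wc ss i.
rewrite row_mul -(rdot_adj (row i W *m D)) adjM adj_realdiag.
apply: le_trans (rdot_realdiag_le _ (c := s1) _) _.
  by move=> j; rewrite mxE sqr_sqrtr.
by rewrite rdot_adj ler_wpM2l.
Qed.

End Balanced.
End Svd.

(** * Spectral initialization *)

Section Initialization.
Local Open Scope complex_scope.
Local Open Scope sesquilinear_scope.
Context {R : realType}.
Local Notation C := R[i].
Variables (n n1 n2 : nat).
Hypotheses (n1_gt0 : (0 < n1)%N) (n2_gt0 : (0 < n2)%N) (n12 : (n1 + n2 = n.+1)%N).
Local Notation G := (@opG R n n1 n2).

Lemma sqrt_weightV (a : 'I_n) :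
  (Num.sqrt (weight n1 n2 a)%:R)^-1%:C * (Num.sqrt (weight n1 n2 a)%:R)%:C = 1 :> C.
Proof.
have w0 : Num.sqrt (weight n1 n2 a)%:R != 0 :> R.
  by rewrite sqrtr_eq0 -ltNge ltr0n; exact: weight_gt0.
by rewrite -rmorphM mulVf // rmorph1.
Qed.

Lemma opDK (x : 'cV[C]_n) : opDinv n1 n2 (opD n1 n2 x) = x.
Proof.
by apply/matrixP => a j; rewrite !mxE mulrA [j]ord1 sqrt_weightV mul1r.
Qed.

Lemma opG_opD (x : 'cV[C]_n) : G (opD n1 n2 x) = hankel n1 n2 x.
Proof. by rewrite /opG opDK. Qed.

Lemma opG_sampled m (f : 'I_m -> 'I_n) (x : 'cV[C]_n) :
  G (opP f (opD n1 n2 x)) = hankel n1 n2 (opP f x).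
Proof.
rewrite /opG; congr hankel; apply/matrixP => a j; rewrite !mxE !summxE mulr_sumr.
apply: eq_bigr => k _; rewrite !mxE [j]ord1 eqxx andbT.
have [->|_] := eqVneq a (f k); rewrite ?mulr0 //.
by rewrite !mulr1 mulrA sqrt_weightV mul1r.
Qed.

Lemma hankel_dev m (f : 'I_m -> 'I_n) (x : 'cV[C]_n) :
  hankel n1 n2 (dev f x) =
  (m%:R / n%:R)^-1%:C *: G (opP f (opD n1 n2 x)) - G (opD n1 n2 x).
Proof.
rewrite opG_sampled opG_opD /dev; apply/matrixP => i j.
rewrite !mxE mulr_sumr -sumrB; apply: eq_bigr => a _.
by rewrite !mxE.
Qed.

Lemma signal_entry (x : 'cV[C]_n) (a : 'I_n) :
  exists i j, hankel n1 n2 x i j = x a 0.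
Proof.
have i_lt : (minn a n1.-1 < n1)%N by lia.
have j_lt : (a - minn a n1.-1 < n2)%N by have := ltn_ord a; lia.
exists (Ordinal i_lt), (Ordinal j_lt); apply: hankelE => /=; lia.
Qed.

(** The first row of the Hankel matrix lists the entries of index at most [n2 - 1], the last column
    those of index at least [n2 - 1]. *)
Lemma signal_energy (x : 'cV[C]_n) (i0 : 'I_n1) (j0 : 'I_n2) :
  i0 = 0%N :> nat -> j0 = n2.-1 :> nat ->
  \sum_a nrm2 (x a 0) <= rdot (row i0 (hankel n1 n2 x)) (row i0 (hankel n1 n2 x)) +
    rdot (col j0 (hankel n1 n2 x)) (col j0 (hankel n1 n2 x)).
Proof.
move=> i00 j0E; rewrite !rdot_nrm2 big_ord1.
under [X in _ + X]eq_bigr do rewrite big_ord1.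
have nrm2_hankel i j : nrm2 (hankel n1 n2 x i j) =
    \sum_(a < n) if (a == i + j :> nat)%N then nrm2 (x a 0) else 0.
  have ij_lt : (i + j < n)%N by have := ltn_ord i; have := ltn_ord j; lia.
  rewrite (hankelE _ (a := Ordinal ij_lt)) // -big_mkcond (big_pred1 (Ordinal ij_lt)) //.
under [X in _ <= X + _]eq_bigr do rewrite mxE nrm2_hankel.
under [X in _ <= _ + X]eq_bigr do rewrite mxE nrm2_hankel.
rewrite exchange_big [X in _ <= _ + X]exchange_big -big_split /=.
apply: ler_sum => a _.
have [an2|an2] := ltnP a n2.
  rewrite -[leLHS]addr0 lerD //; last by apply: sumr_ge0 => i _; case: ifP; rewrite ?nrm2_ge0.
  rewrite -big_mkcond (bigD1 (Ordinal an2)) /= ?i00 // lerDl.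
  by apply: sumr_ge0 => i _; exact: nrm2_ge0.
have ia_lt : (a - n2.-1 < n1)%N by have := ltn_ord a; lia.
rewrite -[leLHS]add0r lerD //; first by apply: sumr_ge0 => i _; case: ifP; rewrite ?nrm2_ge0.
rewrite -big_mkcond (bigD1 (Ordinal ia_lt)) /= ?lerDl; last by apply/eqP; lia.
by apply: sumr_ge0 => i _; exact: nrm2_ge0.
Qed.

Section SignalBounds.
Variables (r : nat) (x : 'cV[C]_n) (U : 'M[C]_(n1, r)) (s : 'rV[R]_r) (V : 'M[C]_(n2, r)).
Variables (c s1 : R).
Hypotheses (x_svd : is_svd (hankel n1 n2 x) U s V) (s_le : forall i, s 0 i <= s1).
Hypotheses (s10 : 0 <= s1) (c0 : 0 <= c) (Uc : row_bounded c U) (Vc : row_bounded c V).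

Lemma row_realdiag_sq k (W : 'M[C]_(k, r)) : row_bounded c W ->
  row_bounded (s1 ^+ 2 * c) (W *m realdiag s).
Proof.
have [_ _ [s0 _] _] := x_svd => Wc i.
rewrite row_mul -(rdot_adj (row i W *m realdiag s)) adjM adj_realdiag.
apply: le_trans (rdot_realdiag_le _ (c := s1 ^+ 2) _) _.
  by move=> j; rewrite lerXn2r ?nnegrE.
by rewrite rdot_adj ler_wpM2l ?sqr_ge0.
Qed.

Lemma rdot_col_adj k (W : 'M[C]_(k, r)) j :
  rdot (col j (W^t*)) (col j (W^t*)) = rdot (row j W) (row j W).
Proof.
rewrite !rdot_nrm2 exchange_big; apply: eq_bigr => i _; apply: eq_bigr => l _.
by rewrite !mxE nrm2J.
Qed.

Lemma signal_entry_le (a : 'I_n) : nrm2 (x a 0) <= (s1 * c) ^+ 2.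
Proof.
have [i [j <-]] := signal_entry x a; have [_ _ _ ->] := x_svd.
apply: le_trans (nrm2_mulmx _ _ _ _) _; rewrite rdot_col_adj.
rewrite [leRHS](_ : _ = (s1 ^+ 2 * c) * c); last by ring.
by rewrite ler_pM ?rdot_ge0 // row_realdiag_sq.
Qed.

Lemma signal_energy_le : \sum_a nrm2 (x a 0) <= 2 * s1 ^+ 2 * c.
Proof.
have [UU VV _ E] := x_svd.
have j_lt : (n2.-1 < n2)%N by rewrite prednK.
apply: le_trans (@signal_energy x (Ordinal n1_gt0) (Ordinal j_lt) _ _) _ => //.
rewrite E -mulrA mulr_natl mulr2n; apply: lerD.
  rewrite row_mul rdot_isomr //; exact: row_realdiag_sq.
rewrite -(rdot_adj (col _ _)) (_ : (col _ _)^t* = row (Ordinal j_lt) ((U *m realdiag s *m V^t*)^t*)).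
  rewrite !adjM trmxCK adj_realdiag mulmxA row_mul rdot_isomr //; exact: row_realdiag_sq.
by apply/matrixP => i j; rewrite !mxE.
Qed.

End SignalBounds.

Section InitError.
Variables (r m : nat) (f : 'I_m -> 'I_n) (x : 'cV[C]_n).
Variables (U U0 : 'M[C]_(n1, r)) (s s0 : 'rV[R]_r) (V V0 : 'M[C]_(n2, r)) (L0 : 'M[C]_(n1, n2)).
Variable dl : R.
Let y := opD n1 n2 x.
Hypotheses (y_svd : is_svd (G y) U s V) (init : pgd_init y f L0 U0 s0 V0).
Hypotheses (n_gt0 : (0 < n)%N) (m_gt0 : (0 < m)%N) (dl0 : 0 <= dl).
Hypothesis dev_l : forall k (X : 'M[C]_(n2, k)),
  rdot (hankel n1 n2 (dev f x) *m X) (hankel n1 n2 (dev f x) *m X) <= dl ^+ 2 * rdot X X.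
Hypothesis dev_r : forall k (X : 'M[C]_(k, n1)),
  rdot (X *m hankel n1 n2 (dev f x)) (X *m hankel n1 n2 (dev f x)) <= dl ^+ 2 * rdot X X.

(* Optimality of [L0] gives [|L0 - G y|^2 <= 2 <N - G y, L0 - G y>] with
   [N = p^-1 G P_Omega y], and [L0 - G y] splits into a part with column space in
   [U] and a part with row space in [V0], each of rank at most [r]. *)
Lemma init_error : frob (L0 - G y) <= 4 * Num.sqrt r%:R * dl.
Proof.
have [[T [Trank Tbest] L0E] [UU0 VV0 _ L0svd]] := init.
have [UU VV _ yE] := y_svd.
set p : R := m%:R / n%:R in L0E; set N := p^-1%:C *: G (opP f y).
have p0 : 0 < p by rewrite divr_gt0 ?ltr0n.
have pK : (p^-1%:C * p%:C = 1 :> C) by rewrite -rmorphM mulVf ?rmorph1 // gt_eqF.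
pose E := N - G y; pose D := L0 - G y.
have EE : E = hankel n1 n2 (dev f x) by rewrite hankel_dev.
have opt : rdot (E - D) (E - D) <= rdot E E.
  have ED : E - D = p^-1%:C *: (G (opP f y) - T).
    by rewrite /E /D L0E scalerBr opprB addrA subrK.
  (* The competitor to [T] is [p G y], of rank at most [r]. *)
  have E' : E = p^-1%:C *: (G (opP f y) - p%:C *: G y).
    by rewrite scalerBr scalerA pK scale1r.
  rewrite ED E' !rdotZl !rdotZr !ler_pM2l ?invr_gt0 //.
  rewrite -!frob_sqr lerXn2r ?nnegrE ?frob_ge0 //; apply: Tbest.
  rewrite yE scalemxAr -mulmxA.
  by apply: leq_trans (mxrankM_maxl _ _) _; exact: rank_leq_col.
have DD : rdot D D <= 2 * rdot E D.
  move: opt; clearbody E D; rewrite rdotDl !rdotDr !rdotNl !rdotNr (rdotC D E).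
  by move: (rdot E E) (rdot E D) (rdot D D) => a b c; lra.
pose W := D - U *m (U^t* *m D).
have WV0 : W *m V0 *m V0^t* = W.
  have Gy0 : G y - U *m (U^t* *m G y) = 0.
    by rewrite yE !mulmxA -(mulmxA U _ U) UU mulmx1 subrr.
  have WL0 : W = L0 - U *m (U^t* *m L0).
    have -> : W = (L0 - U *m (U^t* *m L0)) - (G y - U *m (U^t* *m G y)).
      by rewrite /W /D !mulmxBr !opprD !opprK addrACA.
    by rewrite Gy0 subr0.
  have LVV : L0 *m (V0 *m V0^t*) = L0.
    by rewrite {1}L0svd mulmxA -(mulmxA _ (V0^t*) V0) VV0 mulmx1 -L0svd.
  by rewrite WL0 !mulmxBl -!mulmxA LVV.
have WE : W = D - U *m (U^t* *m D) by [].
rewrite -/D; clearbody W D E.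
have r0 : 0 <= Num.sqrt r%:R :> R by exact: sqrtr_ge0.
have rsq : Num.sqrt r%:R ^+ 2 = r%:R :> R by rewrite sqr_sqrtr.
have f1 : frob (U^t* *m E) <= Num.sqrt r%:R * dl.
  apply: frob_le; first by rewrite mulr_ge0.
  by rewrite exprMn rsq EE (le_trans (dev_r _)) // rdot_adj rdot_orthonormal // mulrC.
have f2 : frob (E *m V0) <= Num.sqrt r%:R * dl.
  apply: frob_le; first by rewrite mulr_ge0.
  by rewrite exprMn rsq EE (le_trans (dev_l _)) // rdot_orthonormal // mulrC.
have f3 : frob (U^t* *m D) <= frob D by rewrite !frobE ler_wsqrtr // rdot_coisoml.
have f4 : frob (W *m V0) <= frob D.
  rewrite !frobE ler_wsqrtr // (le_trans (rdot_coisomr _ VV0)) //.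
  by rewrite WE; exact: rdot_compl_le.
have ED : rdot E D <= 2 * (Num.sqrt r%:R * dl * frob D).
  have -> : rdot E D = rdot (U^t* *m E) (U^t* *m D) + rdot (E *m V0) (W *m V0).
    rewrite (rdot_adjr E V0) WV0 rdot_adjl trmxCK -rdotDr.
    by rewrite WE addrC subrK.
  have h1 : rdot (U^t* *m E) (U^t* *m D) <= Num.sqrt r%:R * dl * frob D.
    by apply: le_trans (rdot_CSw _ _) _; rewrite ler_pM ?frob_ge0.
  have h2 : rdot (E *m V0) (W *m V0) <= Num.sqrt r%:R * dl * frob D.
    by apply: le_trans (rdot_CSw _ _) _; rewrite ler_pM ?frob_ge0.
  by move: h1 h2; move: (rdot _ _) (rdot _ _) (_ * frob D) => a b e; lra.
have [D0|Dn] := eqVneq (frob D) 0; first by rewrite D0 !mulr_ge0.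
have Dgt : 0 < frob D by rewrite lt_def Dn frob_ge0.
rewrite -(ler_pM2r Dgt) -expr2 frob_sqr; apply: le_trans DD _.
by move: ED; move: (rdot E D) (frob D) (Num.sqrt _) => a b e; lra.
Qed.

End InitError.

End Initialization.

(** * The basin of attraction and one projected step *)

Section Deterministic.
Local Open Scope complex_scope.
Local Open Scope sesquilinear_scope.
Context {R : realType}.
Local Notation C := R[i].

Lemma close_arith (sr a b : R) : 0 < sr -> 2 * sr * b <= a ->
  4 / 5 * a <= 4 * (sr / 11) ^+ 2 -> b <= sr / 10.
Proof.
move=> sr0 ba; rewrite expr2 => h.
have h3 : (8 / 5 * b) * sr <= (4 / 121 * sr) * sr by lra.
by move: h3; rewrite (ler_pM2r sr0); lra.
Qed.

Lemma dist_ge0 m r (Z M : 'M[C]_(m, r)) : 0 <= dist Z M.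
Proof.
apply: lb_le_inf; last by move=> _ [Q _ <-]; exact: frob_ge0.
by exists (frob (Z - M *m 1%:M)), 1%:M => //=; apply/unitarymxP; rewrite mul1mx trmx1 map_mx1.
Qed.

Section Close.
Variables (n1 n2 r : nat) (A : 'M[C]_(n1, n2)).
Variables (U : 'M[C]_(n1, r)) (s : 'rV[R]_r) (V : 'M[C]_(n2, r)) (sr : R).
Hypotheses (A_svd : is_svd A U s V) (sr0 : 0 < sr) (sr_le : forall i, sr <= s 0 i).
Let M := balanced U s V.
Let D := realdiag (map_mx Num.sqrt s).

Lemma balanced_min k (X : 'M[C]_(r, k)) : 2 * sr * rdot X X <= rdot (M *m X) (M *m X).
Proof.
rewrite /M balancedE mul_col_mx rdot_col.
have h1 := balanced_minU A_svd X sr_le; rewrite -/D in h1.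
have -> : rdot (V *m D *m X) (V *m D *m X) = rdot (U *m D *m X) (U *m D *m X).
  by rewrite !rdot_adjl !(mulmxA _ _ X) (balanced_gramU A_svd) (balanced_gramV A_svd).
by move: h1; rewrite -/D; move: (rdot X X) (rdot _ _) => a b; lra.
Qed.

Lemma balanced_minQ k (Q : 'M[C]_r) (X : 'M[C]_(r, k)) : Q \is unitarymx ->
  2 * sr * rdot X X <= rdot (M *m Q *m X) (M *m Q *m X).
Proof.
by move=> Qu; rewrite -mulmxA -(rdot_isoml X X (unitary_adjK Qu)) balanced_min.
Qed.

(** [balanced_gap] loses a factor 4, [procrustes_gap] a factor [5/4], and the Gram matrix of [M] is
    at least [2 sr]. The squared factor error is thus at most [5 sr / 242]. *)
Lemma init_close (L0 : 'M[C]_(n1, n2)) U0 s0 V0 : is_svd L0 U0 s0 V0 ->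
  frob (L0 - A) <= sr / 11 ->
  exists2 Q : 'M[C]_r, Q \is unitarymx &
    rdot (balanced U0 s0 V0 - M *m Q) (balanced U0 s0 V0 - M *m Q) <= sr / 10.
Proof.
move=> L0svd e_le; set Z := balanced U0 s0 V0.
have gap : rdot (Z *m Z^t* - M *m M^t*) (Z *m Z^t* - M *m M^t*) <= 4 * (sr / 11) ^+ 2.
  apply: le_trans (_ : 4 * rdot (L0 - A) (L0 - A) <= _).
    have := balanced_gap (ZU := U0 *m realdiag (map_mx Num.sqrt s0))
      (ZV := V0 *m realdiag (map_mx Num.sqrt s0)) (MU := U *m D) (MV := V *m D).
    rewrite -!balancedE -/M -/Z (balanced_prod A_svd) (balanced_prod L0svd); apply.
      by rewrite (balanced_gramU L0svd) (balanced_gramV L0svd).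
    by rewrite (balanced_gramU A_svd) (balanced_gramV A_svd).
  by rewrite ler_pM2l // -frob_sqr lerXn2r // nnegrE ?frob_ge0 // divr_ge0 // ltW.
have MZ : M^t* *m Z \in unitmx.
  apply: (unitmx_gram_close (g := 2 * sr)); first by rewrite mulr_gt0.
    exact: balanced_min.
  apply: le_lt_trans gap _.
  have : 0 < sr ^+ 2 by rewrite exprn_gt0.
  by rewrite exprMn (exprMn 2); lra.
have [Q [T [Qu QT]]] := polar MZ; exists Q => //.
have QT' : (M *m Q)^t* *m Z = T^t* *m T by rewrite adjM -mulmxA.
have := procrustes_gap QT'.
rewrite (_ : M *m Q *m (M *m Q)^t* = M *m M^t*); last first.
  by rewrite adjM -!mulmxA (mulmxA Q) (unitary_Kadj Qu) mul1mx.
move=> /le_trans/(_ gap).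
have := balanced_minQ ((Z - M *m Q)^t*) Qu; rewrite rdot_adj.
exact: close_arith.
Qed.

End Close.

Section Step.
Variables (n n1 n2 r m : nat).
Hypotheses (n1_gt0 : (0 < n1)%N) (n2_gt0 : (0 < n2)%N) (n12 : (n1 + n2 = n.+1)%N).
Hypothesis (m_gt0 : (0 < m)%N).
Variables (f : 'I_m -> 'I_n) (y : 'cV[C]_n).
Variables (U : 'M[C]_(n1, r)) (s : 'rV[R]_r) (V : 'M[C]_(n2, r)) (sr s1 c B tau eta : R).
Hypotheses (y_svd : is_svd (opG n1 n2 y) U s V) (sr0 : 0 < sr) (s10 : 0 <= s1).
Hypotheses (sr_le : forall i, sr <= s 0 i) (s_le : forall i, s 0 i <= s1).
Hypotheses (Uc : row_bounded c U) (Vc : row_bounded c V) (cB : s1 * c <= B ^+ 2) (B0 : 0 <= B).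
Hypotheses (tau0 : 0 <= tau) (eta0 : 0 < eta).
Hypothesis ones_dev : forall X : 'cV[C]_n2,
  rdot (hankel n1 n2 (dev f (const_mx 1 : 'cV[C]_n)) *m X)
    (hankel n1 n2 (dev f (const_mx 1 : 'cV[C]_n)) *m X) <= (tau * n%:R) ^+ 2 * rdot X X.
Hypothesis rip : forall L : 'M[C]_(n1, n2),
  `|n%:R / m%:R * (\sum_k nrm2 (mxdot (tdelta U V (f k)) L))
    - \sum_(a < n) nrm2 (mxdot (tdelta U V a) L)| <= 1 / 10 * rdot L L.
Hypothesis tau_small : tau * (4 * (n%:R * B ^+ 2)) <= sr * (48 / 1000).
Hypothesis eta_small : eta * (25 * (n%:R * B ^+ 2) ^+ 2) <= sr * (6 / 100).
Let M := balanced U s V.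
Let D := realdiag (map_mx Num.sqrt s).

Lemma n1_le_n : (n1 <= n)%N.
Proof. by rewrite -ltnS -n12 -[X in (X < _)%N]addn0 ltn_add2l. Qed.

Lemma n2_le_n : (n2 <= n)%N.
Proof. by rewrite -ltnS -n12 -[X in (X < _)%N]add0n ltn_add2r. Qed.

(** The hypothesis asks for some nearby rotation only; it makes [M^* Z] invertible, so the optimal
    rotation exists as a polar factor and is at least as close. *)
Lemma pgd_step (Z : 'M[C]_(n1 + n2, r)) :
  row_bounded (B ^+ 2) Z ->
  (exists2 Q : 'M[C]_r, Q \is unitarymx & rdot (Z - M *m Q) (Z - M *m Q) <= sr / 10) ->
  let Z' := clip B (Z - eta%:C *: gradient y f (1 / 4) Z) in
  dist Z' M ^+ 2 <= (1 - eta * (1 / 10 * sr)) * dist Z M ^+ 2 /\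
  (exists2 Q : 'M[C]_r, Q \is unitarymx & rdot (Z' - M *m Q) (Z' - M *m Q) <= sr / 10).
Proof.
move=> Zb [Q0 Q0u Z0] Z'.
have MZ : M^t* *m Z \in unitmx.
  apply: (unitmx_close (g := 2 * sr) _ _ Q0u); first by rewrite mulr_gt0.
    by move=> k X; exact: (balanced_min y_svd sr_le).
  apply: le_lt_trans Z0 _; by move: sr0; lra.
have [Q [T [Qu QT]]] := polar MZ.
have dE := dist_polar Qu QT.
have ZQ : rdot (Z - M *m Q) (Z - M *m Q) <= sr / 10.
  apply: le_trans Z0; rewrite -frob_sqr -dE -[leRHS]frob_sqr.
  by rewrite lerXn2r ?nnegrE ?frob_ge0 ?dE ?frob_ge0 // -dE dist_le.
pose MU := U *m D *m Q; pose MV := V *m D *m Q.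
have ME : M *m Q = col_mx MU MV by rewrite /M balancedE mul_col_mx.
have [ZU [ZV ZE]] : exists (ZU : 'M[C]_(n1, r)) (ZV : 'M[C]_(n2, r)), Z = col_mx ZU ZV.
  by exists (usubmx Z), (dsubmx Z); rewrite vsubmxK.
have e1 : Z - M *m Q = col_mx (ZU - MU) (ZV - MV).
  by rewrite ME ZE opp_col_mx add_col_mx.
have row_u (W : 'M[C]_(n1, r)) (W' : 'M[C]_(n2, r)) b :
    row_bounded b (col_mx W W') -> row_bounded b W /\ row_bounded b W'.
  move=> Wb; split=> i; [have := Wb (lshift n2 i)|have := Wb (rshift n1 i)].
    by rewrite rowKu.
  by rewrite rowKd.
have [ZUb ZVb] : row_bounded (B ^+ 2) ZU /\ row_bounded (B ^+ 2) ZV.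
  by apply: row_u; rewrite -ZE.
have MQb k (W : 'M[C]_(k, r)) : row_bounded c W -> row_bounded (B ^+ 2) (W *m D *m Q).
  move=> Wc i; apply: le_trans cB; rewrite row_mul rdot_mul_unitary //.
  exact: (row_realdiag_le y_svd).
have MUb : row_bounded (B ^+ 2) MU by exact: MQb.
have MVb : row_bounded (B ^+ 2) MV by exact: MQb.
have Mb : row_bounded (B ^+ 2) (M *m Q).
  rewrite ME => i; case: (split_ordP i) => j ->.
    by rewrite rowKu.
  by rewrite rowKd.
have bal : MU^t* *m MU = MV^t* *m MV.
  have gramQ k (W : 'M[C]_(k, r)) : (W *m Q)^t* *m (W *m Q) = Q^t* *m (W^t* *m W) *m Q.
    by rewrite adjM !mulmxA.
  by rewrite /MU /MV !gramQ (balanced_gramU y_svd) (balanced_gramV y_svd).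
have MUmin k (X : 'M[C]_(r, k)) : sr * rdot X X <= rdot (MU *m X) (MU *m X).
  by rewrite -(rdot_isoml X X (unitary_adjK Qu)) /MU -mulmxA (balanced_minU y_svd).
have MZT : MU^t* *m ZU + MV^t* *m ZV = T^t* *m T.
  by rewrite -adj_col_mul -ME -ZE adjM -mulmxA.
(* Both cross products equal the Hermitian matrix [T^* T], whence [herm]. *)
have ZMT : ZU^t* *m MU + ZV^t* *m MV = T^t* *m T.
  by have := congr1 (fun X => X^t*) MZT; rewrite adjD !adjM !trmxCK.
have herm : (ZU - MU)^t* *m MU + (ZV - MV)^t* *m MV =
    MU^t* *m (ZU - MU) + MV^t* *m (ZV - MV).
  rewrite !adjD !adjN !mulmxDl !mulmxDr !mulNmx !mulmxN.
  by rewrite addrACA ZMT [RHS]addrACA MZT.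
have VDQ : MV^t* = Q^t* *m D *m V^t* by rewrite /MV !adjM adj_realdiag mulmxA.
have SL : 9 / 10 * rdot (MU *m (ZV - MV)^t* + (ZU - MU) *m MV^t*)
     (MU *m (ZV - MV)^t* + (ZU - MU) *m MV^t*) <=
   sform f (MU *m (ZV - MV)^t* + (ZU - MU) *m MV^t*)
     (MU *m (ZV - MV)^t* + (ZU - MU) *m MV^t*).
  have [UU VV _ _] := y_svd.
  (* Scaling and rotation are absorbed into the free factors of the tangent form. *)
  have -> : MU *m (ZV - MV)^t* + (ZU - MU) *m MV^t* =
      U *m (D *m Q *m (ZV - MV)^t*) + ((ZU - MU) *m (Q^t* *m D)) *m V^t*.
    by rewrite VDQ /MU !mulmxA.
  rewrite (_ : 9 / 10 = 1 - 1 / 10); last by field.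
  exact: (tangent_rip UU VV).
have b0 : 0 <= B ^+ 2 by exact: sqr_ge0.
have h_small : rdot (ZU - MU) (ZU - MU) + rdot (ZV - MV) (ZV - MV) <= sr / 10.
  by move: ZQ; rewrite e1 rdot_col.
pose Am := ZU *m ZV^t* - opG n1 n2 (opGadj n (ZU *m ZV^t*)) + (m%:R / n%:R)^-1%:C *:
  opG n1 n2 (opP f (opGadj n (ZU *m ZV^t*) - y)).
pose Em := ZU^t* *m ZU - ZV^t* *m ZV.
pose gU := Am *m ZV + (1 / 4)%:C *: (ZU *m Em).
pose gV := Am^t* *m ZU + (1 / 4)%:C *: (ZV *m (- Em)).
have gE : gradient y f (1 / 4) Z = col_mx gU gV.
  by rewrite ZE /gradient col_mxKu col_mxKd.
have MM : MU *m MV^t* = opG n1 n2 y.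
  rewrite VDQ /MU !mulmxA -(mulmxA _ Q) (unitary_Kadj Qu) mulmx1.
  by have := balanced_prod y_svd; rewrite adjM adj_realdiag mulmxA.
have res W : rdot Am W = sform f (ZU *m ZV^t* - MU *m MV^t*) W.
  by rewrite MM -(rdot_residual n1_gt0 n2_gt0 n12).
have gradE (WU : 'M[C]_(n1, r)) (WV : 'M[C]_(n2, r)) : rdot gU WU + rdot gV WV =
    sform f (ZU *m ZV^t* - MU *m MV^t*) (WU *m ZV^t* + ZU *m WV^t*)
    + 1 / 4 * (rdot (ZU *m Em) WU - rdot (ZV *m Em) WV).
  rewrite -res /gU /gV rdotDl (rdotDl WV) !rdotZl rdot_adjr (rdot_adjr (Am^t*) ZU).
  rewrite mulmxN rdotNl -(rdot_adj (Am^t*)) adjM !trmxCK rdotDr.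
  by move: (rdot Am _) (rdot Am _) (rdot _ WU) (rdot _ WV) => x1 x2 x3 x4; ring.
have := descent_step (sformC f) (sformD f) (sform_ge0 f) (sform_CS f) n1_le_n n2_le_n b0 sr0
  _ _ _ MUb MVb ZUb ZVb bal MUmin herm SL h_small tau_small gradE eta0 eta_small.
move=> /(_ _ _ _)step.
have {}step : rdot (Z - eta%:C *: gradient y f (1 / 4) Z - M *m Q)
    (Z - eta%:C *: gradient y f (1 / 4) Z - M *m Q)
    <= (1 - eta * (1 / 10 * sr)) * rdot (Z - M *m Q) (Z - M *m Q).
  rewrite addrAC e1 gE scale_col_mx opp_col_mx add_col_mx !rdot_col.
  apply: step.
  - by move=> A' B'; exact: sform_le_l.
  - by move=> A' B'; exact: sform_le_r.
  - move=> A' B' A'b B'b; rewrite (_ : 4 * (n%:R * B ^+ 2) = n%:R * (4 * B ^+ 2)); last by ring.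
    have b40 : 0 <= 4 * B ^+ 2 by rewrite mulr_ge0.
    exact: sform_le_prod.
have clipped := clip_le (Z - eta%:C *: gradient y f (1 / 4) Z) B0 Mb.
have {}step := le_trans clipped step; rewrite -/Z' in step.
have Qd : dist Z M ^+ 2 = rdot (Z - M *m Q) (Z - M *m Q) by rewrite dE frob_sqr.
(* [Q] is optimal for [Z] and merely admissible for [Z'], which suffices for an upper bound on the
   new distance. *)
split.
  rewrite Qd; apply: le_trans step.
  rewrite -frob_sqr lerXn2r ?nnegrE ?frob_ge0 ?dist_ge0 //.
  exact: dist_le.
have contr : (1 - eta * (1 / 10 * sr)) * rdot (Z - M *m Q) (Z - M *m Q) <=
    rdot (Z - M *m Q) (Z - M *m Q).
  move: (rdot_ge0 (Z - M *m Q)); move: (rdot _ _) => d d0.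
  apply: (ler_piMl d0); rewrite gerBl.
  exact: mulr_ge0 (ltW eta0) (mulr_ge0 (divr_ge0 ler01 (ler0n _ _)) (ltW sr0)).
by exists Q; [exact: Qu|exact: le_trans step (le_trans contr ZQ)].
Qed.

End Step.
End Deterministic.

(** * Constants and probabilities *)

Section Arith.
Local Open Scope complex_scope.
Local Open Scope sesquilinear_scope.
Context {R : realType}.

(** At [eps0 = 1/11] the ratio [(1 + eps0) / (1 - eps0)] equals [6/5]. The lower bound makes the
    ground truth feasible; the upper bound limits the rows of the iterates. *)
Lemma sig_bounds (s1 s0 eps0 : R) : 0 < s1 -> 0 < eps0 -> eps0 <= 11^-1 ->
  s0 <= s1 + eps0 * s1 -> s1 <= s0 + eps0 * s1 ->
  s1 <= s0 / (1 - eps0) /\ s0 / (1 - eps0) <= 6 / 5 * s1.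
Proof.
move=> s10 e0 e1 h1 h2.
have d0 : 0 < 1 - eps0 by lra.
rewrite ler_pdivlMr // ler_pdivrMr //.
have : eps0 * s1 <= 11^-1 * s1 by rewrite ler_wpM2r // ltW.
by split; lra.
Qed.

(** The constant is [4 * 6/5 / 100]. *)
Lemma tau_arith (sr s1 m0 sig : R) : 0 < sr -> 0 < s1 -> 0 < m0 -> sig <= 6 / 5 * s1 ->
  sr / (100 * (m0 * s1)) * (4 * (m0 * sig)) <= sr * (48 / 1000).
Proof.
move=> sr0 s10 m00 h; have ms0 : 0 < m0 * s1 by rewrite mulr_gt0.
rewrite mulrAC ler_pdivrMr ?mulr_gt0 //.
rewrite -mulrA ler_pM2l //.
have : m0 * sig <= m0 * (6 / 5 * s1) by rewrite ler_pM2l.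
by lra.
Qed.

Lemma step_bound (sr s1 m0 eta : R) : 0 < s1 -> 0 < m0 ->
  eta <= sr / (600 * m0 ^+ 2 * s1 ^+ 2) -> 600 * (eta * (m0 * s1) ^+ 2) <= sr.
Proof.
move=> s10 m00; have k0 : (0 : R) < 600 by rewrite ltr0n.
move: (600 : R) k0 => K k0.
have d0 : 0 < K * m0 ^+ 2 * s1 ^+ 2 by rewrite mulr_gt0 ?exprn_gt0 // mulr_gt0 ?exprn_gt0.
by rewrite (ler_pdivlMr _ _ d0) exprMn -mulrA [in X in X -> _]mulrCA.
Qed.

(** The constant is [25 * (6/5)^2 / 600]. *)
Lemma eta_arith (sr s1 m0 sig eta : R) : 0 < sr -> 0 < s1 -> 0 < m0 -> 0 < eta ->
  0 <= sig -> sig <= 6 / 5 * s1 -> eta <= sr / (600 * m0 ^+ 2 * s1 ^+ 2) ->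
  eta * (25 * (m0 * sig) ^+ 2) <= sr * (6 / 100).
Proof.
move=> sr0 s10 m00 eta0 sig0 sig_le /(step_bound s10 m00) h.
have h1 : (m0 * sig) ^+ 2 <= 36 / 25 * (m0 * s1) ^+ 2.
  have -> : 36 / 25 * (m0 * s1) ^+ 2 = (m0 * (6 / 5 * s1)) ^+ 2 by field.
  by rewrite lerXn2r ?nnegrE ?mulr_ge0 ?ler_pM2l // ltW.
have := h1; rewrite -(ler_pM2l eta0) (mulrCA eta (36 / 25)) (mulrCA eta 25).
by move: h; move: (eta * (m0 * s1) ^+ 2) (eta * (m0 * sig) ^+ 2) => a b; lra.
Qed.

(** Nonnegativity of the rate lets the induction on iterates multiply its hypothesis by it. *)
Lemma contraction_ge0 (sr s1 m0 eta : R) : 0 < sr -> sr <= s1 -> 1 <= m0 ->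
  0 < eta -> eta <= sr / (600 * m0 ^+ 2 * s1 ^+ 2) -> 0 <= 1 - eta * (1 / 10 * sr).
Proof.
move=> sr0 s1r m01 eta0; have s10 : 0 < s1 by exact: lt_le_trans sr0 s1r.
have m00 : 0 < m0 by exact: lt_le_trans ltr01 m01.
move=> /(step_bound s10 m00) h.
have sr_le : sr <= m0 * s1 by rewrite (le_trans s1r) // ler_peMl // ltW.
have h1 : eta * sr ^+ 2 <= eta * (m0 * s1) ^+ 2.
  by rewrite ler_pM2l // lerXn2r ?nnegrE ?(ltW sr0) // (le_trans (ltW sr0)).
have h2 : (eta * sr) * sr <= 600^-1 * sr.
  move: h1 h; rewrite (expr2 sr) mulrA; move: (eta * (m0 * s1) ^+ 2) (eta * sr * sr) => a b; lra.
by move: h2; rewrite (ler_pM2r sr0) mulrCA; move: (eta * sr) => a; lra.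
Qed.

(** The third power survives a union over [n] frequencies as [n^-2]. *)
Lemma expR_ln_le (n : nat) (E : R) : (0 < n)%N -> 3 * ln n%:R <= E ->
  expR (- E) <= n%:R ^- 3.
Proof.
move=> n0 h; have n0' : (n%:R : R) \is Num.pos by rewrite posrE ltr0n.
rewrite -[X in X ^- 3](lnK n0') -expRM_natl -expRN ler_expR lerN2.
by rewrite mulr_natl -mulr_natl.
Qed.

End Arith.

Section Exponents.
Local Open Scope complex_scope.
Local Open Scope sesquilinear_scope.
Context {R : realType}.
Variables (nn mr sr s1 m0 eps L : R).
Hypotheses (nn0 : 0 < nn) (mr0 : 0 <= mr) (sr0 : 0 < sr) (s1r : sr <= s1) (m01 : 1 <= m0).
Hypotheses (eps0 : 0 < eps) (eps1 : eps <= 11^-1) (L0 : 0 <= L).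
Hypothesis samples : 400 * 300 * (m0 * s1) ^+ 2 * L <= mr * (eps * sr) ^+ 2.

Let s10 : 0 < s1. Proof. exact: lt_le_trans sr0 s1r. Qed.
Let m00 : 0 < m0. Proof. exact: lt_le_trans ltr01 m01. Qed.
Let eps_le1 : eps <= 1. Proof. by move: eps1; lra. Qed.

Lemma samples_gt0 : 0 < L -> 0 < mr.
Proof.
move=> Lgt; have : 0 < mr * (eps * sr) ^+ 2.
  apply: lt_le_trans samples; have k0 : (0 : R) < 400 * 300 by rewrite mulr_gt0 ?ltr0n.
  by apply: mulr_gt0 Lgt; apply: mulr_gt0 k0 _; rewrite exprn_gt0 // mulr_gt0.
by rewrite pmulr_lgt0 // exprn_gt0 // mulr_gt0.
Qed.

(** The factor [r] in [dl^2] meets the factor [m0] of the energy, and [r <= m0] bounds their product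
    by [m0^2]. The constant needed here is only [384]. *)
Lemma signal_exponent (rr : R) : 0 < rr -> rr <= m0 ->
  3 * L <= (eps * sr / (4 * Num.sqrt rr)) ^+ 2 * mr / (4 * nn * (2 * s1 ^+ 2 * (m0 / nn))).
Proof.
move=> rr0 rrm; rewrite [X in X * mr]expr_div_n exprMn (exprMn _ 4) (sqr_sqrtr (ltW rr0)).
have -> : 4 * nn * (2 * s1 ^+ 2 * (m0 / nn)) = 8 * (s1 ^+ 2 * m0).
  by field; rewrite gt_eqF.
have d1 : 0 < 8 * (s1 ^+ 2 * m0) by rewrite mulr_gt0 ?mulr_gt0 ?exprn_gt0.
have d2 : 0 < 4 ^+ 2 * rr by rewrite mulr_gt0 ?exprn_gt0.
rewrite (ler_pdivlMr _ _ d1) [leRHS]mulrAC (ler_pdivlMr _ _ d2).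
rewrite -(exprMn _ eps) (mulrC _ mr); apply: le_trans samples.
have h : s1 ^+ 2 * m0 * rr * L <= (m0 * s1) ^+ 2 * L.
  rewrite ler_wpM2r // exprMn [leRHS]mulrC (expr2 m0) mulrA ler_pM2l //.
  by rewrite mulr_gt0 ?exprn_gt0.
have h0 : 0 <= (m0 * s1) ^+ 2 * L by rewrite mulr_ge0 ?sqr_ge0.
rewrite (_ : 3 * L * (8 * (s1 ^+ 2 * m0)) * (4 ^+ 2 * rr) = 384 * (s1 ^+ 2 * m0 * rr * L)).
  rewrite -(mulrA (400 * 300)).
  by move: h h0; move: (_ * L) (_ * L) => a b; lra.
by ring.
Qed.

(** The binding requirement: [3 * 4 * 100^2] is exactly [400 * 300]. *)
Lemma ones_exponent :
  3 * L <= (sr / (100 * (m0 * s1)) * nn) ^+ 2 * mr / (4 * nn * nn).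
Proof.
have d : 0 < m0 * s1 by rewrite mulr_gt0.
move: samples; rewrite (exprMn _ eps) => H.
have e2 : mr * (eps ^+ 2 * sr ^+ 2) <= mr * sr ^+ 2.
  by rewrite ler_wpM2l // ler_piMl ?sqr_ge0 // exprn_ile1 // ltW.
have {H e2} : 400 * 300 * (m0 * s1) ^+ 2 * L <= mr * sr ^+ 2.
  exact: le_trans H e2.
move=> samples'; rewrite (exprMn _ _ nn) expr_div_n (exprMn _ 100).
have -> : sr ^+ 2 / (100 ^+ 2 * (m0 * s1) ^+ 2) * nn ^+ 2 * mr / (4 * nn * nn) =
    mr * sr ^+ 2 / (400 * 100 * (m0 * s1) ^+ 2).
  by field; rewrite !gt_eqF.
have d2 : 0 < (m0 * s1) ^+ 2 by rewrite exprn_gt0.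
have k0 : (0 : R) < 400 * 100 by rewrite mulr_gt0 ?ltr0n.
have d3 : 0 < 400 * 100 * (m0 * s1) ^+ 2 by rewrite mulr_gt0.
rewrite (ler_pdivlMr _ _ d3).
have -> : 3 * L * (400 * 100 * (m0 * s1) ^+ 2) = 400 * 300 * (m0 * s1) ^+ 2 * L by ring.
exact: samples'.
Qed.

Lemma tangent_exponent : 3 * L <= (1 / 10) ^+ 2 * mr / (4 * (2 * m0) ^+ 2).
Proof.
have H : 400 * 300 * m0 ^+ 2 * L <= mr.
  have d : 0 < s1 ^+ 2 by rewrite exprn_gt0.
  rewrite -(ler_pM2r d); move: samples; rewrite exprMn (mulrAC _ L).
  rewrite (mulrA (400 * 300)) => /le_trans; apply.
  rewrite ler_wpM2l // lerXn2r ?nnegrE ?(ltW s10) //; first by rewrite mulr_ge0 ?ltW.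
  by rewrite (le_trans _ s1r) // ler_piMl // ltW.
have d : 0 < 4 * (2 * m0) ^+ 2 by rewrite mulr_gt0 ?exprn_gt0 ?mulr_gt0.
rewrite (ler_pdivlMr _ _ d).
have h0 : 0 <= m0 ^+ 2 * L by rewrite mulr_ge0 ?sqr_ge0.
rewrite (_ : 3 * L * (4 * (2 * m0) ^+ 2) = 48 * (m0 ^+ 2 * L)); last by ring.
move: H h0; rewrite -(mulrA (400 * 300)); move: (m0 ^+ 2 * L) => a; lra.
Qed.

Lemma signal_dev_small (rr : R) : 1 <= rr ->
  eps * sr / (4 * Num.sqrt rr) * (s1 * (m0 / nn)) <= 2 * s1 ^+ 2 * (m0 / nn) / 3.
Proof.
move=> rr1.
have -> : 2 * s1 ^+ 2 * (m0 / nn) / 3 = 2 / 3 * s1 * (s1 * (m0 / nn)) by ring.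
have d0 : 0 < s1 * (m0 / nn) by rewrite mulr_gt0 // divr_gt0.
rewrite (ler_pM2r d0).
have q1 : 1 <= Num.sqrt rr by rewrite -sqrtr1 ler_wsqrtr.
have d : 0 < 4 * Num.sqrt rr by rewrite mulr_gt0 // (lt_le_trans ltr01).
rewrite (ler_pdivrMr _ _ d).
have h1 : eps * sr <= s1 by apply: le_trans s1r; rewrite ler_piMl // ltW.
have h2 : s1 <= s1 * Num.sqrt rr by rewrite ler_peMr // ltW.
have -> : 2 / 3 * s1 * (4 * Num.sqrt rr) = 8 / 3 * (s1 * Num.sqrt rr) by ring.
by move: h1 h2 s10; move: (eps * sr) (s1 * Num.sqrt rr) => a b; lra.
Qed.

Lemma ones_dev_small : sr / (100 * (m0 * s1)) * nn * 1 <= nn / 3.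
Proof.
rewrite mulr1 mulrC ler_pM2l //.
have d : 0 < m0 * s1 by rewrite mulr_gt0.
have d3 : 0 < 100 * (m0 * s1) by rewrite mulr_gt0.
rewrite (ler_pdivrMr _ _ d3).
have : sr <= m0 * s1 by rewrite (le_trans s1r) // ler_peMl // ltW.
by move: d; move: (m0 * s1) => a; lra.
Qed.

End Exponents.

(** * Convergence on good samples and the count of bad ones *)

Section Recovery.
Local Open Scope complex_scope.
Local Open Scope sesquilinear_scope.
Context {R : realType}.
Local Notation C := R[i].

Lemma frob_distC m n (A B : 'M[C]_(m, n)) : frob (A - B) = frob (B - A).
Proof. by rewrite !frobE -opprB rdotNl rdotNr opprK. Qed.

Section Deterministic.
Variables (n n1 n2 r m : nat).
Hypotheses (n_gt0 : (0 < n)%N) (n1_gt0 : (0 < n1)%N) (n2_gt0 : (0 < n2)%N).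
Hypotheses (n12 : (n1 + n2 = n.+1)%N) (m_gt0 : (0 < m)%N).
Variables (f : 'I_m -> 'I_n) (x : 'cV[C]_n) (w : C).
Variables (U : 'M[C]_(n1, r)) (s : 'rV[R]_r) (V : 'M[C]_(n2, r)).
Variables (i0 : 'I_r) (sr mu eps eta : R).
Let y := opD n1 n2 x.
Let s1 := s 0 i0.
Let m0 := mu * c_s n n1 n2 * r%:R.
Let c := m0 / n%:R.
Let dl := eps * sr / (4 * Num.sqrt r%:R).
Let tau := sr / (100 * (m0 * s1)).
Let M := balanced U s V.
Hypotheses (y_svd : is_svd (opG n1 n2 y) U s V) (sr0 : 0 < sr).
Hypotheses (i00 : i0 = 0%N :> nat) (sr_le : forall i, sr <= s 0 i).
Hypotheses (Uc : row_bounded c U) (Vc : row_bounded c V) (m01 : 1 <= m0).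
Hypotheses (eps0 : 0 < eps) (eps1 : eps <= 11^-1).
Hypotheses (eta0 : 0 < eta) (eta_le : eta <= sr / (600 * m0 ^+ 2 * s1 ^+ 2)).
Hypothesis w_prim : n.-primitive_root w.
Hypothesis dev_x : forall l : 'I_n, nrm2 (dft w (dev f x) l) <= dl ^+ 2.
Hypothesis dev_1 : forall l : 'I_n,
  nrm2 (dft w (dev f (const_mx 1 : 'cV[C]_n)) l) <= (tau * n%:R) ^+ 2.
Hypothesis rip : forall L : 'M[C]_(n1, n2),
  `|n%:R / m%:R * (\sum_k nrm2 (mxdot (tdelta U V (f k)) L))
    - \sum_(a < n) nrm2 (mxdot (tdelta U V a) L)| <= 1 / 10 * rdot L L.

Let s10 : 0 < s1. Proof. exact: lt_le_trans sr0 (sr_le i0). Qed.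
Let s_le i : s 0 i <= s1.
Proof. by have [_ _ [_ s_sorted] _] := y_svd; rewrite s_sorted ?i00. Qed.
Let m00 : 0 < m0. Proof. exact: lt_le_trans ltr01 m01. Qed.

(** [dl] is chosen to cancel the factor [4 sqrt r] of [init_error]. *)
Lemma init_frob_le L0 U0 (s0 : 'rV[R]_r) V0 : pgd_init y f L0 U0 s0 V0 ->
  frob (L0 - opG n1 n2 y) <= eps * sr.
Proof.
move=> init; have q0 : 0 < Num.sqrt r%:R :> R.
  by rewrite sqrtr_gt0 ltr0n (leq_ltn_trans (leq0n i0)).
have dl0 : 0 <= dl by rewrite divr_ge0 ?mulr_ge0 // ltW.
have := init_error n1_gt0 n2_gt0 n12 y_svd init n_gt0 m_gt0 dl0
  (hankel_opnorm n_gt0 w_prim n12 n1_gt0 n2_gt0 dev_x)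
  (hankel_opnormr n_gt0 w_prim n12 n1_gt0 n2_gt0 dev_x).
by rewrite /dl mulrCA mulfV ?mulr1 // mulf_neq0 ?gt_eqF.
Qed.

Lemma pgd_linear_convergence L0 U0 (s0 : 'rV[R]_r) V0 : pgd_init y f L0 U0 s0 V0 ->
  let sig := s0 0 i0 / (1 - eps) in
  let Z := pgd_iter y f (1 / 4) mu sig eta (balanced U0 s0 V0) in
  forall k : nat,
    dist (Z k) M ^+ 2 <= (1 - eta * (1 / 10 * sr)) ^+ k * dist (Z 0%N) M ^+ 2.
Proof.
move=> init sig Z; have [_ L0svd] := init.
have e_le := init_frob_le init.
have es1 : eps * sr <= eps * s1 by rewrite (ler_pM2l eps0) sr_le.
have s0_max i : s0 0 i <= s0 0 i0.
  by have [_ _ [_ s0_sorted] _] := L0svd; rewrite s0_sorted ?i00.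
(* Only the computable [sigma_1 (L0)] enters [sig]; Weyl's inequality in both directions compares it
   with [s1]. *)
have [sig_ge sig_le] : s1 <= sig /\ sig <= 6 / 5 * s1.
  apply: sig_bounds => //.
    apply: le_trans (svd_head_le L0svd y_svd s_le) _.
    by rewrite lerD2l (le_trans e_le).
  apply: le_trans (svd_head_le y_svd L0svd s0_max) _.
  by rewrite lerD2l frob_distC (le_trans e_le).
have sig0 : 0 <= sig by exact: le_trans (ltW s10) sig_ge.
pose B := feasible_bound n n1 n2 r mu sig.
have n0 : 0 < n%:R :> R by rewrite ltr0n.
have B0 : 0 <= B by exact: sqrtr_ge0.
have B2 : B ^+ 2 = m0 * sig / n%:R.
  by apply: sqr_sqrtr; exact: divr_ge0 (mulr_ge0 (ltW m00) sig0) (ltW n0).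
have nB : n%:R * B ^+ 2 = m0 * sig by rewrite B2 mulrC divfK // gt_eqF.
have cB : s1 * c <= B ^+ 2.
  by rewrite B2 /c mulrA (mulrC s1) ler_pM2r ?invr_gt0 // (ler_pM2l m00).
have tau0 : 0 <= tau by exact: divr_ge0 (ltW sr0) (mulr_ge0 (ler0n _ _) (ltW (mulr_gt0 m00 s10))).
have tau_small : tau * (4 * (n%:R * B ^+ 2)) <= sr * (48 / 1000).
  by rewrite nB; exact: tau_arith.
have eta_small : eta * (25 * (n%:R * B ^+ 2) ^+ 2) <= sr * (6 / 100).
  by rewrite nB; exact: (eta_arith (s1 := s1)).
have step := pgd_step n1_gt0 n2_gt0 n12 m_gt0 y_svd sr0 (ltW s10) sr_le s_le Uc Vc cB B0
  tau0 eta0 (fun X => hankel_opnorm n_gt0 w_prim n12 n1_gt0 n2_gt0 dev_1 X) rip tau_small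
  eta_small.
have rate0 := contraction_ge0 sr0 (sr_le i0) m01 eta0 eta_le.
have ZS k : Z k.+1 = clip B (Z k - eta%:C *: gradient y f (1 / 4) (Z k)) by [].
have Zb k : row_bounded (B ^+ 2) (Z k).
  by case: k => [|k]; [|rewrite ZS]; exact: clip_row_bounded.
have Z0c : exists2 Q : 'M[C]_r, Q \is unitarymx & rdot (Z 0%N - M *m Q) (Z 0%N - M *m Q) <= sr / 10.
  have [|Q Qu Qle] := init_close y_svd sr0 sr_le L0svd.
    by apply: le_trans e_le _; rewrite mulrC ler_pM2l.
  (* Clipping the initial point does not move it away from [M Q], whose rows satisfy the bound by
     [cB]. *)
  exists Q; [exact: Qu|apply: le_trans Qle; apply: (clip_le _ B0) => i].
  apply: le_trans cB; rewrite row_mul rdot_mul_unitary //.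
  rewrite /M balancedE; case: (split_ordP i) => j ->; rewrite ?rowKu ?rowKd.
    exact: (row_realdiag_le y_svd (ltW s10) Uc s_le).
  exact: (row_realdiag_le y_svd (ltW s10) Vc s_le).
(* The second conjunct is the hypothesis of [pgd_step] at the next iterate. *)
suff inv k : dist (Z k) M ^+ 2 <= (1 - eta * (1 / 10 * sr)) ^+ k * dist (Z 0%N) M ^+ 2 /\
    exists2 Q : 'M[C]_r, Q \is unitarymx & rdot (Z k - M *m Q) (Z k - M *m Q) <= sr / 10.
  by move=> k; have [] := inv k.
elim: k => [|k [IHd IHc]]; first by rewrite expr0 mul1r.
have [d_le close] := step _ (Zb k) IHc.
rewrite ZS; split=> //; apply: le_trans d_le _.
by rewrite (exprS _ k) -[leRHS]mulrA (ler_wpM2l rate0).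
Qed.

End Deterministic.
Lemma card_bigcup_le (I T : finType) (F : I -> {set T}) (b : R) :
  (forall i, #|F i|%:R <= b) -> #|(\bigcup_i F i)%SET|%:R <= #|I|%:R * b.
Proof.
move=> Fb; apply: le_trans (_ : (\sum_i #|F i|)%N%:R <= _).
  rewrite ler_nat; elim/big_rec2: _ => [|i k A _ kA]; first by rewrite cards0.
  by apply: leq_trans (_ : #|F i| + #|A| <= _)%N; rewrite ?leq_card_setU // leq_add2l.
rewrite natr_sum; apply: le_trans (_ : \sum_(i : I) b <= _); first exact: ler_sum.
by rewrite sumr_const mulr_natl.
Qed.

Lemma dft_dev_union (m n : nat) (w : C) (x : 'cV[C]_n) (X W dl : R) :
  (0 < n)%N -> (0 < m)%N -> n.-primitive_root w ->
  (forall a : 'I_n, nrm2 (x a 0) <= X ^+ 2) -> \sum_(a < n) nrm2 (x a 0) <= W ->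
  0 <= X -> 0 < W -> 0 <= dl -> dl * X <= W / 3 ->
  3 * ln n%:R <= dl ^+ 2 * m%:R / (4 * n%:R * W) ->
  exists2 B : {set {ffun 'I_m -> 'I_n}},
    (#|B|%:R : R) <= 2 * n%:R ^- 2 * n%:R ^+ m &
    forall f : {ffun 'I_m -> 'I_n}, f \notin B ->
      forall l : 'I_n, nrm2 (dft w (dev f x) l) <= dl ^+ 2.
Proof.
move=> n_gt0 m_gt0 w_prim xX xW X0 W0 dl0 dlX expo.
pose F (l : 'I_n) := [set f : {ffun 'I_m -> 'I_n} | dl ^+ 2 <= nrm2 (dft w (dev f x) l)]%SET.
exists (\bigcup_l F l)%SET.
  have n0 : n%:R != 0 :> R by rewrite pnatr_eq0 -lt0n.
  have Fb l : (#|F l|%:R : R) <= 2 * n%:R ^- 3 * n%:R ^+ m.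
    apply: le_trans (dft_dev_count l n_gt0 m_gt0 w_prim xX xW X0 W0 dl0 dlX) _.
    by rewrite ler_wpM2r ?exprn_ge0 // ler_pM2l // expR_ln_le.
  apply: le_trans (card_bigcup_le Fb) _; rewrite card_ord mulrA ler_wpM2r ?exprn_ge0 //.
  by rewrite mulrCA [n%:R ^+ 3]exprS invfM mulVKf.
move=> f fB l; rewrite leNgt; apply: contra fB => h.
by apply/finset.bigcupP; exists l => //; rewrite inE ltW.
Qed.

Section Sampling.
Variables (n n1 n2 r m : nat).
Hypotheses (n_gt0 : (0 < n)%N) (n1_gt0 : (0 < n1)%N) (n2_gt0 : (0 < n2)%N).
Hypotheses (n12 : (n1 + n2 = n.+1)%N) (m_gt0 : (0 < m)%N).
Variables (x : 'cV[C]_n) (w : C).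
Variables (U : 'M[C]_(n1, r)) (s : 'rV[R]_r) (V : 'M[C]_(n2, r)).
Variables (sr s1 m0 eps : R).
Let c := m0 / n%:R.
Let dl := eps * sr / (4 * Num.sqrt r%:R).
Let tau := sr / (100 * (m0 * s1)).
Hypotheses (x_svd : is_svd (hankel n1 n2 x) U s V) (sr0 : 0 < sr).
Hypotheses (s1r : sr <= s1) (s_le : forall i, s 0 i <= s1).
Hypotheses (Uc : row_bounded c U) (Vc : row_bounded c V) (m01 : 1 <= m0).
Hypotheses (r_gt0 : (0 < r)%N) (rm : r%:R <= m0).
Hypotheses (eps0 : 0 < eps) (eps1 : eps <= 11^-1).
Hypothesis w_prim : n.-primitive_root w.
Hypothesis samples : 400 * 300 * (m0 * s1) ^+ 2 * ln n%:R <= m%:R * (eps * sr) ^+ 2.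

(** The three families are the Fourier deviations of [x], those of the all-ones signal, and the
    quadratic form on the tangent space, each of proportion at most [2 n^-2]. *)
Lemma bad_samples_count : exists2 B : {set {ffun 'I_m -> 'I_n}},
  (#|B|%:R : R) <= 6 * n%:R ^- 2 * n%:R ^+ m &
  forall f : {ffun 'I_m -> 'I_n}, f \notin B ->
  [/\ forall l : 'I_n, nrm2 (dft w (dev f x) l) <= dl ^+ 2,
      forall l : 'I_n, nrm2 (dft w (dev f (const_mx 1 : 'cV[C]_n)) l) <= (tau * n%:R) ^+ 2 &
      forall L : 'M[C]_(n1, n2),
        `|n%:R / m%:R * (\sum_k nrm2 (mxdot (tdelta U V (f k)) L))
          - \sum_(a < n) nrm2 (mxdot (tdelta U V a) L)| <= 1 / 10 * rdot L L].
Proof.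
have s10 : 0 < s1 := lt_le_trans sr0 s1r.
have m00 : 0 < m0 := lt_le_trans ltr01 m01.
have n0 : 0 < n%:R :> R by rewrite ltr0n.
have c0 : 0 < c by rewrite divr_gt0.
have L0 : 0 <= ln n%:R :> R by rewrite ln_ge0 // ler1n.
have rr0 : 0 < r%:R :> R by rewrite ltr0n.
have rr1 : 1 <= r%:R :> R by rewrite ler1n.
have mr0 : 0 <= m%:R :> R by [].
have [UU VV _ _] := x_svd.
have dl0 : 0 <= dl.
  exact: divr_ge0 (mulr_ge0 (ltW eps0) (ltW sr0)) (mulr_ge0 (ler0n _ _) (sqrtr_ge0 _)).
have tau0 : 0 <= tau.
  exact: divr_ge0 (ltW sr0) (mulr_ge0 (ler0n _ _) (ltW (mulr_gt0 m00 s10))).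
have W0 : 0 < 2 * s1 ^+ 2 * c by rewrite mulr_gt0 // mulr_gt0 ?exprn_gt0.
have [B1 B1_le B1P] := dft_dev_union n_gt0 m_gt0 w_prim
  (signal_entry_le n1_gt0 n2_gt0 n12 x_svd s_le (ltW s10) Uc Vc)
  (signal_energy_le n1_gt0 n2_gt0 n12 x_svd s_le (ltW s10) Uc Vc)
  (mulr_ge0 (ltW s10) (ltW c0)) W0 dl0
  (signal_dev_small n0 sr0 s1r m01 eps1 rr1)
  (signal_exponent n0 sr0 s1r m01 L0 samples rr0 rm).
have nrm1 (a : 'I_n) : nrm2 ((const_mx 1 : 'cV[C]_n) a 0) = 1.
  by rewrite mxE -(rmorph1 (real_complex R)) nrm2_real expr1n.
have [B2 B2_le B2P] : exists2 B : {set {ffun 'I_m -> 'I_n}},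
    (#|B|%:R : R) <= 2 * n%:R ^- 2 * n%:R ^+ m &
    forall f : {ffun 'I_m -> 'I_n}, f \notin B -> forall l : 'I_n,
      nrm2 (dft w (dev f (const_mx 1 : 'cV[C]_n)) l) <= (tau * n%:R) ^+ 2.
  apply: (dft_dev_union (X := 1) (W := n%:R)) => //.
  - by move=> a; rewrite nrm1 expr1n.
  - by rewrite (eq_bigr _ (fun a _ => nrm1 a)) sumr_const card_ord.
  - by rewrite mulr_ge0.
  - exact: ones_dev_small.
  - exact: (ones_exponent n0 mr0 sr0 s1r m01 eps0 eps1 samples).
(* [2 * m0] bounds [n |tdelta a|^2], by [rdot_tdelta] with [c = m0 / n]. *)
have [||||B3 B3_le B3P] := @quadratic_form_count R m n n1 n2 (@tdelta _ _ _ _ U V n) (2 * m0) (1 / 10) n_gt0 m_gt0.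
- move=> a; have := rdot_tdelta UU VV n1_gt0 n2_gt0 n12 Uc Vc a.
  rewrite -(ler_pM2l n0) (_ : n%:R * (2 * c) = 2 * m0) //.
  by rewrite mulrCA /c (mulrCA n%:R m0) divff ?mulr1 // gt_eqF.
- by rewrite mulr_gt0.
- by [].
- by move: m01; lra.
exists (B1 :|: B2 :|: B3)%SET; last first.
  by move=> f; rewrite !inE !negb_or => /andP[/andP[/B1P h1 /B2P h2] /B3P h3].
have {}B3_le : (#|B3|%:R : R) <= 2 * n%:R ^- 2 * n%:R ^+ m.
  apply: le_trans B3_le _; rewrite ler_wpM2r ?exprn_ge0 // ler_pM2l //.
  apply: le_trans (expR_ln_le n_gt0 (tangent_exponent mr0 sr0 s1r m01 eps0 eps1 L0 samples)) _.
  by rewrite lef_pV2 ?posrE ?exprn_gt0 // ler_weXn2l // ler1n.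
apply: le_trans (_ : (#|B1| + #|B2| + #|B3|)%N%:R <= _).
  rewrite ler_nat; apply: leq_trans (leq_card_setU _ _) _.
  by rewrite leq_add2r leq_card_setU.
rewrite !natrD -!(mulrA _ (n%:R ^- 2)).
move: B1_le B2_le B3_le; rewrite -!(mulrA _ (n%:R ^- 2)).
by move: (n%:R ^- 2 * _) => z; lra.
Qed.

End Sampling.
End Recovery.

(** * Hypotheses brought to normalized form *)

Section Final.
Local Open Scope complex_scope.
Local Open Scope sesquilinear_scope.
Context {R : realType}.
Local Notation C := R[i].

Lemma norm2inf_row_bounded m n (A : 'M[C]_(m, n)) (b b' : R) :
  0 <= b -> b <= b' -> norm2inf A <= Num.sqrt b -> row_bounded b' A.
Proof.
move=> b0 bb' Ab i; apply: le_trans bb'; rewrite -frob_sqr -(sqr_sqrtr b0).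
rewrite lerXn2r ?nnegrE ?frob_ge0 ?sqrtr_ge0 //; apply: le_trans Ab.
exact: (le_bigmax _ (rownorm A)).
Qed.

(** Summing squared rows gives [r = |U|^2 <= m m0 / n]. Incoherence thus forces [m0 >= r >= 1]. *)
Lemma orthonormal_row_bounded m n r (U : 'M[C]_(m, r)) (m0 : R) :
  (0 < n)%N -> (m <= n)%N -> 0 <= m0 -> U^t* *m U = 1%:M ->
  row_bounded (m0 / n%:R) U -> r%:R <= m0.
Proof.
move=> n0 mn m00 UU Ub; rewrite -(rdot_orthonormal UU) rdot_rows.
have c0 : 0 <= m0 / n%:R by rewrite divr_ge0.
apply: le_trans (ler_sum _ (fun i _ => Ub i)) _; rewrite sumr_const card_ord -[leLHS]mulr_natl.
apply: le_trans (_ : n%:R * (m0 / n%:R) <= _).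
  by rewrite ler_wpM2r // ler_nat.
by rewrite mulrCA divff ?mulr1 // pnatr_eq0 -lt0n.
Qed.

Lemma samples_rescale (K mu cs rr s1 sr eps L mr : R) : 0 < sr -> 0 < eps ->
  K * eps ^- 2 * mu ^+ 2 * cs ^+ 2 * (s1 / sr) ^+ 2 * rr ^+ 2 * L <= mr ->
  K * (mu * cs * rr * s1) ^+ 2 * L <= mr * (eps * sr) ^+ 2.
Proof.
move=> sr0 e0; have d : 0 < (eps * sr) ^+ 2 by rewrite exprn_gt0 // mulr_gt0.
rewrite -(ler_pM2r d); apply: le_trans; rewrite le_eqVlt; apply/orP; left; apply/eqP.
by field; rewrite !gt_eqF.
Qed.

End Final.

Theorem theorem2p1 (R : realType) :
  exists c1 c2 : R, 0 < c1 /\ 0 < c2 /\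
  forall (n n1 n2 r : nat),
    (0 < n1)%N -> (0 < n2)%N -> (n1 + n2 = n.+1)%N -> (0 < r)%N ->
  forall x : 'cV[R[i]]_n,
    spectrally_sparse r x ->
    \rank (hankel n1 n2 x) = r ->
  let y := opD n1 n2 x in
  let Gy := opG n1 n2 y in
  forall (U : 'M[R[i]]_(n1, r)) (s : 'rV[R]_r) (V : 'M[R[i]]_(n2, r)) (mu0 : R),
    is_svd Gy U s V ->
    0 < mu0 -> incoherent n mu0 U V ->
  forall eps0 mu : R,
    0 < eps0 -> eps0 <= 11^-1 -> mu0 <= mu ->
  let cs : R := c_s n n1 n2 in
  let kappa := sigma 1 Gy / sigma r Gy in
  forall (m : nat) (d : measure_display) (T : measurableType d)
      (P : probability T R) (a : 'I_m -> T -> 'I_n),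
    iid_uniform P a ->
    c2 * eps0 ^- 2 * mu ^+ 2 * cs ^+ 2 * kappa ^+ 2 * r%:R ^+ 2 * ln n%:R <= m%:R ->
  forall eta : R,
    0 < eta ->
    eta <= sigma r Gy / (600 * (mu * cs * r%:R) ^+ 2 * sigma 1 Gy ^+ 2) ->
  let M := balanced U s V in
  let lam : R := 1 / 4 in
  let nu := 1 / 10 * sigma r Gy in
  let good := [set w : T |
    forall (L0 : 'M[R[i]]_(n1, n2))
        (U0 : 'M[R[i]]_(n1, r)) (s0 : 'rV[R]_r) (V0 : 'M[R[i]]_(n2, r)),
      pgd_init y (a ^~ w) L0 U0 s0 V0 ->
      let sig := sigma 1 L0 / (1 - eps0) in
      let Z := pgd_iter y (a ^~ w) lam mu sig eta (balanced U0 s0 V0) in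
      forall k : nat, (1 <= k)%N ->
        dist (Z k) M ^+ 2 <= (1 - eta * nu) ^+ k * dist (Z 0%N) M ^+ 2] in
  ((1 - c1 * n%:R ^- 2)%:E <= P good)%E.
Proof.
exists 6, (400 * 300); split; first by rewrite ltr0n.
split; first by rewrite mulr_gt0 ?ltr0n.
move=> n n1 n2 r n1_gt0 n2_gt0 n12 r_gt0 x _ x_rank y Gy U s V mu0 y_svd mu00 [U_inc V_inc].
move=> eps0 mu eps00 eps01 mu_ge cs kappa m d T P a a_iid samples eta eta0 eta_le; lazy zeta.
pose i0 := Ordinal r_gt0.
have ir_lt : (r.-1 < r)%N by rewrite prednK.
pose ir := Ordinal ir_lt.
have s1E : sigma 1 Gy = s 0 i0 by exact: (sigma_svd i0 y_svd).
have srE : sigma r Gy = s 0 ir by rewrite -(sigma_svd ir y_svd) /= prednK.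
have GyE : Gy = hankel n1 n2 x by exact: opG_opD.
have x_svd : is_svd (hankel n1 n2 x) U s V by rewrite -GyE.
have s_gt0 := svd_pos x_svd x_rank.
have [UU VV [_ s_sorted] _] := y_svd.
have s_le i : s 0 i <= s 0 i0 by exact: s_sorted.
have sr_le i : s 0 ir <= s 0 i by apply: s_sorted; rewrite -ltnS /= prednK.
have n1_le := n1_le_n n2_gt0 n12; have n2_le := n2_le_n n1_gt0 n12.
have n_gt0 : (0 < n)%N by exact: leq_trans n1_gt0 n1_le.
(* For [n = 1] the claimed lower bound [1 - 6] is negative; otherwise [ln n > 0], so that the
   sample-size condition forces [m > 0]. *)
case: (ltnP 1 n) => [n_gt1|n_le1]; last first.
  have n1E : n = 1%N by apply/eqP; rewrite eqn_leq n_le1.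
  rewrite [in n%:R ^+ 2]n1E expr1n invr1 mulr1; apply: le_trans (measure_ge0 P _).
  by rewrite lee_fin; lra.
have cs0 : 0 <= cs by rewrite /cs /c_s le_max divr_ge0.
set m0 := mu * cs * r%:R.
have c_le : mu0 * cs * r%:R / n%:R <= m0 / n%:R.
  by rewrite ler_wpM2r ?invr_ge0 // ler_wpM2r // ler_wpM2r.
have c0_ge0 : 0 <= mu0 * cs * r%:R / n%:R by rewrite divr_ge0 // mulr_ge0 // mulr_ge0 // ltW.
have Uc := norm2inf_row_bounded c0_ge0 c_le U_inc.
have Vc := norm2inf_row_bounded c0_ge0 c_le V_inc.
have m00 : 0 <= m0 by rewrite mulr_ge0 // mulr_ge0 // (le_trans (ltW mu00)).
have rm := orthonormal_row_bounded n_gt0 n1_le m00 UU Uc.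
have m01 : 1 <= m0 by apply: le_trans rm; rewrite ler1n.
rewrite /kappa s1E srE in samples.
have {}samples := samples_rescale (s_gt0 ir) eps00 samples.
rewrite s1E srE in eta_le.
have m_gt0 : (0 < m)%N.
  rewrite -(ltr0n R); apply: (samples_gt0 (s_gt0 ir) (sr_le i0) m01 eps00 samples).
  by rewrite ln_gt0 // ltr1n.
have [w w_prim] := @prim_root_exists R n n_gt0.
have [B B_le BP] := bad_samples_count n_gt0 n1_gt0 n2_gt0 n12 m_gt0 x_svd (s_gt0 ir) (sr_le i0)
  s_le Uc Vc m01 r_gt0 rm eps00 eps01 w_prim samples.
rewrite srE.
apply: (prob_sample_ge a_iid n_gt0 _ B_le
  (G := fun f => forall L0 U0 (s0 : 'rV[R]_r) V0, pgd_init y f L0 U0 s0 V0 ->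
    let sig := sigma 1 L0 / (1 - eps0) in
    let Z := pgd_iter y f (1 / 4) mu sig eta (balanced U0 s0 V0) in
    forall k : nat, (1 <= k)%N ->
      dist (Z k) (balanced U s V) ^+ 2 <= (1 - eta * (1 / 10 * s 0 ir)) ^+ k * dist (Z 0%N) (balanced U s V) ^+ 2)).
move=> f /BP[dev_x dev_1 rip] L0 U0 s0 V0 init sig Z k _.
have [_ L0svd] := init.
have s0E : sigma 1 L0 = s0 0 i0 by exact: (sigma_svd i0 L0svd).
rewrite /Z /sig s0E.
exact: (pgd_linear_convergence n_gt0 n1_gt0 n2_gt0 n12 m_gt0 y_svd (s_gt0 ir)
  _ sr_le Uc Vc m01 eps00 eps01 eta0 eta_le w_prim dev_x dev_1 rip init).
Qed.
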